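(* Let $\epsilon\in(0,2)$ and let $\mathcal{L}^2=L^2(-\pi,\pi)$. Let $L$ be the operator in $\mathcal{L}^2$ given by $(Ly)(x)=\epsilon\,(\sin(x)\,y'(x))'+y'(x)$, with domain consisting of all absolutely continuous $2\pi$-periodic functions $y$ (i.e. $y(-\pi)=y(\pi)$) for which $\sin(x)y'(x)$ is locally absolutely continuous and $(Ly)(x)\in\mathcal{L}^2$. Let $L_0$ be the restriction of $L$ to the set of all smooth $2\pi$-periodic functions, and $\bar{L}_0$ its closure. Then $L=\bar{L}_0$. Moreover, let $J$ be the operator on $\mathcal{L}^2$ defined by $(Jf)(x)=f(\pi-x)$ (with functions regarded as $2\pi$-periodic); then $L=JL^{*}J$, i.e. $L$ is $J$-self-adjoint in the Krein space $(\mathcal{L}^2,[\cdot,\cdot])$ with indefinite inner product $[f,g]=\langle Jf,g\rangle$.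
   Context: $L^*$ denotes the Hilbert-space adjoint of $L$ in $L^2(-\pi,\pi)$. An operator $T$ is called $J$-self-adjoint if $T=JT^*J$, where $J$ is a self-adjoint involution (fundamental symmetry) defining the Krein space. *)

(* Defs.v *)
(* mathcomp-analysis (Lebesgue integration on a realType R)
   + real_closed's complex numbers R[i]. *)
From HB Require Import structures.
From mathcomp Require Import all_boot all_order all_algebra.
From mathcomp Require Import all_classical all_reals all_analysis.
From mathcomp Require Import complex.
Set Implicit Arguments. Unset Strict Implicit. Unset Printing Implicit Defensive.
Import Order.TTheory GRing.Theory Num.Theory.
Import numFieldNormedType.Exports.
Local Open Scope classical_set_scope.
Local Open Scope ring_scope.
Local Open Scope complex_scope.

Section KreinDefs.
Variable R : realType.

(* complex-valued functions on the real line; only their values on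
   [-pi, pi] matter for L^2(-pi, pi) *)
Definition Cfun := R -> R[i].

Definition Iint : set R := `[- pi, pi]%classic.

Definition leb := (@lebesgue_measure R).

Definition ReF (f : Cfun) : R -> R := fun x => complex.Re (f x).
Definition ImF (f : Cfun) : R -> R := fun x => complex.Im (f x).

(* f is (the representative of) an element of L^2(-pi,pi) *)
Definition L2 (f : Cfun) : Prop :=
  [/\ measurable_fun Iint (ReF f), measurable_fun Iint (ImF f) &
      (\int[leb]_(x in Iint) ((ReF f x) ^+ 2 + (ImF f x) ^+ 2)%:E < +oo)%E].

(* squared L^2 distance *)
Definition dist2 (f g : Cfun) : \bar R :=
  (\int[leb]_(x in Iint) ((ReF f x - ReF g x) ^+ 2 + (ImF f x - ImF g x) ^+ 2)%:E)%E.

(* L^2 inner product <f, g> = \int f * conj g *)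
Definition inner (f g : Cfun) : R[i] :=
  (Rintegral leb Iint (fun x => complex.Re (f x * (g x)^*)))
  +i* (Rintegral leb Iint (fun x => complex.Im (f x * (g x)^*))).

(* equality a.e. on (-pi, pi), i.e. equality in L^2 *)
Definition aeI (f g : Cfun) : Prop := ae_eq leb Iint f g.

(* absolute continuity of a real function on [a, b] *)
Definition abs_cont (a b : R) (f : R -> R) : Prop :=
  forall e : R, 0 < e -> exists2 d : R, 0 < d &
    forall (n : nat) (s t : nat -> R),
      (forall k, (k < n)%N -> a <= s k /\ s k <= t k /\ t k <= b) ->
      (forall k, (k.+1 < n)%N -> t k <= s k.+1) ->
      \sum_(k < n) (t k - s k) < d ->
      \sum_(k < n) `|f (t k) - f (s k)| < e.

Definition cabs_cont (a b : R) (f : Cfun) : Prop :=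
  abs_cont a b (ReF f) /\ abs_cont a b (ImF f).

(* locally absolutely continuous on (-pi, pi) *)
Definition loc_abs_cont (f : Cfun) : Prop :=
  forall a b : R, - pi < a -> b < pi -> cabs_cont a b f.

(* derivative of a complex-valued function of a real variable *)
Definition cderiv (f : Cfun) : Cfun :=
  fun x => (derive1 (ReF f) x) +i* (derive1 (ImF f) x).

(* operators are represented by their graphs (sets of pairs (y, Ly)) *)
Definition graph := set (Cfun * Cfun).

(* the graph of L: (y, g) with g = Ly in L^2 *)
Definition graphL (eps : R) : graph := fun yg =>
  let y := yg.1 in let g := yg.2 in
  [/\ L2 y, L2 g, cabs_cont (- pi) pi y, y (- pi) = y pi &
      exists p : Cfun,
        [/\ loc_abs_cont p,
            aeI p (fun x => (sin x)%:C * cderiv y x) &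
            aeI g (fun x => eps%:C * cderiv p x + cderiv y x)]].

(* smooth 2pi-periodic functions *)
Definition smooth_periodic (y : Cfun) : Prop :=
  (forall (n : nat) (x : R),
     derivable (derive1n n (ReF y)) x 1 /\ derivable (derive1n n (ImF y)) x 1) /\
  (forall x : R, y (x + 2 * pi) = y x).

(* L_0 : restriction of L to smooth periodic functions *)
Definition graphL0 (eps : R) : graph :=
  fun yg => graphL eps yg /\ smooth_periodic yg.1.

(* closure in L^2 x L^2 of a graph *)
Definition closure_op (G : graph) : graph := fun fg =>
  [/\ L2 fg.1, L2 fg.2 &
      exists u : nat -> Cfun * Cfun,
        [/\ forall n, G (u n),
            dist2 (u n).1 fg.1 @[n --> \oo] --> 0%E &
            dist2 (u n).2 fg.2 @[n --> \oo] --> 0%E]].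

(* Hilbert space adjoint: (g, h) with <Ly, g> = <y, h> for all y in dom L *)
Definition adjoint (G : graph) : graph := fun gh =>
  [/\ L2 gh.1, L2 gh.2 &
      forall yf, G yf -> inner yf.2 gh.1 = inner yf.1 gh.2].

(* (J f)(x) = f(pi - x), f regarded as 2pi-periodic *)
Definition Jop (f : Cfun) : Cfun :=
  fun x => if 0 < x then f (pi - x) else f (- pi - x).

(* graph of J T J *)
Definition Jconj (G : graph) : graph := fun q =>
  exists2 p, G p & q = (Jop p.1, Jop p.2).

(* equality of operators in L^2 (graphs equal modulo a.e. equality) *)
Definition op_eq (G H : graph) : Prop :=
  (forall p, G p -> exists2 q, H q & aeI p.1 q.1 /\ aeI p.2 q.2) /\
  (forall q, H q -> exists2 p, G p & aeI p.1 q.1 /\ aeI p.2 q.2).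

End KreinDefs.

(* Main.v *)
(* Write the equation Ly = f as p' + y' = f with the flux p = eps sin y'.  Integrating once,
   p = y(-pi) + int f - y, and p vanishes at the zeros -pi, 0, pi of sin.  Hence int f = 0,
   and a maximum principle (p = 0 where y is extremal) bounds the oscillation of y by that
   of int f, so that y is controlled in L^2 modulo constants by f.

   Conversely, variation of constants with the integrating factor tan(x/2)^(1/eps) solves
   the equation for every f in L^2 of mean zero, with p^2 <= E |sin|; this uses that int f
   is Hoelder continuous of exponent 1/2 together with eps < 2.  So the range of L consists
   of the functions of mean zero and its kernel of the constants, which makes L closed.

   For the smooth core, cut off y' = p / sin logarithmically at the poles: the error made
   in the equation has squared norm O(1 / l), l being the length of the cutoff in logarithmic
   scale, because p^2 <= E |sin|.  The resulting derivative has an L^2 derivative, and approximating the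
   latter by smooth periodic functions approximates f by L_0 y.

   Since sin(pi - x) = sin x, integrating by parts on [-pi, 0] and on [0, pi] gives
   <Ly, Jz> = <y, JLz>, so JLJ is contained in L^*.  If (u, h) is in the graph of L^*,
   testing with constants shows int h = 0; solving Lz = Jh, the function u - Jz is
   orthogonal to the range of L, hence constant. *)
Require Import Defs.
From HB Require Import structures.
From mathcomp Require Import all_boot all_order all_algebra.
From mathcomp Require Import all_classical all_reals all_analysis.
From mathcomp Require Import measurable_realfun.
From mathcomp Require Import complex lra ring zify.
Set Implicit Arguments. Unset Strict Implicit. Unset Printing Implicit Defensive.
Import Order.TTheory GRing.Theory Num.Theory.
Import numFieldNormedType.Exports.
Local Open Scope classical_set_scope.
Local Open Scope ring_scope.

(** * Absolutely continuous functions are primitives *)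

(** The condition [eps < 2] acts at the pole pi. In the variable u = tan(x/2)^(1/eps) the solution
    on [0, pi] is the average over [0, u] of the right-hand side. Hoelder continuity of exponent 1/2
    makes the deviation from the value at pi of size u^(-eps/2), integrable at u = 0 exactly when
    eps < 2. The average then keeps this rate, which is the square root of the distance to pi, and
    p^2 <= E |sin| follows. Starting the integral at u = 0 excludes the homogeneous solution 1/u,
    unbounded at the pole 0. The cutoff has to be logarithmic. If chi cuts off y', the delicate
    error is chi' p, of squared norm at most E times the integral of chi'^2 |sin|. Near a pole this
    is the Dirichlet energy of a radial function in the plane, which is invariant under dilation: a
    cutoff at one scale leaves an error of fixed size, however small the scale, and only spreading
    it over many scales makes the error small. *)

Section AbsoluteContinuity.
Context {R : realType}.
Implicit Types (a b c : R) (f g h : R -> R) (l : seq (R * R)).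
Notation mu := (@lebesgue_measure R).

(** List form of the interval families in [abs_cont], so that they can be concatenated and treated
    by induction. Neighbours may touch and intervals may be degenerate. *)
Fixpoint itv_chain a b l : bool :=
  if l is p :: l' then (a <= p.1 <= p.2) && itv_chain p.2 b l' else a <= b.

Definition chain_len l := \sum_(p <- l) (p.2 - p.1).
Definition chain_var f l := \sum_(p <- l) `|f p.2 - f p.1|.

Lemma itv_chain_le a b l : itv_chain a b l -> a <= b.
Proof.
elim: l a => //= p l ih a /andP[/andP[ap pp]] /ih; apply: le_trans.
exact: le_trans pp.
Qed.

Lemma itv_chain_wideL a a' b l : a' <= a -> itv_chain a b l -> itv_chain a' b l.
Proof.
case: l => /= [|p l] aa; first exact: le_trans.
by move=> /andP[/andP[ap ->] ->]; rewrite !andbT (le_trans aa).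
Qed.

Lemma itv_chain_cat a b c l1 l2 :
  itv_chain a b l1 -> itv_chain b c l2 -> itv_chain a c (l1 ++ l2).
Proof.
elim: l1 a => /= [a ab|p l ih a /andP[-> pl] l2c]; first exact: itv_chain_wideL.
by rewrite /= ih.
Qed.

Lemma itv_chain_nth a b l k : itv_chain a b l -> (k < size l)%N ->
  [/\ a <= (nth (0, 0) l k).1, (nth (0, 0) l k).1 <= (nth (0, 0) l k).2,
      (nth (0, 0) l k).2 <= b &
      ((k.+1 < size l)%N -> (nth (0, 0) l k).2 <= (nth (0, 0) l k.+1).1)].
Proof.
elim: l a k => //= p l ih a [|k] /= /andP[/andP[ap pp]] pl.
  move=> _; split => //; first exact: itv_chain_le pl.
  by case: l pl {ih} => //= q l /andP[/andP[]].
rewrite ltnS => /(ih _ _ pl)[h1 h2 h3 h4]; split => //.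
by apply: le_trans h1; exact: le_trans pp.
Qed.

Lemma itv_chain_iota (s t : nat -> R) a b m n :
  (forall k, (m <= k < m + n)%N -> s k <= t k <= b) ->
  (forall k, (m <= k)%N -> (k.+1 < m + n)%N -> t k <= s k.+1) ->
  a <= b -> ((0 < n)%N -> a <= s m) ->
  itv_chain a b [seq (s k, t k) | k <- iota m n].
Proof.
elim: n m a => //= n ih m a st ts ab am.
have /andP[sm tb] : s m <= t m <= b by apply: st; lia.
rewrite am//= sm /=; apply: ih => //.
- by move=> k kmn; apply: st; lia.
- by move=> k mk kn; apply: ts; lia.
- by move=> n0; apply: ts; lia.
Qed.

Lemma abs_contP a b f : a <= b -> abs_cont a b f <->
  forall e : R, 0 < e -> exists2 d : R, 0 < d & forall l, itv_chain a b l ->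
    chain_len l < d -> chain_var f l < e.
Proof.
move=> ab; split=> [acf e /acf[d d0 fd]|acf e /acf[d d0 fd]]; exists d => //.
  move=> l chl ld; rewrite /chain_var (big_nth (0, 0)) big_mkord.
  apply: (fd _ (fun k => (nth (0, 0) l k).1) (fun k => (nth (0, 0) l k).2)).
  - by move=> k /(itv_chain_nth chl)[].
  - by move=> k kl; have [_ _ _] := itv_chain_nth chl (ltnW kl); apply.
  - by move: ld; rewrite /chain_len (big_nth (0, 0)) big_mkord.
move=> n s t stab ts std.
have := fd [seq (s k, t k) | k <- iota 0 n].
rewrite /chain_len /chain_var !big_map -/(index_iota 0 n) -{2 3}(subn0 n).
rewrite -/(index_iota 0 n) !big_mkord; apply => //.
apply: itv_chain_iota => //.
- by move=> k /andP[_ /stab[_ [-> ->]]].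
- by move=> k _; exact: ts.
- by move=> /stab[].
Qed.

Lemma itv_partition_chain a b f (s : seq R) : itv_partition a b s ->
  exists l, [/\ itv_chain a b l, chain_len l = b - a &
                chain_var f l = variation a b f s].
Proof.
elim: s a => [a /itv_partition_nil ->|x s ih a abs].
  exists [::]; rewrite /= /chain_len /chain_var /variation !big_nil subrr.
  by split.
have [l [xbl lenl varl]] := ih _ (itv_partition_cons abs).
have ax : a <= x by case: abs => /= /andP[/ltW].
exists ((a, x) :: l); split => /=; first by rewrite lexx ax.
- by rewrite /chain_len big_cons /= -/(chain_len l) lenl; ring.
- rewrite /chain_var big_cons -/(chain_var f l) varl /= /variation.
  rewrite big_nat_recl//=; congr +%R.
Qed.

Lemma chain_var_cat f l1 l2 :
  chain_var f (l1 ++ l2) = chain_var f l1 + chain_var f l2.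
Proof. by rewrite /chain_var big_cat. Qed.

Lemma chain_len_cat l1 l2 : chain_len (l1 ++ l2) = chain_len l1 + chain_len l2.
Proof. by rewrite /chain_len big_cat. Qed.

Lemma abs_contS a b c d f : a <= c -> d <= b -> abs_cont a b f -> abs_cont c d f.
Proof.
move=> ac db acf e /acf[del del0 fd]; exists del => // n s t st ts.
apply: fd => // k /st[h1 [h2 h3]].
by split; [exact: le_trans h1|split => //; exact: le_trans db].
Qed.

(** Take the [d] belonging to tolerance 1 and cut [[a, b]] into [N.+1] pieces shorter than [d]: the
    variation is at most 1 on each piece. *)
Lemma abs_cont_bounded_variation a b f : a <= b -> abs_cont a b f ->
  bounded_variation a b f.
Proof.
move=> ab /(abs_contP f ab) /(_ 1 ltr01)[d d0 fd].
have fdTV x y : a <= x -> x <= y -> y <= b -> y - x < d ->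
    (total_variation x y f <= 1%:E)%E.
  move=> ax xy yb yxd; apply: ge_ereal_sup => _ [_ [s xys <-] <-].
  have [l [ls len var]] := itv_partition_chain f xys.
  rewrite lee_fin -var ltW//; apply: fd; last by rewrite len.
  apply: (itv_chain_wideL ax); rewrite -(cats0 l); exact: itv_chain_cat ls _.
pose N := Num.truncn ((b - a) / d).
pose h := (b - a) / N.+1%:R.
have hd : h < d.
  rewrite /h ltr_pdivrMr// -ltr_pdivrMl// mulrC.
  by have := truncnS_gt ((b - a) / d).
have h0 : 0 <= h by rewrite divr_ge0// subr_ge0.
have bE : b = a + N.+1%:R * h by rewrite /h mulrC divfK// addrC subrK.
have aux k : (k <= N.+1)%N ->
    (total_variation a (a + k%:R * h) f <= k%:R%:E)%E.
  elim: k => [|k ih kN]; first by rewrite mul0r addr0 total_variationxx.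
  have hk : a + k.+1%:R * h <= b by rewrite [leRHS]bE lerD2l ler_wpM2r// ler_nat.
  rewrite (@total_variationD _ a _ (a + k%:R * h)); last 2 first.
  - by rewrite lerDl mulr_ge0.
  - by rewrite lerD2l ler_wpM2r// ler_nat.
  rewrite -natr1 EFinD leeD//; first exact/ih/ltnW.
  apply: fdTV => //.
  - by rewrite lerDl mulr_ge0.
  - by rewrite lerD2l ler_wpM2r// lerDl.
  - by rewrite natr1.
  - by lra.
apply/(bounded_variationP f ab); rewrite ge0_fin_numE ?total_variation_ge0//.
by rewrite {1}bE (le_lt_trans (aux _ (leqnn _)))// ltry.
Qed.

Lemma total_variation_chain a b f : a <= b -> bounded_variation a b f ->
  forall e : R, 0 < e -> exists l, [/\ itv_chain a b l, chain_len l = b - a &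
    fine (total_variation a b f) - e < chain_var f l].
Proof.
move=> ab /(bounded_variationP f ab) TVfin e e0.
have : ((fine (total_variation a b f) - e)%:E < total_variation a b f)%E.
  by rewrite -[ltRHS]fineK// lte_fin ltrBlDr ltrDl.
move=> /ereal_sup_gt[_ [_ [s abs <-] <-]]; rewrite lte_fin => es.
have [l [ls len var]] := itv_partition_chain f abs.
by exists l; rewrite var.
Qed.

Definition tv a f x : R := fine (total_variation a x f).

Lemma tvD a b f x y : bounded_variation a b f -> a <= x -> x <= y -> y <= b ->
  tv a f y - tv a f x = fine (total_variation x y f).
Proof.
move=> bvf ax xy yb; rewrite /tv (total_variationD f ax xy) fineD; first by ring.
- apply/(bounded_variationP f ax); apply: bounded_variationl bvf => //.
  exact: le_trans yb.
- apply/(bounded_variationP f xy); apply: (@bounded_variationr _ a) => //.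
  by apply: bounded_variationl bvf => //; exact: le_trans xy.
Qed.

Lemma tv_ge a b f x y : bounded_variation a b f -> a <= x -> x <= y -> y <= b ->
  `|f y - f x| <= tv a f y - tv a f x.
Proof.
move=> bvf ax xy yb; rewrite (tvD bvf ax xy yb) -lee_fin fineK.
  exact: total_variation_ge.
apply/(bounded_variationP f xy); apply: (@bounded_variationr _ a) => //.
by apply: bounded_variationl bvf => //; exact: le_trans xy.
Qed.

(** Each interval of [l] is replaced by a partition of it that nearly attains the variation of [f]
    there. The total length is unchanged and at most [e] is lost per interval. *)
Lemma tv_chain a b f l (e : R) : 0 < e -> a <= b -> bounded_variation a b f ->
  itv_chain a b l -> exists l', [/\ itv_chain a b l', chain_len l' = chain_len l &
    chain_var (tv a f) l - (size l)%:R * e <= chain_var f l'].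
Proof.
move=> e0 ab bvf abl; suff : forall a0, a <= a0 -> itv_chain a0 b l ->
    exists l', [/\ itv_chain a0 b l', chain_len l' = chain_len l &
      chain_var (tv a f) l - (size l)%:R * e <= chain_var f l'] by apply.
elim: l {abl} => [a0 aa0 a0b|p l ih a0 aa0 /= /andP[/andP[a0p pp] pl]].
  by exists [::]; rewrite /chain_len /chain_var !big_nil; split => //=; lra.
have ap := le_trans aa0 a0p; have pb := itv_chain_le pl.
have [l1 [pl1 len1 var1]] := ih _ (le_trans ap pp) pl.
have bvp : bounded_variation p.1 p.2 f.
  apply: (@bounded_variationr _ a) => //.
  by apply: bounded_variationl bvf => //; exact: le_trans pp.
have [l2 [pl2 len2 var2]] := total_variation_chain pp bvp e0.
exists (l2 ++ l1); split.
- apply: (itv_chain_wideL a0p); exact: itv_chain_cat pl1.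
- by rewrite chain_len_cat len2 len1 /chain_len big_cons.
- rewrite chain_var_cat {1}/chain_var big_cons -/(chain_var _ _).
  rewrite ger0_norm; last by rewrite (le_trans _ (tv_ge bvf ap pp pb)).
  rewrite (tvD bvf ap pp pb) -natr1; lra.
Qed.

Lemma abs_cont_tv a b f : a <= b -> abs_cont a b f -> abs_cont a b (tv a f).
Proof.
move=> ab acf; have bvf := abs_cont_bounded_variation ab acf.
apply/(abs_contP _ ab) => e e0.
have [|d d0 fd] := (abs_contP f ab).1 acf (e / 2); first by rewrite divr_gt0.
exists d => // l abl ld.
(* The loss allowed per interval, so that all losses add up to at most [e / 2]; the successor covers
   the empty chain. *)
have e1 : 0 < e / 2 / (size l).+1%:R by rewrite !divr_gt0.
have [l' [abl' len' var']] := tv_chain e1 ab bvf abl.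
have {fd} := fd _ abl'; rewrite len' => /(_ ld) fl'.
have : (size l)%:R * (e / 2 / (size l).+1%:R) <= e / 2.
  rewrite mulrA ler_pdivrMr// mulrC ler_wpM2l ?ler_nat//.
  by rewrite divr_ge0// ltW.
by move: var'; set t := _%:R * _; lra.
Qed.

End AbsoluteContinuity.

(** * Stieltjes measures of absolutely continuous functions vanish on null sets *)

Section LebesgueStieltjesAC.
Context {R : realType}.
Implicit Types (a b x : R) (V : cumulative R R).
Notation mu := (@lebesgue_measure R).
Notation LS := (@lebesgue_stieltjes_measure R).

Lemma LS_itvoc V a b : a <= b -> LS V `]a, b]%classic = (V b - V a)%:E.
Proof.
move=> ab; rewrite /LS /lebesgue_stieltjes_measure/= /measure_extension measurable_mu_extE/=; last exact: is_ocitv.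
exact: wlength_itv_bnd.
Qed.

Lemma measure_bigsetU_oc (m : {measure set (measurableTypeR R) -> \bar R})
    (s t : nat -> R) n :
  (forall k, (k < n)%N -> s k <= t k) ->
  (forall k, (k.+1 < n)%N -> t k <= s k.+1) ->
  m (\big[setU/set0]_(k < n) `]s k, t k]%classic) =
  (\sum_(k < n) m `]s k, t k]%classic)%E.
Proof.
elim: n => [|n ih] st ts; first by rewrite !big_ord0 measure0.
have mU k : measurable (\big[setU/set0]_(k < k) `]s k, t k]%classic : set R).
  by apply: bigsetU_measurable => i _.
rewrite !big_ord_recr/= measureU//; [|exact: mU|].
  by congr (_ + _)%E; apply: ih => k kn; [apply: st|apply: ts]; lia.
have mono j : (j <= n)%N -> forall k, (k < j)%N -> t k <= s j.
  elim: j => [|j ihj] jn k kj //.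
  have [{}kj|jk] := ltnP k j.
    apply: le_trans (ihj (ltnW jn) _ kj) _.
    by apply: le_trans (st j _) (ts j _); lia.
  have -> : k = j by lia.
  exact: ts.
rewrite -(bigcup_mkord n (fun k => `]s k, t k]%classic)) -subset0.
move=> x [[k /= kn]].
rewrite !in_itv/= => /andP[_ xt] /andP[+ _].
by rewrite ltNge (le_trans xt)// (mono n).
Qed.

Lemma grid_cell a h n x : 0 < h -> a < x -> x <= a + n%:R * h ->
  exists2 k, (k < n)%N & a + k%:R * h < x <= a + k.+1%:R * h.
Proof.
move=> h0 ax; elim: n => [|n ih]; first by rewrite mul0r addr0 leNgt ax.
move=> xn; have [|nx] := leP x (a + n%:R * h); last by exists n => //; rewrite nx.
by move=> /ih[k kn xk]; exists k => //; exact: ltnW.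
Qed.

(** The open set is exhausted by the dyadic half-open cells that it contains. The cells of one level
    form a chain of total length below [d], hence have Stieltjes measure below [e], and continuity
    from below passes to the union. *)
Lemma LS_abs_cont_open V a b (e d : R) (U : set R) : a < b -> 0 < e -> 0 < d ->
  (forall l, itv_chain a b l -> chain_len l < d -> chain_var V l < e) ->
  open U -> (mu U < d%:E)%E -> (LS V (U `&` `]a, b]) <= e%:E)%E.
Proof.
move=> ab e0 d0 Vd oU Ud.
pose h n := (b - a) / (2 ^ n)%:R.
have h0 n : 0 < h n by rewrite divr_gt0 ?subr_gt0// ltr0n expn_gt0.
have hS n : h n = 2 * h n.+1.
  by rewrite /h expnSr natrM; field; rewrite pnatr_eq0 -lt0n expn_gt0.
pose s n k := a + k%:R * h n.
pose inU n k := `[< `]s n k, s n k.+1]%classic `<=` U >].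
have inUP n k : reflect (`]s n k, s n k.+1]%classic `<=` U) (inU n k).
  exact: asboolP.
(* A cell not contained in [U] is collapsed to the empty set []s, s]], so that every level keeps all
   indices below [2 ^ n] and remains a chain. *)
pose t n k := if inU n k then s n k.+1 else s n k.
have sS n k : s n k <= s n k.+1 by rewrite lerD2l ler_wpM2r ?(ltW (h0 n))// ler_nat.
have smono n i j : (i <= j)%N -> s n i <= s n j.
  by move=> ij; rewrite lerD2l ler_wpM2r ?(ltW (h0 n))// ler_nat.
have sN n : s n (2 ^ n)%N = b.
  by rewrite /s /h mulrC divfK ?subrKC// pnatr_eq0 -lt0n expn_gt0.
have s0 n : s n 0%N = a by rewrite /s mul0r addr0.
have st n k : s n k <= t n k by rewrite /t; case: ifP.
have tS n k : t n k <= s n k.+1 by rewrite /t; case: ifP.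
pose W n := \big[setU/set0]_(k < 2 ^ n) `]s n k, t n k]%classic.
have WE n : W n = \bigcup_(k < 2 ^ n) `]s n k, t n k]%classic by rewrite bigcup_mkord.
have mW n : measurable (W n : set R) by apply: bigsetU_measurable => i _.
have WU n : W n `<=` U `&` `]a, b].
  move=> x; rewrite WE => -[k /= kn]; rewrite in_itv/=.
  rewrite /t; case: (inUP _ _) => [kU|_] /andP[sx xt]; last first.
    by move: sx; rewrite ltNge xt.
  split; first by apply: kU; rewrite /= in_itv/= sx.
  rewrite /= in_itv/= (le_lt_trans _ sx)/= ?(le_trans xt)//.
    by rewrite -(sN n) smono.
  by rewrite -(s0 n) smono.
have ndW : nondecreasing_seq W.
  apply/nondecreasing_seqP => n; apply/subsetPset => x.
  rewrite !WE => -[k /= kn]; rewrite in_itv/= {1}/t.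
  case: (inUP _ _) => [kU|_] /andP[sx xt]; last by move: sx; rewrite ltNge xt.
  have sE1 : s n.+1 k.*2 = s n k by rewrite /s (hS n) -muln2 natrM; ring.
  have sE2 : s n.+1 k.*2.+2 = s n k.+1.
    by rewrite /s (hS n) -doubleS -muln2 natrM; ring.
  have lt2 : (2 ^ n.+1 = (2 ^ n).*2)%N by rewrite expnS mul2n.
  have [xm|mx] := leP x (s n.+1 k.*2.+1).
    exists k.*2 => /=; first by lia.
    rewrite in_itv/= sE1 sx /t; case: (inUP _ _) => // -[] y /=; rewrite in_itv/= sE1.
    move=> /andP[sy yt]; apply: kU; rewrite /= in_itv/= sy/= (le_trans yt)//.
    by rewrite -sE2.
  exists k.*2.+1 => /=; first by lia.
  rewrite in_itv/= mx /t; case: (inUP _ _); rewrite sE2 // => -[] y /=.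
  rewrite in_itv/= => /andP[sy yt]; apply: kU; rewrite /= in_itv/= yt andbT.
  by rewrite -sE1 (le_lt_trans _ sy).
have UW : U `&` `]a, b] = \bigcup_n W n.
  apply/seteqP; split; last by move=> x [n _]; exact: WU.
  move=> x [Ux]; rewrite /= in_itv/= => /andP[ax xb].
  have [r /= r0 xr] : exists2 r, 0 < r & ball x r `<=` U.
    by apply/nbhs_ballP; exact: open_nbhs_nbhs.
  have [n hn] : exists n, h n < r.
    exists (Num.truncn ((b - a) / r)).
    rewrite /h ltr_pdivrMr ?ltr0n ?expn_gt0// mulrC -ltr_pdivrMr//.
    apply: lt_le_trans (truncnS_gt _) _.
    by rewrite ler_nat ltn_expl.
  exists n => //; have := @grid_cell a (h n) (2 ^ n)%N x (h0 n) ax.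
  rewrite -/(s n (2 ^ n)%N) sN => /(_ xb)[k kn].
  rewrite -/(s n k) -/(s n k.+1) => /andP[sx xs].
  rewrite WE; exists k => //=; rewrite in_itv/= sx/= /t.
  case: (inUP _ _) => // -[] y /=; rewrite in_itv/= => /andP[sy ys]; apply: xr.
  have sSE : s n k.+1 = s n k + h n by rewrite /s -natr1; ring.
  by rewrite /ball/= ltr_distl; apply/andP; split; lra.
have chainW n : itv_chain a b [seq (s n k, t n k) | k <- iota 0 (2 ^ n)].
  apply: itv_chain_iota; rewrite ?s0 ?(ltW ab)//.
  move=> k /andP[_ kn]; rewrite st/= (le_trans (tS _ _))// -(sN n).
  exact: smono.
have mU : measurable U by exact: open_measurable.
have mUW : measurable (U `&` `]a, b] : set R) by exact: measurableI.
have LSW n : (LS V (W n) <= e%:E)%E.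
  have muW : (mu (W n) < d%:E)%E.
    apply: le_lt_trans Ud; apply: le_measure; rewrite ?inE.
    - exact: mW.
    - exact: mU.
    - by move=> x /WU[].
  rewrite /W measure_bigsetU_oc//.
  rewrite (eq_bigr (fun k : 'I_(2 ^ n) => (V (t n k) - V (s n k))%:E)); last first.
    by move=> k _; exact: LS_itvoc.
  rewrite sumEFin lee_fin.
  have H : \sum_(k < 2 ^ n) (t n k - s n k) < d ->
      \sum_(k < 2 ^ n) `|V (t n k) - V (s n k)| < e.
    have := Vd _ (chainW n); rewrite /chain_len /chain_var !big_map.
    have -> : iota 0 (2 ^ n) = index_iota 0 (2 ^ n) by rewrite /index_iota subn0.
    by rewrite !big_mkord.
  apply: le_trans (ltW (H _)); first by apply: ler_sum => k _; exact: ler_norm.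
  rewrite -lte_fin -sumEFin (le_lt_trans _ muW)// /W measure_bigsetU_oc//.
  by apply: lee_sum => k _; rewrite [leRHS](@LS_itvoc idfun).
have cvgW : LS V \o W @ \oo --> LS V (\bigcup_n W n).
  by apply: nondecreasing_cvg_mu => //; rewrite -UW.
rewrite UW -(cvg_lim (@ereal_hausdorff R) cvgW).
by apply: lime_le; [exact: cvgP cvgW|apply: nearW => n /=; exact: LSW].
Qed.

(** Outer regularity places a null set inside an open set of arbitrarily small Lebesgue measure. *)
Lemma LS_abs_cont_null V a b (N : set R) : a < b -> abs_cont a b V ->
  measurable N -> mu N = 0%E -> LS V (N `&` `]a, b]) = 0%E.
Proof.
move=> ab /(abs_contP V (ltW ab)) Vac mN N0.
apply/eqP; rewrite eq_le measure_ge0 andbT; apply/lee_addgt0Pr => e e0.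
rewrite add0e; have [d d0 Vd] := Vac e e0.
have [|U [oU NU]] := lebesgue_regularity_outer mN _ d0; first by rewrite [ltLHS]N0.
move=> UNd.
have mU : measurable U by exact: open_measurable.
have Ud : (mu U < d%:E)%E.
  apply: le_lt_trans UNd; rewrite -[leRHS]add0e -N0 -measureU//.
  - by rewrite setDUK.
  - exact: measurableD.
  - by rewrite setDIK.
apply: le_trans (LS_abs_cont_open ab e0 d0 Vd oU Ud).
apply: le_measure; rewrite ?inE; last exact: setSI.
- exact: measurableI.
- exact: measurableI.
Qed.

End LebesgueStieltjesAC.

(** * Existence of densities, by Radon-Nikodym and Jordan decomposition *)

Section Primitive.
Context {R : realType}.
Implicit Types (a b c x : R) (f g h k : R -> R).
Notation mu := (@lebesgue_measure R).
Notation LS := (@lebesgue_stieltjes_measure R).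

(** The working form of absolute continuity: the derivative is carried as a datum [g], determined
    only almost everywhere, instead of being recovered pointwise. *)
Definition prim a b f g := mu.-integrable `[a, b] (EFin \o g) /\
  forall x, a <= x <= b -> f x = f a + \int[mu]_(t in `[a, x]) g t.

Lemma eq_abs_cont a b f g : {in `[a, b], f =1 g} -> abs_cont a b f -> abs_cont a b g.
Proof.
move=> fg acf e /acf[d d0 fd]; exists d => // n s t st ts std.
apply: le_lt_trans (fd n s t st ts std); apply: ler_sum => k _.
have [h1 [h2 h3]] := st k (ltn_ord k).
by rewrite !fg// in_itv/= ?h1 ?h3 ?(le_trans h1) ?(le_trans _ h3).
Qed.

Lemma abs_cont_unif a b f : a <= b -> abs_cont a b f ->
  forall e : R, 0 < e -> exists2 d : R, 0 < d &
    forall x y, a <= x <= b -> a <= y <= b -> `|x - y| < d -> `|f x - f y| < e.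
Proof.
move=> ab /(abs_contP f ab) acf e /acf[d d0 fd]; exists d => // x y.
wlog xy : x y / y <= x => [H|].
  have [/H|/ltW/H] := leP y x; first exact.
  by move=> + axb ayb; rewrite distrC (distrC (f x)); exact.
move=> /andP[ax xb] /andP[ay yb]; rewrite ger0_norm ?subr_ge0// => xyd.
have := fd [:: (y, x)].
by rewrite /chain_len /chain_var !big_seq1 /= ay xy xb; exact.
Qed.

Definition clamp a b x := Num.max a (Num.min b x).

Lemma clamp_itv a b x : a <= b -> a <= clamp a b x <= b.
Proof. by move=> ab; rewrite /clamp le_max lexx ge_max ab ge_min lexx. Qed.

Lemma clamp_id a b x : a <= x <= b -> clamp a b x = x.
Proof. by move=> /andP[ax xb]; rewrite /clamp min_r// max_r. Qed.

Lemma clamp_nd a b : {homo clamp a b : x y / x <= y}.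
Proof.
move=> x y xy; rewrite /clamp; apply: le_max2 => //.
exact: le_min2.
Qed.

Lemma clamp_lip a b x y : `|clamp a b x - clamp a b y| <= `|x - y|.
Proof.
rewrite /clamp !maxEle !minEle.
by do ! case: ifPn; rewrite -?ltNge => *; rewrite ler_norml; case: (ler0P (x - y)) => *; lra.
Qed.

Lemma abs_cont_clamp_continuous a b f : a <= b -> abs_cont a b f ->
  continuous (f \o clamp a b).
Proof.
move=> ab acf x; apply/cvgrPdist_lt => e e0.
have [d d0 fd] := abs_cont_unif ab acf e0.
apply/nbhs_ballP; exists d => //= y; rewrite /ball/= => xy.
apply: fd; rewrite ?clamp_itv//.
exact: le_lt_trans (clamp_lip _ _ _ _) _.
Qed.

(** Extended by constants through [clamp], [f] is the distribution function of a Stieltjes measure.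
    Restricted to []a, b]] this measure is finite and absolutely continuous, and its Radon-Nikodym
    density is the derivative. *)
Lemma abs_cont_nd_prim a b f : a < b -> abs_cont a b f ->
  {in `[a, b] &, nondecreasing_fun f} -> exists g, prim a b f g.
Proof.
move=> ab acf ndf; have aleb := ltW ab.
pose F := f \o clamp a b.
have ndF : nondecreasing F.
  move=> x y xy; apply: ndf; rewrite ?in_itv/= ?clamp_itv//.
  exact: clamp_nd.
have rcF : right_continuous F.
  exact/right_continuousW/abs_cont_clamp_continuous.
pose V : cumulative R R := HB.pack F (isCumulative.Build R _ R F ndF rcF).
have FE x : a <= x <= b -> V x = f x by move=> axb; rewrite /= /F /= clamp_id.
have acV : abs_cont a b V.
  by apply: eq_abs_cont acf => x; rewrite in_itv/= => axb; rewrite -FE.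
have LSfin : (LS V `]a, b]%classic < +oo)%E by rewrite LS_itvoc ?ltry.
have mI : measurable (`]a, b]%classic : set (measurableTypeR R)) by exact: measurable_itv.
pose nu : {finite_measure set _ -> \bar R} := mfrestr mI LSfin.
have nu_mu : nu `<< mu.
  apply/null_content_dominatesP => A mA A0.
  by rewrite /nu/= /mfrestr/= /mrestr (LS_abs_cont_null ab acV).
have [g [g0 gfin gint gE]] := radon_nikodym_sigma_finite nu_mu.
have gEF : EFin \o (fine \o g) = g by apply/funext => x /=; rewrite fineK.
exists (fine \o g); split.
  by rewrite gEF; exact: integrableS gint.
move=> x /andP[ax xb].
have -> : \int[mu]_(t in `[a, x]) (fine \o g) t = \int[mu]_(t in `]a, x]) (fine \o g) t.
  rewrite Rintegral_itv_obnd_cbnd// gEF.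
  exact: integrableS gint.
rewrite /Rintegral (eq_integral g); last by move=> t _; rewrite fineK.
rewrite -gE; last exact: measurable_itv.
rewrite /nu/= /mfrestr/= /mrestr.
have -> : `]a, x]%classic `&` `]a, b]%classic = `]a, x]%classic :> set R.
  apply/seteqP; split=> [t []//|t]; rewrite /= !in_itv/= => /andP[-> tx]; split => //=.
  exact: le_trans xb.
have -> : LS V `]a, x]%classic = (V x - V a)%:E by exact: LS_itvoc.
by rewrite ?FE ?lexx ?ax ?aleb//=; ring.
Qed.

Lemma abs_contD a b f g : a <= b -> abs_cont a b f -> abs_cont a b g ->
  abs_cont a b (f \+ g).
Proof.
move=> ab /(abs_contP _ ab) acf /(abs_contP _ ab) acg; apply/(abs_contP _ ab) => e e0.
have e2 : 0 < e / 2 by rewrite divr_gt0.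
have [d1 d10 fd] := acf _ e2; have [d2 d20 gd] := acg _ e2.
exists (Num.min d1 d2) => [|l abl]; first by rewrite lt_min d10.
rewrite lt_min => /andP[/(fd _ abl) h1 /(gd _ abl) h2].
have : chain_var (f \+ g) l <= chain_var f l + chain_var g l.
  rewrite /chain_var -big_split/=; apply: ler_sum => p _.
  by rewrite opprD addrACA ler_normD.
lra.
Qed.

Lemma abs_contN a b f : abs_cont a b f -> abs_cont a b (\- f).
Proof.
move=> acf e /acf[d d0 fd]; exists d => // n s t st ts /(fd n s t st ts).
apply: le_lt_trans; apply: ler_sum => k _.
by rewrite -opprD normrN.
Qed.

Lemma abs_contB a b f g : a <= b -> abs_cont a b f -> abs_cont a b g ->
  abs_cont a b (f \- g).
Proof. by move=> ab acf /abs_contN; exact: abs_contD. Qed.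

Lemma prim_integrableS a b c f g : a <= c -> c <= b -> prim a b f g ->
  mu.-integrable `[a, c] (EFin \o g).
Proof.
move=> ac cb [gi _]; apply: integrableS gi => //.
by apply: subset_itvl; rewrite bnd_simp.
Qed.

Lemma primB a b f f' g g' : prim a b f g -> prim a b f' g' ->
  prim a b (f \- f') (g \- g').
Proof.
move=> pf pf'; have [gi fE] := pf; have [g'i f'E] := pf'; split.
  by apply: eq_integrable (integrableB _ gi g'i).
move=> x /[dup] xab /andP[ax xb].
have i1 := prim_integrableS ax xb pf; have i2 := prim_integrableS ax xb pf'.
by rewrite /= (fE x xab) (f'E x xab) (RintegralB _ i1 i2)//; ring.
Qed.

(** Jordan decomposition: [tv a f] and [tv a f - f] are both nondecreasing and absolutely
    continuous. *)
Lemma abs_cont_prim a b f : a < b -> abs_cont a b f -> exists g, prim a b f g.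
Proof.
move=> ab acf; have aleb := ltW ab.
have bvf := abs_cont_bounded_variation aleb acf.
have actv := abs_cont_tv aleb acf.
have [|g1 p1] := abs_cont_nd_prim ab actv.
  move=> x y; rewrite !in_itv/= => /andP[ax xb] /andP[ay yb] xy.
  by rewrite -subr_ge0 (le_trans _ (tv_ge bvf ax xy yb)).
have [|g2 p2] := abs_cont_nd_prim ab (abs_contB aleb actv acf).
  move=> x y; rewrite !in_itv/= => /andP[ax xb] /andP[ay yb] xy /=.
  by have := tv_ge bvf ax xy yb; rewrite ler_norml => /andP[_]; lra.
exists (g1 \- g2); have := primB p1 p2.
suff -> : tv a f \- (tv a f \- f) = f by [].
by apply/funext => x /=; ring.
Qed.

End Primitive.

(** Allows finitely many almost-everywhere statements to be intersected with [filterS2] and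
    [filterS3]. *)
#[global] Instance ae_lebesgue_filter (R : realType) :
  Filter (nbhs (almost_everywhere (@lebesgue_measure R))) :=
  ae_filter_ringOfSetsType (@lebesgue_measure R).

(** * Calculus of primitives *)

Section PrimitiveTheory.
Context {R : realType}.
Implicit Types (a b c d x y : R) (f g h k : R -> R).
Notation mu := (@lebesgue_measure R).

Lemma integrable_subitv a b c d g : a <= c -> d <= b ->
  mu.-integrable `[a, b] (EFin \o g) -> mu.-integrable `[c, d] (EFin \o g).
Proof.
move=> ac db; apply: integrableS => //.
by move=> x; rewrite /= !in_itv/= => /andP[cx xd]; rewrite (le_trans ac) ?(le_trans xd).
Qed.

Lemma Rintegral_itv_cat a b c g : a <= c -> c <= b ->
  mu.-integrable `[a, b] (EFin \o g) ->
  \int[mu]_(t in `[a, b]) g t =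
    \int[mu]_(t in `[a, c]) g t + \int[mu]_(t in `[c, b]) g t.
Proof.
move=> ac cb gi.
have := @Rintegral_itvB R g (BLeft a) (BRight b) c gi; rewrite !bnd_simp => /(_ ac cb).
rewrite Rintegral_itv_obnd_cbnd; first by move=> <-; rewrite addrC subrK.
apply: integrableS gi => //.
by move=> x; rewrite /= !in_itv/= => /andP[cx ->]; rewrite (le_trans ac) ?ltW.
Qed.

Lemma primB_int a b f g x y : prim a b f g -> a <= x -> x <= y -> y <= b ->
  f y - f x = \int[mu]_(t in `[x, y]) g t.
Proof.
move=> [gi fE] ax xy yb.
rewrite (fE y) ?yb ?(le_trans ax)// (fE x) ?ax ?(le_trans xy)//.
rewrite (@Rintegral_itv_cat a y x)//; first by ring.
exact: integrable_subitv gi.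
Qed.

Lemma primP a b f g : mu.-integrable `[a, b] (EFin \o g) ->
  (forall x y, a <= x -> x <= y -> y <= b ->
     f y - f x = \int[mu]_(t in `[x, y]) g t) -> prim a b f g.
Proof.
by move=> gi fE; split=> // x /andP[ax xb]; rewrite -fE ?lexx//; ring.
Qed.

Lemma primS a b c d f g : a <= c -> d <= b -> prim a b f g -> prim c d f g.
Proof.
move=> ac db pf; apply: primP.
  by case: pf => gi _; exact: integrable_subitv gi.
move=> x y cx xy yd; apply: (primB_int pf) => //.
  exact: le_trans cx.
exact: le_trans db.
Qed.

Lemma integrable_itvU (A B : set R) (g : R -> R) :
  measurable A -> measurable B -> mu.-integrable A (EFin \o g) ->
  mu.-integrable B (EFin \o g) -> mu.-integrable (A `|` B) (EFin \o g).
Proof.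
move=> mA mB /integrableP[mAg Ag] Bi.
have /integrableP[mBg Bg] : mu.-integrable (B `\` A) (EFin \o g).
  by apply: integrableS Bi => //; exact: measurableD.
have mBA : measurable (B `\` A) by exact: measurableD.
have mU : measurable_fun (A `|` (B `\` A)) g.
  by apply/measurable_funU => //; split; exact/measurable_EFinP.
have -> : A `|` B = A `|` (B `\` A) by rewrite setDE setUIr setUv setIT.
apply/integrableP; split; first exact/measurable_EFinP.
rewrite ge0_integral_setU//.
- by rewrite lte_add_pinfty.
- by apply: measurableT_comp => //; exact/measurable_EFinP.
- by apply/disj_setPS => x [Ax [_]].
Qed.

Lemma prim_cat a b c f g : a <= c -> c <= b -> prim a c f g -> prim c b f g ->
  prim a b f g.
Proof.
move=> ac cb pl pr.
have gi : mu.-integrable `[a, b] (EFin \o g).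
  have -> : `[a, b]%classic = `[a, c]%classic `|` `[c, b]%classic :> set R.
    apply/seteqP; split=> x; rewrite /= !in_itv/=.
      by move=> /andP[ax xb]; have [xc|/ltW xc] := leP x c; [left; rewrite ax|right; rewrite xb xc].
    by move=> [] /andP[h1 h2]; rewrite ?h1 ?h2 ?(le_trans h2) ?(le_trans _ h1).
  by apply: integrable_itvU => //; [case: pl|case: pr].
split=> // x /andP[ax xb]; have [xc|/ltW cx] := leP x c.
  by case: pl => _; apply; rewrite ax.
rewrite (@Rintegral_itv_cat a x c)//; last exact: integrable_subitv gi.
rewrite -(primB_int pl)// -(primB_int pr)//; ring.
Qed.

Lemma eq_prim a b f f' g : {in `[a, b], f =1 f'} -> prim a b f g -> prim a b f' g.
Proof.
move=> ff' [gi fE]; split=> // x /[dup] axb /andP[ax xb].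
rewrite -!ff' ?in_itv/= ?ax ?xb ?lexx ?(le_trans ax)//.
exact: fE.
Qed.

Lemma ae_neq c : {ae mu, forall x, x != c}.
Proof.
exists [set c]; split => //; first by rewrite lebesgue_measure_set1.
by move=> x /= /negP; rewrite negbK => /eqP.
Qed.

Lemma ae_itv a b (P : R -> Prop) : {ae mu, forall x, a < x < b -> P x} ->
  {ae mu, forall x, x \in `[a, b] -> P x}.
Proof.
move=> abP; have := ae_neq a; have := ae_neq b; move: abP.
apply: filterS3 => x abP xb xa; rewrite in_itv/= => /andP[ax bx]; apply: abP.
by rewrite !lt_neqAle ax bx xb eq_sym xa.
Qed.

(** The tool for rewriting the derivative datum with equations that hold only almost everywhere,
    such as the differential equation itself. *)
Lemma prim_ae a b f g h : measurable_fun `[a, b] h ->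
  {ae mu, forall x, a < x < b -> g x = h x} -> prim a b f g -> prim a b f h.
Proof.
move=> mh /ae_itv gh [gi fE].
have mg : measurable_fun `[a, b] g by apply/measurable_EFinP; case/integrableP: gi.
have hi : mu.-integrable `[a, b] (EFin \o h).
  apply/integrableP; split; first exact/measurable_EFinP.
  case/integrableP: gi => _; congr (_ < _)%E.
  apply: ae_eq_integral => //; try by do 2 apply: measurableT_comp => //.
  by apply: filterS gh => x + axb => /(_ axb) /= ->.
split=> // x /[dup] axb /andP[ax xb]; rewrite fE//; congr (_ + fine _).
have sub : `[a, x] `<=` `[a, b] by apply: subset_itvl; rewrite bnd_simp.
apply: ae_eq_integral => //; try by apply/measurable_EFinP; exact: measurable_funS sub _.
by apply: filterS gh => t + /sub atx => /(_ atx) ->.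
Qed.

Lemma primD a b f f' g g' : prim a b f g -> prim a b f' g' ->
  prim a b (f \+ f') (g \+ g').
Proof.
move=> pf pf'; have [gi fE] := pf; have [g'i f'E] := pf'; split.
  by apply: eq_integrable (integrableD _ gi g'i).
move=> x /[dup] xab /andP[ax xb].
have i1 := prim_integrableS ax xb pf; have i2 := prim_integrableS ax xb pf'.
by rewrite /= (fE x xab) (f'E x xab) (RintegralD _ i1 i2)//; ring.
Qed.

Lemma prim0 a b c : prim a b (cst c) (cst 0).
Proof.
split; first exact: integrable0.
by move=> x _; rewrite /Rintegral integral0 /= addr0.
Qed.

Lemma primZ a b r f g : prim a b f g ->
  prim a b (fun x => r * f x) (fun x => r * g x).
Proof.
move=> pf; have [gi fE] := pf; split.
  by apply: eq_integrable (integrableZl _ r gi).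
move=> x /[dup] xab /andP[ax xb].
have i1 := prim_integrableS ax xb pf.
by rewrite (fE x xab) RintegralZl//; ring.
Qed.

(** Lebesgue differentiation for [g] extended by zero to the line; near an interior point [f] is a
    constant plus the integral of this extension. *)
Lemma prim_is_derive a b f g : prim a b f g ->
  {ae mu, forall x, a < x < b -> is_derive x 1 f (g x)}.
Proof.
move=> [gi fE].
pose G := g \_ `[a, b].
have Gi : mu.-integrable setT (EFin \o G).
  by rewrite -restrict_EFin; apply/integrable_restrict => //=; rewrite setTI.
have locG : locally_integrable [set: R] G by exact: integrable_locally.
have GiI (y : R) : mu.-integrable `[a, y] (EFin \o G) by exact: integrableS Gi.
have := @FTC1 R G (BLeft a) GiI locG.
apply: filterS => x /= H /andP[ax xb].
have [|dF FE] := H; first by rewrite lte_fin.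
rewrite derive1E in FE.
have -> : g x = G x by rewrite /G patchE mem_set//= in_itv/= !ltW.
rewrite -FE.
pose F := fun y => f a + \int[mu]_(t in `[a, y]) G t.
have nF : \near x, F x = f x.
  near=> y; have ay : a < y by near: y; exact: lt_nbhsr.
  have yb : y < b by near: y; exact: lt_nbhsl.
  have -> : f y = f a + \int[mu]_(t in `[a, y]) g t by apply: fE; rewrite !ltW.
  congr (_ + _).
  apply: eq_Rintegral => t; rewrite inE/= in_itv/= => /andP[at_ ty].
  by rewrite /G patchE mem_set//= in_itv/= at_ (le_trans ty)// ltW.
apply: (near_eq_is_derive nF).
rewrite /F; rewrite -[X in is_derive _ _ _ X]add0r.
apply: is_deriveD.
exact: DeriveDef.
Unshelve. all: by end_near. Qed.

End PrimitiveTheory.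

(** * Primitives are absolutely continuous; the product rule *)

Section PrimitiveAbsCont.
Context {R : realType}.
Implicit Types (a b c d x y : R) (f g h k : R -> R).
Notation mu := (@lebesgue_measure R).

Lemma itv_chain_mem a b l p : itv_chain a b l -> p \in l ->
  [/\ a <= p.1, p.1 <= p.2 & p.2 <= b].
Proof.
move=> abl pl; have := pl; rewrite -index_mem => /(itv_chain_nth abl).
by rewrite nth_index// => -[].
Qed.

(** Half-open intervals, so that touching members of a chain are disjoint and measures add
    exactly. *)
Fixpoint chain_set (l : seq (R * R)) : set R :=
  if l is p :: l' then `]p.1, p.2]%classic `|` chain_set l' else set0.

Lemma chain_set_measurable l : measurable (chain_set l).
Proof. by elim: l => //= p l ih; exact: measurableU. Qed.

Lemma chain_set_sub a b l : itv_chain a b l -> chain_set l `<=` `]a, b].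
Proof.
elim: l a => [a _ x []|p l ih a /= /andP[/andP[ap pp] pl] x [|/(ih _ pl)]];
  rewrite /= !in_itv/= => /andP[h1 h2].
  by rewrite (le_lt_trans ap)//= (le_trans h2)// (itv_chain_le pl).
by rewrite h2 andbT (le_lt_trans (le_trans ap pp)).
Qed.

Lemma chain_set_disj p b l : itv_chain p.2 b l ->
  [disjoint `]p.1, p.2]%classic & chain_set l].
Proof.
move=> /chain_set_sub pl; apply/disj_setPS => x [/=]; rewrite in_itv/=.
move=> /andP[_ xp] /pl; rewrite /= in_itv/= => /andP[px _].
by move: px; rewrite ltNge xp.
Qed.

Lemma chain_set_mu a b l : itv_chain a b l -> mu (chain_set l) = (chain_len l)%:E.
Proof.
elim: l a => [a _|p l ih a /= /andP[/andP[ap pp] pl]].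
  by rewrite /chain_len big_nil measure0.
rewrite measureU//; last 2 first.
- exact: chain_set_measurable.
- exact/eqP/(chain_set_disj pl).
rewrite [X in (X + _)%E](@LS_itvoc R idfun)//.
rewrite [X in (_ + X)%E](ih _ pl) -EFinD; congr (_%:E).
by rewrite /chain_len big_cons.
Qed.

Lemma chain_set_Rintegral a b l g : itv_chain a b l ->
  mu.-integrable `[a, b] (EFin \o g) ->
  \int[mu]_(x in chain_set l) g x = \sum_(p <- l) \int[mu]_(x in `[p.1, p.2]) g x.
Proof.
elim: l a => [a _ _|p l ih a /= /andP[/andP[ap pp] pl] gi].
  by rewrite /= Rintegral_set0 big_nil.
have pb := itv_chain_le pl.
have gi1 : mu.-integrable `[p.2, b] (EFin \o g).
  by apply: integrable_subitv gi => //; exact: le_trans pp.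
have gi2 : mu.-integrable `]p.1, p.2] (EFin \o g).
  apply: integrableS gi => // x; rewrite /= !in_itv/= => /andP[px xp].
  by rewrite (le_trans ap (ltW px)) (le_trans xp).
have sub : chain_set l `<=` `[p.2, b].
  by move=> x /(chain_set_sub pl); exact: subset_itv_oc_cc.
have mcs := chain_set_measurable l.
rewrite Rintegral_setU//; last 2 first.
- by apply: integrable_itvU => //; exact: integrableS gi1.
- exact: chain_set_disj pl.
by rewrite big_cons (ih _ pl gi1) Rintegral_itv_obnd_cbnd.
Qed.

(** Absolute continuity of the integral of [|g|], evaluated on the union of the intervals of a
    chain. *)
Lemma prim_abs_cont a b f g : a <= b -> prim a b f g -> abs_cont a b f.
Proof.
move=> ab pf; apply/(abs_contP f ab) => e e0; have [gi fE] := pf.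
pose G := g \_ `[a, b].
have Gi : mu.-integrable setT (EFin \o G).
  by rewrite -restrict_EFin; apply/integrable_restrict => //=; rewrite setTI.
have [d [d0 Gd]] := integral_normr_continuous Gi e0.
exists d => // l abl ld.
have ml : (mu (chain_set l) < d%:E)%E by rewrite (chain_set_mu abl) lte_fin.
apply: le_lt_trans (Gd _ (chain_set_measurable l) ml).
have -> : \int[mu]_(x in chain_set l) `|G x| = \int[mu]_(x in chain_set l) `|g x|.
  apply: eq_Rintegral => x; rewrite inE => /(chain_set_sub abl).
  by move=> /subset_itv_oc_cc xab; rewrite /G patchE mem_set.
rewrite (chain_set_Rintegral abl); last exact: (integrable_norm gi).
rewrite /chain_var big_seq [leRHS]big_seq; apply: ler_sum => p pl.
have [ap pp pb] := itv_chain_mem abl pl.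
rewrite (primB_int pf)//; apply: le_normr_Rintegral => //.
exact: integrable_subitv gi.
Qed.

Lemma prim_continuous a b f g : prim a b f g -> {within `[a, b], continuous f}.
Proof.
move=> pf; have [ab|ba] := leP a b; last first.
  by rewrite set_itv_ge ?bnd_simp -?ltNge//; exact: continuous_subspace0.
apply/subspace_continuousP => x; rewrite /= in_itv/= => axb.
apply/cvgrPdist_lt => e e0.
have [d d0 fd] := abs_cont_unif ab (prim_abs_cont ab pf) e0.
apply/nbhs_ballP; exists d => //= y xy; rewrite /= in_itv/= => ayb.
exact: fd.
Qed.

Lemma prim_measurable a b f g : prim a b f g -> measurable_fun `[a, b] f.
Proof.
by move=> /prim_continuous; apply: subspace_continuous_measurable_fun.
Qed.

Lemma prim_bounded a b f g : prim a b f g ->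
  exists2 M, 0 < M & forall x, a <= x <= b -> `|f x| <= M.
Proof.
move=> [gi fE]; exists (`|f a| + \int[mu]_(t in `[a, b]) `|g t| + 1).
  by rewrite ltr_wpDl// addr_ge0// Rintegral_ge0.
move=> x /[dup] axb /andP[ax xb]; rewrite fE//.
have gix : mu.-integrable `[a, x] (EFin \o g) by exact: integrable_subitv gi.
apply: le_trans (ler_normD _ _) _; rewrite -addrA lerD2l -[leLHS]addr0 lerD//.
apply: le_trans (le_normr_Rintegral _ gix) _ => //.
rewrite (@Rintegral_itv_cat _ a b x)//; last exact: (integrable_norm gi).
by rewrite lerDl Rintegral_ge0.
Qed.

Lemma abs_contM a b f g : a <= b ->
  (exists2 M, 0 < M & forall x, a <= x <= b -> `|f x| <= M) ->
  (exists2 M, 0 < M & forall x, a <= x <= b -> `|g x| <= M) ->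
  abs_cont a b f -> abs_cont a b g -> abs_cont a b (f \* g).
Proof.
move=> ab [M M0 fM] [N N0 gN] /(abs_contP _ ab) acf /(abs_contP _ ab) acg.
apply/(abs_contP _ ab) => e e0.
have e1 : 0 < e / 2 / N by rewrite !divr_gt0.
have e2 : 0 < e / 2 / M by rewrite !divr_gt0.
have [d1 d10 fd] := acf _ e1; have [d2 d20 gd] := acg _ e2.
exists (Num.min d1 d2) => [|l abl]; first by rewrite lt_min d10.
rewrite lt_min => /andP[/(fd _ abl) h1 /(gd _ abl) h2].
have : chain_var (f \* g) l <= chain_var f l * N + chain_var g l * M.
  rewrite /chain_var !mulr_suml -big_split/= big_seq [leRHS]big_seq.
  apply: ler_sum => p pl; have [ap pp pb] := itv_chain_mem abl pl.
  have -> : f p.2 * g p.2 - f p.1 * g p.1 =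
    (f p.2 - f p.1) * g p.2 + (g p.2 - g p.1) * f p.1 by ring.
  apply: le_trans (ler_normD _ _) _; rewrite !normrM lerD// ler_wpM2l//.
    by apply: gN; rewrite pb (le_trans ap).
  by apply: fM; rewrite ap (le_trans pp).
move: h1 h2; rewrite !ltr_pdivlMr// => h1 h2; lra.
Qed.

(** The product is absolutely continuous, hence a primitive of some [k]; almost everywhere all three
    functions are differentiable, which identifies [k] with the product-rule expression. *)
Lemma primM a b f f' g g' : a < b -> prim a b f f' -> prim a b g g' ->
  prim a b (f \* g) (fun x => f' x * g x + f x * g' x).
Proof.
move=> ab pf pg; have aleb := ltW ab.
have [k pk] := abs_cont_prim ab (abs_contM aleb (prim_bounded pf) (prim_bounded pg)
  (prim_abs_cont aleb pf) (prim_abs_cont aleb pg)).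
have [f'i _] := pf; have [g'i _] := pg.
apply: (prim_ae _ _ pk); first apply: measurable_funD; try apply: measurable_funM.
- by apply/measurable_EFinP; case/integrableP: f'i.
- exact: prim_measurable pg.
- exact: prim_measurable pf.
- by apply/measurable_EFinP; case/integrableP: g'i.
move: (prim_is_derive pk) (prim_is_derive pf) (prim_is_derive pg).
apply: filterS3 => x + + + axb => /(_ axb) dk /(_ axb) df /(_ axb) dg; move: dk.
have dfg : is_derive x 1 (f \* g) (f' x * g x + f x * g' x).
  rewrite (_ : f \* g = f * g)//; apply: is_derive_eq.
  by rewrite /GRing.scale/=; ring.
by move=> dk; rewrite -(@derive_val _ _ _ _ _ _ _ dk) -(@derive_val _ _ _ _ _ _ _ dfg).
Qed.

End PrimitiveAbsCont.

(** * Classical and improper fundamental theorems *)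

Section PrimitiveFTC.
Context {R : realType}.
Implicit Types (a b c d x y : R) (f g h k : R -> R).
Notation mu := (@lebesgue_measure R).

Lemma within_continuous_for a b f :
  (forall x, a <= x <= b -> {for x, continuous f}) -> {within `[a, b], continuous f}.
Proof.
move=> cf; apply: continuous_in_subspaceT => x; rewrite inE/= in_itv/=.
exact: cf.
Qed.

Lemma prim_C1 a b f g :
  (forall x, a <= x <= b -> is_derive x 1 f (g x)) ->
  (forall x, a <= x <= b -> {for x, continuous g}) -> prim a b f g.
Proof.
move=> df cg.
have gi : mu.-integrable `[a, b] (EFin \o g).
  apply: continuous_compact_integrable; first exact: segment_compact.
  exact: within_continuous_for.
apply: primP => // x y ax; rewrite le_eqVlt => /predU1P[<- _|xy yb].
  by rewrite set_itv1 Rintegral_set1 subrr.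
have sub z : x <= z <= y -> a <= z <= b.
  by move=> /andP[xz zy]; rewrite (le_trans ax xz) (le_trans zy yb).
have cf z : x <= z <= y -> {for z, continuous f}.
  move=> /sub/df ?; apply: differentiable_continuous; exact/derivable1_diffP.
rewrite /Rintegral (@continuous_FTC2 R g f)//.
- by apply: within_continuous_for => z /sub/cg.
- split.
  + by move=> z /subset_itv_oo_cc; rewrite /= in_itv/= => /sub/df.
  + by apply: cvg_at_right_filter; apply: cf; rewrite lexx ltW.
  + by apply: cvg_at_left_filter; apply: cf; rewrite lexx ltW.
- move=> z /subset_itv_oo_cc; rewrite /= in_itv/= => /sub/df ?.
  by rewrite derive1E derive_val.
Qed.

Lemma prim_cvg_right a b f g : a < b -> prim a b f g -> f x @[x --> a^'+] --> f a.
Proof.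
move=> ab pf; apply/cvgrPdist_lt => e e0.
have [d d0 fd] := abs_cont_unif (ltW ab) (prim_abs_cont (ltW ab) pf) e0.
near=> y; apply: fd.
- by rewrite lexx ltW.
- by apply/andP; split; apply: ltW; near: y; [exact: nbhs_right_gt|exact: nbhs_right_lt].
- near: y; apply: cvg_at_right_filter; first exact: cvg_id.
  exact: nbhsx_ballx.
Unshelve. all: by end_near. Qed.

Lemma prim_cvg_left a b f g : a < b -> prim a b f g -> f x @[x --> b^'-] --> f b.
Proof.
move=> ab pf; apply/cvgrPdist_lt => e e0.
have [d d0 fd] := abs_cont_unif (ltW ab) (prim_abs_cont (ltW ab) pf) e0.
near=> y; apply: fd.
- by rewrite lexx ltW.
- by apply/andP; split; apply: ltW; near: y; [exact: nbhs_left_gt|exact: nbhs_left_lt].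
- near: y; apply: cvg_at_left_filter; first exact: cvg_id.
  exact: nbhsx_ballx.
Unshelve. all: by end_near. Qed.

Lemma prim_cvg a b f g x : a < x < b -> prim a b f g -> {for x, continuous f}.
Proof.
move=> /andP[ax xb] pf; have ab := lt_trans ax xb; apply/cvgrPdist_lt => e e0.
have [d d0 fd] := abs_cont_unif (ltW ab) (prim_abs_cont (ltW ab) pf) e0.
near=> y; apply: fd.
- by rewrite !ltW.
- by apply/andP; split; apply: ltW; near: y; [exact: lt_nbhsr|exact: lt_nbhsl].
- by near: y; apply/nbhs_ballP; exists d => //=.
Unshelve. all: by end_near. Qed.

(* Improper fundamental theorem: the bounded function [P] makes [k] integrable. *)
Lemma prim_dominated a b f k (P p : R -> R) (K : R) : a < b ->
  (forall x, a < x < b -> is_derive x 1 f (k x)) ->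
  (forall x, a < x < b -> {for x, continuous k}) ->
  f x @[x --> a^'+] --> f a -> f x @[x --> b^'-] --> f b ->
  (forall x, a < x < b -> is_derive x 1 P (p x)) ->
  (forall x, a < x < b -> {for x, continuous p}) ->
  (forall x, a < x < b -> `|k x| <= p x) ->
  (forall x, a < x < b -> `|P x| <= K) ->
  prim a b f k.
Proof.
move=> ab df ck fa fb dP cp kp PK.
(* Compact intervals exhausting []a, b[]; [n.+3] keeps [s n] below [t n] already for [n = 0]. *)
pose s (n : nat) := a + (b - a) / n.+3%:R; pose t (n : nat) := b - (b - a) / n.+3%:R.
have ba0 : 0 < b - a by rewrite subr_gt0.
have n0 n : 0 < (b - a) / n.+3%:R by rewrite divr_gt0.
have n1 n : (b - a) / n.+3%:R < (b - a) / 2 by rewrite ltr_pM2l// ltf_pV2 ?posrE ?ltr_nat.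
have as_ n : a < s n by rewrite /s ltrDl.
have tb n : t n < b by rewrite /t ltrBlDr ltrDl.
have st n : s n <= t n.
  by have := n1 n; rewrite /s /t; set u := _ / n.+3%:R; lra.
have sub n z : s n <= z <= t n -> a < z < b.
  by move=> /andP[h1 h2]; rewrite (lt_le_trans (as_ n) h1) (le_lt_trans h2 (tb n)).
have primn n : prim (s n) (t n) f k.
  by apply: prim_C1 => x /sub; [exact: df|exact: ck].
have primPn n : prim (s n) (t n) P p.
  by apply: prim_C1 => x /sub; [exact: dP|exact: cp].
(* The integral of [p] is an increment of [P], hence at most [2 * K] uniformly in [n]; monotone
   convergence then gives integrability of [k]. *)
have intn n : (\int[mu]_(x in `[s n, t n]) `|(k x)%:E| <= (2 * K)%:E)%E.
  have [ki _] := primn n; have [pi_ _] := primPn n.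
  have K2 : P (t n) - P (s n) <= 2 * K.
    have := PK _ (sub n (s n) _); have := PK _ (sub n (t n) _).
    rewrite !lexx !st => /(_ erefl) + /(_ erefl); rewrite !ler_norml.
    by move=> /andP[? ?] /andP[? ?]; lra.
  apply: (@le_trans _ _ (\int[mu]_(x in `[s n, t n]) (p x)%:E)%E).
    apply: ge0_le_integral => //.
    - apply: measurableT_comp => //; first by case/integrableP: ki.
    - by case/integrableP: pi_.
    - by move=> x xst; rewrite lee_fin; apply: kp; exact: sub xst.
  rewrite -[leLHS]fineK; last exact: integrable_fin_num.
  by rewrite lee_fin (le_trans _ K2)// (primB_int (primPn n))// lexx.
have UE : `]a, b[%classic = \bigcup_n `[s n, t n]%classic :> set R.
  apply/seteqP; split=> [x|x [n _]] /=; rewrite !in_itv/=; last exact: sub.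
  move=> /andP[ax xb]; pose m := Num.min (x - a) (b - x).
  have m0 : 0 < m by rewrite lt_min !subr_gt0 ax.
  exists (Num.truncn ((b - a) / m)) => //=; rewrite in_itv/=.
  have : (b - a) / (Num.truncn ((b - a) / m)).+3%:R <= m.
    rewrite ler_pdivrMr// mulrC -ler_pdivrMr//.
    apply: le_trans (ltW (truncnS_gt _)) _.
    by rewrite ler_nat -addn2 leq_addr.
  rewrite le_min /s /t; set u := _ / _%:R; move=> /andP[h1 h2]; apply/andP; split; lra.
have mk : measurable_fun `]a, b[ k.
  apply: open_continuous_measurable_fun; first exact: interval_open.
  by move=> x; rewrite inE/= in_itv/=; exact: ck.
have ki : mu.-integrable `]a, b[ (EFin \o k).
  apply/integrableP; split; first exact/measurable_EFinP.
  have cvgi : (\int[mu]_(x in `[s i, t i]) `|(k x)%:E| @[i --> \oo] -->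
              \int[mu]_(x in `]a, b[) `|(k x)%:E|)%E.
    rewrite UE; apply: ge0_nondecreasing_set_cvg_integral => //.
    - apply/nondecreasing_seqP => n; apply/subsetPset; apply: subset_itv;
        rewrite bnd_simp /s /t ?lerD2l ?lerN2 ler_pM2l// lef_pV2 ?posrE// ler_nat; lia.
    - move=> i; apply: measurableT_comp => //; apply/measurable_EFinP.
      by apply: measurable_funS mk => // x; rewrite /= !in_itv/=; exact: sub.
  rewrite -(cvg_lim (@ereal_hausdorff R) cvgi).
  apply: (@le_lt_trans _ _ (2 * K)%:E); last by rewrite ltry.
  by apply: lime_le; [exact: cvgP cvgi|apply: nearW].
have {}ki : mu.-integrable `[a, b] (EFin \o k).
  have i1 c : mu.-integrable [set c] (EFin \o k).
    apply/integrableP; split; first by apply/measurable_EFinP; exact: measurable_fun_set1.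
    by rewrite integral_set1.
  rewrite -(@setUitv1 _ _ (BLeft a) b true) ?bnd_simp ?ltW//.
  apply: integrable_itvU => //.
  by rewrite -(@setU1itv _ _ (BLeft b) a false) ?bnd_simp//; exact: integrable_itvU.
pose G y := \int[mu]_(x in `[a, y]) k x.
have pG : prim a b G k.
  by split=> // x _; rewrite /G set_itv1 Rintegral_set1 add0r.
(* On compact subintervals [f] and [G] are primitives of the same function, so they differ by a
   constant in the open interval. The one-sided limits carry this constant to the endpoints. *)
have fG x y : a < x -> x <= y -> y < b -> f y - G y = f x - G x.
  move=> ax xy yb; have pf : prim x y f k.
    by apply: prim_C1 => z /andP[xz zy]; [apply: df|apply: ck];
      rewrite (lt_le_trans ax xz) (le_lt_trans zy yb).
  have := primB_int pf (lexx x) xy (lexx y).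
  have := primB_int pG (ltW ax) xy (ltW yb); lra.
pose c := (a + b) / 2.
have ac : a < c by rewrite /c; lra.
have cb : c < b by rewrite /c; lra.
have fGc x : a < x < b -> f x - G x = f c - G c.
  move=> /andP[ax xb]; have [cx|/ltW xc] := leP c x; first exact: fG.
  by apply/esym; exact: fG.
have fGa : f a - G a = f c - G c.
  have h1 : f x - G x @[x --> a^'+] --> f a - G a.
    by apply: cvgB => //; exact: prim_cvg_right pG.
  have h2 : f x - G x @[x --> a^'+] --> f c - G c.
    apply: cvg_near_cst; near=> x; apply: fGc.
    by apply/andP; split; near: x; [exact: nbhs_right_gt|exact: nbhs_right_lt].
  exact: (cvg_unique _ h1 h2).
have fGb : f b - G b = f c - G c.
  have h1 : f x - G x @[x --> b^'-] --> f b - G b.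
    by apply: cvgB => //; exact: prim_cvg_left pG.
  have h2 : f x - G x @[x --> b^'-] --> f c - G c.
    apply: cvg_near_cst; near=> x; apply: fGc.
    by apply/andP; split; near: x; [exact: nbhs_left_gt|exact: nbhs_left_lt].
  exact: (cvg_unique _ h1 h2).
have -> : k = k \+ cst 0 by apply/funext => x /=; rewrite addr0.
apply: eq_prim (primD pG (prim0 a b (f c - G c))) => x; rewrite in_itv/=.
move=> /andP[]; rewrite le_eqVlt => /predU1P[<- _|ax].
  by rewrite /= -fGa; ring.
rewrite le_eqVlt => /predU1P[->|xb]; first by rewrite /= -fGb; ring.
by rewrite /= -(fGc x) ?ax//; ring.
Unshelve. all: by end_near. Qed.

End PrimitiveFTC.

(** * Square-integrable functions *)

Section SquareIntegrable.
Context {R : realType}.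
Implicit Types (a b c d x y : R) (f g h : R -> R).
Notation mu := (@lebesgue_measure R).

Lemma Rintegrable_le a b f g : measurable_fun `[a, b] f ->
  mu.-integrable `[a, b] (EFin \o g) ->
  (forall x, a <= x <= b -> `|f x| <= g x) -> mu.-integrable `[a, b] (EFin \o f).
Proof.
move=> mf gi fg; apply: le_integrable gi => //; first exact/measurable_EFinP.
move=> x; rewrite /= in_itv/= => /fg fgx; rewrite lee_fin (le_trans fgx)//.
exact: ler_norm.
Qed.

Lemma Rintegrable_cst a b c : mu.-integrable `[a, b] (EFin \o cst c).
Proof.
apply: continuous_compact_integrable; first exact: segment_compact.
by apply: continuous_subspaceT => x; exact: cst_continuous.
Qed.

Lemma Rintegrable_measurable a b f :
  mu.-integrable `[a, b] (EFin \o f) -> measurable_fun `[a, b] f.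
Proof. by move=> /integrableP[/measurable_EFinP]. Qed.

Lemma Rintegrable_bounded a b f c : measurable_fun `[a, b] f ->
  (forall x, a <= x <= b -> `|f x| <= c) -> mu.-integrable `[a, b] (EFin \o f).
Proof. by move=> mf fc; apply: Rintegrable_le mf (Rintegrable_cst a b c) _. Qed.

Lemma RintegrableD a b f g : mu.-integrable `[a, b] (EFin \o f) ->
  mu.-integrable `[a, b] (EFin \o g) -> mu.-integrable `[a, b] (EFin \o (f \+ g)).
Proof. by move=> fi gi; apply: eq_integrable (integrableD _ fi gi). Qed.

Lemma RintegrableZ a b f c : mu.-integrable `[a, b] (EFin \o f) ->
  mu.-integrable `[a, b] (EFin \o (fun x => c * f x)).
Proof. by move=> fi; apply: eq_integrable (integrableZl _ c fi). Qed.

(** Measurability is listed on its own because that of the square does not imply it. *)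
Definition sqint a b f := measurable_fun `[a, b] f /\
  mu.-integrable `[a, b] (EFin \o (fun x => f x ^+ 2)).

Definition nsq a b f := \int[mu]_(x in `[a, b]) (f x ^+ 2).

Lemma nsq_ge0 a b f : 0 <= nsq a b f.
Proof. by apply: Rintegral_ge0 => x _; exact: sqr_ge0. Qed.

Lemma sqint_integrable a b f : sqint a b f -> mu.-integrable `[a, b] (EFin \o f).
Proof.
move=> [mf fi].
apply: Rintegrable_le mf (RintegrableD (Rintegrable_cst a b 1) fi) _ => x _ /=.
have := sqr_ge0 (f x - 1); have := sqr_ge0 (f x + 1).
by rewrite ler_norml => ? ?; apply/andP; split; lra.
Qed.

Lemma sqintS a b c d f : a <= c -> d <= b -> sqint a b f -> sqint c d f.
Proof.
move=> ac db [mf fi]; split; last exact: integrable_subitv fi.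
apply: measurable_funS mf => // x; rewrite /= !in_itv/= => /andP[cx xd].
by rewrite (le_trans ac cx) (le_trans xd db).
Qed.

Lemma sqint_bounded a b f c : measurable_fun `[a, b] f ->
  (forall x, a <= x <= b -> `|f x| <= c) -> sqint a b f.
Proof.
move=> mf fc; split=> //; apply: (@Rintegrable_bounded _ _ _ (c ^+ 2)).
  exact: measurable_funX.
by move=> x /fc fxc; rewrite normrX ler_pXn2r// ?nnegrE// (le_trans _ fxc).
Qed.

Lemma sqint_prim a b f g : prim a b f g -> sqint a b f.
Proof.
move=> pf; have [M _ fM] := prim_bounded pf.
exact: sqint_bounded (prim_measurable pf) fM.
Qed.

Lemma sqintM_integrable a b f g : sqint a b f -> sqint a b g ->
  mu.-integrable `[a, b] (EFin \o (f \* g)).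
Proof.
move=> [mf fi] [mg gi]; apply: Rintegrable_le (RintegrableD fi gi) _.
  exact: measurable_funM.
move=> x _ /=; have := sqr_ge0 (f x - g x); have := sqr_ge0 (f x + g x).
by rewrite ler_norml => ? ?; apply/andP; split; nra.
Qed.

Lemma sqintD a b f g : sqint a b f -> sqint a b g -> sqint a b (f \+ g).
Proof.
move=> [mf fi] [mg gi]; split; first exact: measurable_funD.
apply: Rintegrable_le (RintegrableD (RintegrableZ 2 fi) (RintegrableZ 2 gi)) _.
  by apply: measurable_funX; exact: measurable_funD.
by move=> x _ /=; rewrite ger0_norm ?sqr_ge0//; have := sqr_ge0 (f x - g x); lra.
Qed.

Lemma sqintM_bounded a b f g c : measurable_fun `[a, b] f ->
  (forall x, a <= x <= b -> `|f x| <= c) -> sqint a b g -> sqint a b (f \* g).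
Proof.
move=> mf fc [mg gi]; split; first exact: measurable_funM.
apply: Rintegrable_le (RintegrableZ (c ^+ 2) gi) _.
  by apply: measurable_funX; exact: measurable_funM.
move=> x /fc fxc /=; rewrite ger0_norm ?sqr_ge0// exprMn ler_wpM2r ?sqr_ge0//.
by rewrite -(real_normK (num_real (f x))) ler_pXn2r// ?nnegrE// (le_trans _ fxc).
Qed.

Lemma sqintZ a b f c : sqint a b f -> sqint a b (fun x => c * f x).
Proof. by apply: (@sqintM_bounded _ _ (cst c) _ `|c|) => //. Qed.

Lemma sqintB a b f g : sqint a b f -> sqint a b g -> sqint a b (f \- g).
Proof.
move=> sf sg; have := sqintD sf (sqintZ (-1) sg).
by rewrite (_ : _ \+ _ = f \- g)//; apply/funext => x /=; rewrite mulN1r.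
Qed.

Lemma sqint_cst a b c : sqint a b (cst c).
Proof. by apply: (@sqint_bounded _ _ _ `|c|). Qed.

Lemma nsqZ a b f c : sqint a b f -> nsq a b (fun x => c * f x) = c ^+ 2 * nsq a b f.
Proof.
move=> [mf fi]; rewrite /nsq -RintegralZl//; apply: eq_Rintegral => x _.
by rewrite exprMn.
Qed.

Lemma nsqD_le a b f g : sqint a b f -> sqint a b g ->
  nsq a b (f \+ g) <= 2 * nsq a b f + 2 * nsq a b g.
Proof.
move=> sf sg; have [mf fi] := sf; have [mg gi] := sg.
rewrite /nsq -!RintegralZl// -RintegralD//=; try exact: RintegrableZ.
apply: le_Rintegral => //.
- by case: (sqintD sf sg).
- exact: RintegrableD (RintegrableZ 2 fi) (RintegrableZ 2 gi).
- by move=> x _ /=; have := sqr_ge0 (f x - g x); lra.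
Qed.

Lemma Rintegral_itv_cst a b c : a <= b -> \int[mu]_(x in `[a, b]) c = c * (b - a).
Proof.
move=> ab; rewrite Rintegral_cst//= lebesgue_measure_itv/= lte_fin.
have [//|ba] := ltP a b.
by have -> : a = b; [apply/le_anti; rewrite ab|rewrite subrr].
Qed.

Lemma nsqB_cst a b f c : a <= b -> sqint a b f ->
  nsq a b (f \- cst c) =
  nsq a b f - 2 * c * \int[mu]_(x in `[a, b]) f x + c ^+ 2 * (b - a).
Proof.
move=> ab sf; have [mf fi] := sf; have f1i := sqint_integrable sf.
rewrite -[c ^+ 2 * _]Rintegral_itv_cst// -RintegralZl// /nsq -RintegralB//; last first.
  exact: RintegrableZ.
rewrite -RintegralD//; last 2 first.
- have := RintegrableD fi (RintegrableZ (-1) (RintegrableZ (2 * c) f1i)).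
  by congr (_.-integrable _ _); apply/funext => x /=; rewrite mulN1r.
- exact: Rintegrable_cst.
by apply: eq_Rintegral => x _ /=; ring.
Qed.

(** Nonnegativity of the variance: subtract from [f] its mean and expand the square. *)
Lemma cauchy_schwarz_itv a b f : a <= b -> sqint a b f ->
  (\int[mu]_(x in `[a, b]) f x) ^+ 2 <= (b - a) * nsq a b f.
Proof.
rewrite le_eqVlt => /predU1P[<- _|ab sf].
  by rewrite set_itv1 Rintegral_set1 subrr mul0r expr0n.
have := nsq_ge0 a b (f \- cst ((\int[mu]_(x in `[a, b]) f x) / (b - a))).
rewrite nsqB_cst// ?(ltW ab)//; set I := \int[mu]_(x in _) _; set c := I / (b - a).
have ba : 0 < b - a by rewrite subr_gt0.
have IE : I = c * (b - a) by rewrite /c divfK// gt_eqF.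
rewrite IE; nra.
Qed.

Lemma Rintegral_subr_mean a b f : a < b -> sqint a b f ->
  \int[mu]_(x in `[a, b]) (f \- cst ((\int[mu]_(t in `[a, b]) f t) / (b - a))) x = 0.
Proof.
move=> ab f2; rewrite RintegralB//; last 2 first.
- exact: sqint_integrable.
- exact: Rintegrable_cst.
by rewrite Rintegral_itv_cst ?(ltW ab)// divfK ?subrr// gt_eqF// subr_gt0.
Qed.

Lemma nsqS_le a b c d f : a <= c -> d <= b -> sqint a b f -> nsq c d f <= nsq a b f.
Proof.
move=> ac db sf; have [cd|dc] := leP c d; last first.
  by rewrite {1}/nsq set_itv_ge ?Rintegral_set0 ?nsq_ge0// bnd_simp -ltNge.
have [_ fi] := sf; rewrite {2}/nsq (@Rintegral_itv_cat _ a b c)//; last exact: le_trans db.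
rewrite (@Rintegral_itv_cat _ c b d)//; last exact: integrable_subitv fi.
by rewrite -/(nsq a c f) -/(nsq c d f) -/(nsq d b f) addrCA lerDl addr_ge0 ?nsq_ge0.
Qed.

Lemma nsq_eq0 a b f : sqint a b f -> nsq a b f = 0 ->
  {ae mu, forall x, a < x < b -> f x = 0}.
Proof.
move=> [mf fi] f0.
have mf2 : measurable_fun `[a, b] (EFin \o (fun x => f x ^+ 2)) by case/integrableP: fi.
have : (\int[mu]_(x in `[a, b]) `|((f x ^+ 2)%R)%:E| = 0)%E.
  have : (\int[mu]_(x in `[a, b]) ((f x ^+ 2)%R)%:E = 0)%E.
    rewrite -[LHS]fineK; last exact: integrable_fin_num.
    by rewrite -/(Rintegral mu `[a, b] (fun x => f x ^+ 2)) -/(nsq a b f) f0.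
  move=> <-; apply: eq_integral => x _ /=; rewrite ger0_norm//.
  exact: sqr_ge0.
move=> h; have [//|+ _] := ae_eq_integral_abs mu _ mf2.
move=> /(_ h); apply: filterS => x + axb.
rewrite /= in_itv/=; case/andP: axb => ax xb; rewrite !ltW// => /(_ erefl)[] /eqP.
by rewrite sqrf_eq0 => /eqP.
Qed.

End SquareIntegrable.

(** * Behaviour of integrable functions at a singular endpoint *)

Section OperatorPrelim.
Context {R : realType}.
Implicit Types (a b c d x y : R) (f g h v : R -> R).
Notation mu := (@lebesgue_measure R).
Notation pi := (@trigo.pi R).

Lemma prim_derive_at a b f g x : prim a b f g -> a < x < b ->
  {for x, continuous g} -> is_derive x 1 f (g x).
Proof.
move=> [gi fE] /andP[ax xb] cg.
have [dF FE] := @continuous_FTC1_closed R g a x b xb gi ax cg.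
pose F := fun y => f a + \int[mu]_(t in `[a, y]) g t.
have nF : \near x, F x = f x.
  near=> y.
  have -> : f y = f a + \int[mu]_(t in `[a, y]) g t.
    by apply: fE; apply/andP; split; apply: ltW; near: y; [exact: lt_nbhsr|exact: lt_nbhsl].
  by [].
apply: (near_eq_is_derive nF).
rewrite /F -[X in is_derive _ _ _ X]add0r.
apply: is_deriveD; rewrite -FE derive1E.
exact: DeriveDef.
Unshelve. all: by end_near. Qed.

Lemma prim_lip a b f g M x y : prim a b f g ->
  (forall x, a <= x <= b -> `|g x| <= M) -> a <= x -> x <= y -> y <= b ->
  `|f y - f x| <= M * (y - x).
Proof.
move=> pf gM ax xy yb; have [gi _] := pf.
have gixy : mu.-integrable `[x, y] (EFin \o g) by exact: integrable_subitv gi.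
rewrite (primB_int pf)// (le_trans (le_normr_Rintegral _ gixy))//.
rewrite -(Rintegral_itv_cst _ xy); apply: le_Rintegral => //.
- exact: (integrable_norm gixy).
- exact: Rintegrable_cst.
- move=> z; rewrite /= in_itv/= => /andP[xz zy]; apply: gM.
  by rewrite (le_trans ax xz) (le_trans zy yb).
Qed.

Lemma prim_sin a b : prim a b (@sin R) (@cos R).
Proof. by apply: prim_C1 => x _; exact: continuous_cos. Qed.

Lemma prim_cos a b : prim a b (@cos R) (fun x => - sin x).
Proof.
apply: prim_C1 => x _.
by apply: continuousN; exact: continuous_sin.
Qed.

Lemma sin_lip x y : `|sin x - sin y| <= `|x - y|.
Proof.
wlog xy : x y / y <= x => [H|].
  have [/H//|/ltW/H] := leP y x.
  by rewrite distrC (distrC x).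
rewrite [leRHS]ger0_norm ?subr_ge0// -[leRHS]mul1r.
by apply: (prim_lip (prim_sin y x)) => // z _; exact: cos_max.
Qed.

(** The primitive of [|v|] is uniformly continuous, yet it grows by at least [k / 2] on arbitrarily
    short intervals: at distance at most [2 * h] from [c] one has [|v| >= k / (2 * h)], over a
    length [h]. *)
Lemma no_pole a b c v (k : R) : a < b -> mu.-integrable `[a, b] (EFin \o v) ->
  c = a \/ c = b -> 0 < k ->
  {ae mu, forall x, a < x < b -> k <= `|x - c| * `|v x|} -> False.
Proof.
move=> ab vi cab k0 kv.
pose w x := `|v x|.
have wi : mu.-integrable `[a, b] (EFin \o w) by exact: (integrable_norm vi).
pose W x := \int[mu]_(t in `[a, x]) w t.
have pW : prim a b W w.
  by split=> // x _; rewrite /W set_itv1 Rintegral_set1 add0r.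
have [|d d0 Wd] := abs_cont_unif (ltW ab) (prim_abs_cont (ltW ab) pW) (e := k / 2).
  by rewrite divr_gt0.
pose h := Num.min d (b - a) / 4.
have h0 : 0 < h by rewrite divr_gt0// lt_min d0 subr_gt0.
have hd : h < d.
  rewrite /h ltr_pdivrMr// (@le_lt_trans _ _ d)// ?ge_min ?lexx// ltr_pMr//.
  by rewrite ltr1n.
have hab : 4 * h <= b - a by rewrite /h mulrC divfK// ge_min lexx orbT.
(* The interval is the second one of length [h] counted from the endpoint [c]. *)
have [x [ax xhb cx]] : exists x, [/\ a <= x, x + h <= b &
    forall t, x <= t <= x + h -> `|t - c| <= 2 * h].
  case: cab => ->; [exists (a + h)|exists (b - 2 * h)]; split; try lra.
    by move=> t /andP[t1 t2]; rewrite ler_norml; apply/andP; split; lra.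
  by move=> t /andP[t1 t2]; rewrite ler_norml; apply/andP; split; lra.
have xh : x <= x + h by lra.
have := Wd (x + h) x; rewrite ax xhb (le_trans xh xhb) (le_trans ax xh).
rewrite addrAC subrr add0r gtr0_norm// => /(_ erefl erefl hd).
apply/negP; rewrite -leNgt (le_trans _ (ler_norm _))//.
(* Taking the maximum turns the almost-everywhere lower bound into a pointwise one without changing
   the integral. *)
pose u t := Num.max (w t) (k / (2 * h)).
have mw : measurable_fun `[a, b] w by exact: Rintegrable_measurable wi.
have pu : prim x (x + h) W u.
  apply: prim_ae (primS ax xhb pW).
    apply: measurable_maxr => //; apply: measurable_funS mw => // t; rewrite /= !in_itv/=.
    by move=> /andP[xt txh]; rewrite (le_trans ax xt) (le_trans txh xhb).
  apply: filterS kv => t kv /andP[xt txh].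
  have h2 : 0 < 2 * h by lra.
  rewrite /u max_l// ler_pdivrMr//.
  have /kv : a < t < b by rewrite (le_lt_trans ax xt) (lt_le_trans txh xhb).
  move=> /le_trans; apply; rewrite mulrC ler_wpM2l// cx//.
  by rewrite !ltW.
have -> : k / 2 = \int[mu]_(t in `[x, x + h]) (k / (2 * h)).
  by rewrite Rintegral_itv_cst//; field; rewrite gt_eqF.
rewrite (primB_int pu)//; apply: le_Rintegral => //.
- exact: Rintegrable_cst.
- by case: pu.
- by move=> t _; rewrite /u le_max lexx orbT.
Qed.

(* Otherwise [v] would dominate a multiple of [1 / |x - c|], which is not integrable. *)
Lemma prim_vanish a b c P P' s v : a < b -> prim a b P P' ->
  mu.-integrable `[a, b] (EFin \o v) -> c = a \/ c = b ->
  (forall x, a < x < b -> `|s x| <= `|x - c|) ->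
  {ae mu, forall x, a < x < b -> P x = s x * v x} -> P c = 0.
Proof.
move=> ab pP vi cab sc Pv; apply/eqP/negPn/negP => Pc0.
have k0 : 0 < `|P c| / 2 by rewrite divr_gt0// normr_gt0.
have [d d0 Pd] := abs_cont_unif (ltW ab) (prim_abs_cont (ltW ab) pP) k0.
pose h := Num.min d (b - a) / 2.
have h0 : 0 < h by rewrite divr_gt0// lt_min d0 subr_gt0.
have hd : h < d.
  rewrite /h ltr_pdivrMr// (@le_lt_trans _ _ d)// ?ge_min ?lexx// ltr_pMr//.
  by rewrite ltr1n.
have hab : 2 * h <= b - a by rewrite /h mulrC divfK// ge_min lexx orbT.
(* A short interval that still has [c] as an endpoint and on which [|P|] exceeds half of [|P c|], as
   [no_pole] requires. *)
have [a' [b' [aa' bb' ab' cab' a'b']]] : exists a' b', [/\ a <= a', b' <= b, a' < b',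
    c = a' \/ c = b' & b' - a' = h].
  by case: cab => ->; [exists a, (a + h)|exists (b - h), b]; split; lra.
apply: (no_pole (a := a') (b := b') (c := c) (v := v) (k := `|P c| / 2)) => //.
  exact: integrable_subitv vi.
apply: filterS Pv => x Px /andP[ax xb].
have axb : a < x < b by rewrite (le_lt_trans aa' ax) (lt_le_trans xb bb').
have : `|P c - P x| < `|P c| / 2.
  apply: Pd.
  - by case: cab => ->; rewrite lexx ltW.
  - by case/andP: axb => *; rewrite !ltW.
  - apply: le_lt_trans hd; rewrite -a'b' ler_norml.
    by case: cab' => ->; apply/andP; split; lra.
have : `|P c| <= `|P x| + `|P c - P x|.
  by have := ler_normD (P x) (P c - P x); rewrite addrC subrK.
have : `|P x| <= `|x - c| * `|v x| by rewrite Px// normrM ler_wpM2r// sc.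
lra.
Qed.

End OperatorPrelim.

(** * The operator on real functions, in integrated form *)

Section RealOperator.
Context {R : realType}.
Variable eps : R.
Hypothesis eps0 : 0 < eps.
Implicit Types (a b c d x y : R) (f g h u v : R -> R).
Notation mu := (@lebesgue_measure R).
Notation pi := (@trigo.pi R).

Lemma pi0 : - pi < pi. Proof. by have := @pi_gt0 R; lra. Qed.

Definition Fint f x := \int[mu]_(t in `[- pi, x]) f t.

Definition graphLr u f : Prop :=
  [/\ sqint (- pi) pi u, sqint (- pi) pi f, abs_cont (- pi) pi u, u (- pi) = u pi &
    exists p, [/\ forall a b, - pi < a -> b < pi -> abs_cont a b p,
      {ae mu, forall x, - pi < x < pi -> p x = sin x * derive1 u x} &
      {ae mu, forall x, - pi < x < pi -> f x = eps * derive1 p x + derive1 u x}]].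

(* The integrated form of [Lu = f], with [v = u']: the flux [eps sin u' + u] is a
   primitive of [f], which takes the value [u (-pi)] at [-pi]. *)
Definition solves u v f : Prop :=
  [/\ sqint (- pi) pi f, prim (- pi) pi u v, u (- pi) = u pi,
      \int[mu]_(t in `[- pi, pi]) f t = 0 &
      {ae mu, forall x, - pi < x < pi -> eps * (sin x * v x) + u x = u (- pi) + Fint f x}].

Lemma prim_Fint f : sqint (- pi) pi f -> prim (- pi) pi (Fint f) f.
Proof.
move=> /sqint_integrable fi; split=> // x _.
by rewrite /Fint set_itv1 Rintegral_set1 add0r.
Qed.

Lemma FintNpi f : Fint f (- pi) = 0.
Proof. by rewrite /Fint set_itv1 Rintegral_set1. Qed.

Lemma sin_le_pole x : `|sin x| <= `|x - 0| /\ `|sin x| <= `|x - pi| /\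
  `|sin x| <= `|x - - pi|.
Proof.
have := sin_lip x pi; have := sin_lip x (- pi); have := sin_lip x 0.
by rewrite sin0 sinN sinpi !oppr0 !addr0.
Qed.

(** Local absolute continuity of the flux makes [q - Fint f] constant on the open interval only. The
    passage to the endpoints rests on the integrability of [v], through [prim_vanish]. *)
Lemma graphLr_solves u f : graphLr u f -> exists v, solves u v f.
Proof.
move=> [u2 f2 acu upi [p [acp pE fE]]].
have [v pv] := abs_cont_prim pi0 acu.
have aev := prim_is_derive pv; have [vi _] := pv; have [mf _] := f2.
pose q := fun x => eps * p x + u x.
have primq a b : - pi < a -> a < b -> b < pi -> prim a b q f.
  move=> pia ab bpi; have [p1 pp] := abs_cont_prim ab (acp a b pia bpi).
  have := primD (primZ eps pp) (primS (ltW pia) (ltW bpi) pv).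
  apply: prim_ae.
    apply: measurable_funS mf => // x; rewrite /= !in_itv/= => /andP[ax xb].
    by rewrite (le_trans (ltW pia) ax) (le_trans xb (ltW bpi)).
  move: fE aev (prim_is_derive pp).
  apply: filterS3 => x fE dv dp /[dup] axb /andP[ax xb].
  have xpi : - pi < x < pi by rewrite (lt_trans pia ax) (lt_trans xb bpi).
  rewrite fE//= !derive1E.
  by rewrite (@derive_val _ _ _ _ _ _ _ (dp axb)) (@derive_val _ _ _ _ _ _ _ (dv xpi)).
have pF := prim_Fint f2.
pose C := q 0 - Fint f 0.
have qC x : - pi < x < pi -> q x - Fint f x = C.
  have H a b : - pi < a -> a <= b -> b < pi -> q b - Fint f b = q a - Fint f a.
    move=> pia; rewrite le_eqVlt => /predU1P[-> //|ab bpi].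
    have := primB_int (primq a b pia ab bpi) (lexx a) (ltW ab) (lexx b).
    have := primB_int pF (ltW pia) (ltW ab) (ltW bpi); lra.
  have := @pi_gt0 R => pi_gt0.
  move=> /andP[pix xpi]; have [x0|/ltW x0] := leP 0 x; first by apply: H => //; lra.
  by apply/esym; apply: H => //; lra.
(* Equal to [eps * sin x * v x] almost everywhere, but continuous up to the endpoints. Its vanishing
   at [- pi] identifies [C], and its vanishing at [pi] gives mean zero of [f]. *)
pose P := (cst C \+ Fint f) \- u.
have pP : prim (- pi) pi P ((cst 0 \+ f) \- v) by apply: primB pv; exact: primD (prim0 _ _ _) pF.
have Pv : {ae mu, forall x, - pi < x < pi -> P x = (eps * sin x) * v x}.
  move: pE aev; apply: filterS2 => x pE dv xpi.
  rewrite /P/= -(qC x xpi) /q pE// derive1E (@derive_val _ _ _ _ _ _ _ (dv xpi)); ring.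
have Pv' : {ae mu, forall x, - pi < x < pi -> eps^-1 * P x = sin x * v x}.
  by apply: filterS Pv => x Pv /Pv ->; field; rewrite gt_eqF.
have P0 c : c = - pi \/ c = pi -> P c = 0.
  move=> cpi; have : eps^-1 * P c = 0.
    apply: (prim_vanish pi0 (primZ eps^-1 pP) vi cpi _ Pv').
    by move=> x _; case: cpi => ->; have [_ []] := sin_le_pole x.
  by move=> /eqP; rewrite mulf_eq0 invr_eq0 gt_eqF//= => /eqP.
have CE : C = u (- pi).
  have := P0 (- pi) (or_introl erefl); rewrite /P/= FintNpi; lra.
exists v; split => //.
  have := P0 pi (or_intror erefl); rewrite /P/= CE -/(Fint f pi) upi; lra.
apply: filterS Pv => x Pv /Pv; rewrite -CE /P/=; lra.
Qed.

(* The rescaled flux [sin u'] in terms of [u] and [f]. *)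
Definition flux u f x := eps^-1 * (u (- pi) + Fint f x - u x).

Section Solution.
Variables (u v f : R -> R).
Hypothesis uvf : solves u v f.

Lemma prim_flux : prim (- pi) pi (flux u f) (fun x => eps^-1 * (f x - v x)).
Proof.
have [f2 pu _ _ _] := uvf.
have := primZ eps^-1 (primB (primD (prim0 (- pi) pi (u (- pi))) (prim_Fint f2)) pu).
have -> : (fun x => eps^-1 * ((cst 0 \+ f) \- v) x) = (fun x => eps^-1 * (f x - v x)) by
  apply/funext => x /=; rewrite add0r.
by [].
Qed.

Lemma fluxE : {ae mu, forall x, - pi < x < pi -> flux u f x = sin x * v x}.
Proof.
have [_ _ _ _] := uvf; apply: filterS => x uE /uE h.
by rewrite /flux -h; field; rewrite gt_eqF.
Qed.

Lemma fluxNpi : flux u f (- pi) = 0.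
Proof. by rewrite /flux FintNpi; ring. Qed.

Lemma fluxpi : flux u f pi = 0.
Proof. by have [_ _ upi f0 _] := uvf; rewrite /flux /Fint f0 upi; ring. Qed.

Lemma flux0 : flux u f 0 = 0.
Proof.
have [_ pu _ _ _] := uvf; have pi_gt0 := @pi_gt0 R.
have Npi0 : - pi <= 0 by lra.
apply: (prim_vanish pi_gt0 (primS Npi0 (lexx pi) prim_flux) (s := sin) (v := v)).
- by case: pu => vi _; exact: integrable_subitv vi.
- by left.
- by move=> x _; have [] := sin_le_pole x.
- by apply: filterS fluxE => x h /andP[x0 xpi]; apply: h; rewrite xpi; lra.
Qed.

(** Away from the zeros of sin the derivative datum has the continuous representative [flux / sin],
    so [u] is differentiable in the classical sense, as Fermat's criterion at an extremum
    requires. *)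
Lemma solves_is_derive x : - pi < x < pi -> x != 0 ->
  is_derive x 1 u (flux u f x / sin x).
Proof.
move=> /andP[pix xpi] x0; have [_ pu _ _ _] := uvf; have pi_gt0 := @pi_gt0 R.
have [a [b [pia bpi /andP[ax xb] sab]]] : exists a b, [/\ - pi < a, b < pi, a < x < b &
    forall t, a <= t <= b -> sin t != 0].
  have [xpos|xneg] := ltP 0 x.
    exists (x / 2), ((x + pi) / 2); split; try lra.
    by move=> t /andP[t1 t2]; rewrite gt_eqF// sin_gt0_pi//; apply/andP; split; lra.
  have {}xneg : x < 0 by rewrite lt_neqAle x0.
  exists ((x - pi) / 2), (x / 2); split; try lra.
  move=> t /andP[t1 t2]; rewrite -(opprK t) sinN oppr_eq0 gt_eqF// sin_gt0_pi//.
  by apply/andP; split; lra.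
pose g t := flux u f t / sin t.
have cg t : a <= t <= b -> {for t, continuous g}.
  move=> /[dup] atb /andP[at_ tb]; apply: cvgM.
    apply: (prim_cvg _ prim_flux); rewrite (lt_le_trans pia at_); exact: le_lt_trans tb _.
  by apply: cvgV; [exact: sab|exact: continuous_sin].
have pg : prim a b u g.
  apply: prim_ae (primS (ltW pia) (ltW bpi) pu).
    apply: subspace_continuous_measurable_fun => //.
    exact: within_continuous_for.
  apply: filterS fluxE => t h /andP[at_ tb]; rewrite /g h.
    by rewrite mulrC mulKf// sab// !ltW.
  by rewrite (lt_trans pia at_) (lt_trans tb bpi).
have := prim_derive_at pg (x := x); rewrite ax xb; apply => //.
by apply: cg; rewrite !ltW.
Qed.

(* At a maximum of [u] the flux vanishes, so that [u = u (-pi) + Fint f] there. *)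
Lemma solves_le B : (forall x, - pi <= x <= pi -> Fint f x <= B) ->
  forall x, - pi <= x <= pi -> u x <= u (- pi) + B.
Proof.
move=> FB; have [_ pu _ _ _] := uvf.
have [c cI cmax] := EVT_max (ltW pi0) (prim_continuous pu).
move: (cI); rewrite in_itv/= => cpi.
suff flux0c : flux u f c = 0.
  move=> x xpi; apply: le_trans (cmax x _) _; first by rewrite in_itv.
  have := FB c cpi; move/eqP: flux0c; rewrite /flux mulf_eq0 invr_eq0 gt_eqF//=.
  by move=> /eqP; lra.
have /andP[] := cpi; rewrite le_eqVlt => /predU1P[<- _|pic]; first exact: fluxNpi.
rewrite le_eqVlt => /predU1P[->|cltpi]; first exact: fluxpi.
have [->|c0] := eqVneq c 0; first exact: flux0.
have dc : - pi < c < pi by rewrite pic.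
(* The half period containing [c]: [u] is differentiable throughout its interior and has an interior
   maximum there. *)
have [a [b [pia bpi acb ab0]]] : exists a b, [/\ - pi <= a, b <= pi, a < c < b &
    forall t, a < t < b -> t != 0].
  have pi_gt0 := @pi_gt0 R; have [cpos|cneg] := ltP 0 c.
    exists 0, pi; split => //; try lra.
    by move=> t /andP[t0 _]; rewrite gt_eqF.
  have {}cneg : c < 0 by rewrite lt_neqAle c0.
  exists (- pi), 0; split => //; try lra.
  by move=> t /andP[_ t0]; rewrite lt_eqF.
have inI t : a < t < b -> - pi < t < pi.
  by move=> /andP[at_ tb]; rewrite (le_lt_trans pia at_) (lt_le_trans tb bpi).
have dmax : is_derive c 1 u 0.
  apply: (@derive1_at_max _ u a b).
  - by case/andP: acb => ac cb; exact: ltW (lt_trans ac cb).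
  - move=> t; rewrite in_itv/= => atb.
    by have := solves_is_derive (inI _ atb) (ab0 _ atb) => ?.
  - by rewrite in_itv.
  - move=> t; rewrite in_itv/= => /inI/andP[t1 t2]; apply: cmax.
    by rewrite in_itv/= !ltW.
have := solves_is_derive dc c0 => dq.
have : flux u f c / sin c = 0.
  by rewrite -(@derive_val _ _ _ _ _ _ _ dq) (@derive_val _ _ _ _ _ _ _ dmax).
move=> /eqP; rewrite mulf_eq0 invr_eq0 => /orP[/eqP//|].
have [cpos|cneg] := ltP 0 c; first by rewrite gt_eqF// sin_gt0_pi// cpos.
rewrite -(opprK c) sinN oppr_eq0 gt_eqF// sin_gt0_pi//.
by apply/andP; split; [rewrite oppr_gt0 lt_neqAle c0|lra].
Qed.

End Solution.

Lemma solvesD u v f u' v' f' : solves u v f -> solves u' v' f' ->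
  solves (u \+ u') (v \+ v') (f \+ f').
Proof.
move=> [f2 pu upi f0 uE] [f2' pu' upi' f0' uE'].
have fi := sqint_integrable f2; have fi' := sqint_integrable f2'.
split.
- exact: sqintD.
- exact: primD.
- by rewrite /= upi upi'.
- by rewrite RintegralD// f0 f0' addr0.
move: uE uE'; apply: filterS2 => x uE uE' /[dup] xpi /andP[pix pix'].
have E : Fint (f \+ f') x = Fint f x + Fint f' x.
  rewrite /Fint RintegralD//.
    exact: integrable_subitv (lexx _) (ltW pix') fi.
  exact: integrable_subitv (lexx _) (ltW pix') fi'.
have := uE xpi; have := uE' xpi; rewrite E /=; lra.
Qed.

Lemma solvesZ c u v f : solves u v f ->
  solves (fun x => c * u x) (fun x => c * v x) (fun x => c * f x).
Proof.
move=> [f2 pu upi f0 uE]; have fi := sqint_integrable f2; split.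
- exact: sqintZ.
- exact: primZ.
- by rewrite upi.
- by rewrite RintegralZl// f0 mulr0.
apply: filterS uE => x uE /[dup] xpi /andP[pix pix'].
have E : Fint (fun x => c * f x) x = c * Fint f x.
  by rewrite /Fint RintegralZl//; apply: integrable_subitv fi => //; exact: ltW.
by rewrite E -mulrDr -(uE xpi); ring.
Qed.

Lemma solves_cst c : solves (cst c) (cst 0) (cst 0).
Proof.
split.
- exact: sqint_cst.
- exact: prim0.
- by [].
- by rewrite /Rintegral integral0.
apply: aeW => x _; rewrite /Fint /Rintegral integral0 /=; ring.
Qed.

(** The one-sided maximum principle applied to [u] and, by linearity, to its negative. *)
Lemma solves_bound u v f B : solves u v f ->
  (forall x, - pi <= x <= pi -> `|Fint f x| <= B) ->
  forall x, - pi <= x <= pi -> `|u x - u (- pi)| <= B.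
Proof.
move=> uvf FB x xpi; rewrite ler_norml; apply/andP; split.
  have FN t : - pi <= t <= pi -> Fint (fun x => -1 * f x) t <= B.
    move=> /[dup] tpi /andP[t1 t2]; have [/sqint_integrable fi _ _ _ _] := uvf.
    rewrite /Fint RintegralZl//; last exact: integrable_subitv fi.
    by rewrite mulN1r -/(Fint f t); have := FB t tpi; rewrite ler_norml => /andP[]; lra.
  by have := solves_le (solvesZ (-1) uvf) FN xpi; lra.
have FN t : - pi <= t <= pi -> Fint f t <= B.
  by move=> /FB; rewrite ler_norml => /andP[].
by have := solves_le uvf FN xpi; lra.
Qed.

Lemma Fint_bound f x : sqint (- pi) pi f -> - pi <= x <= pi ->
  Fint f x ^+ 2 <= 2 * pi * nsq (- pi) pi f.
Proof.
move=> f2 /andP[pix xpi].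
have f2x : sqint (- pi) x f by exact: sqintS f2.
apply: le_trans (cauchy_schwarz_itv pix f2x) _.
apply: le_trans (ler_wpM2l _ (nsqS_le (lexx _) xpi f2)) _; first lra.
by rewrite ler_wpM2r ?nsq_ge0//; lra.
Qed.

(** The coercivity estimate behind closedness. One factor [2 * pi] comes from Cauchy-Schwarz for
    [Fint f], the other from integrating the resulting uniform bound over the period. *)
Lemma solves_nsq u v f : solves u v f ->
  nsq (- pi) pi (fun x => u x - u (- pi)) <= (2 * pi) ^+ 2 * nsq (- pi) pi f.
Proof.
move=> uvf; have [f2 pu _ _ _] := uvf.
pose B := Num.sqrt (2 * pi * nsq (- pi) pi f).
have B2 : B ^+ 2 = 2 * pi * nsq (- pi) pi f.
  by rewrite sqr_sqrtr// mulr_ge0 ?nsq_ge0// mulr_ge0// pi_ge0.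
have FB x : - pi <= x <= pi -> `|Fint f x| <= B.
  move=> xpi; rewrite -ler_sqr ?nnegrE ?sqrtr_ge0// real_normK ?num_real// B2.
  exact: Fint_bound.
have -> : (2 * pi) ^+ 2 * nsq (- pi) pi f = B ^+ 2 * (pi - - pi) by rewrite B2; ring.
rewrite -(Rintegral_itv_cst (B ^+ 2) (ltW pi0)); apply: le_Rintegral => //.
- have : sqint (- pi) pi (u \- cst (u (- pi))).
    by apply: sqintB; [exact: sqint_prim pu|exact: sqint_cst].
  by case.
- exact: Rintegrable_cst.
move=> x; rewrite /= in_itv/= => xpi; have := solves_bound uvf FB xpi.
by rewrite -ler_sqr ?nnegrE ?sqrtr_ge0// real_normK ?num_real.
Qed.

End RealOperator.

(** * Reflections of the line *)

Section Flip.
Context {R : realType}.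
Implicit Types (a b c d x y : R) (f g h u v : R -> R).
Notation mu := (@lebesgue_measure R).

Definition flip c (x : measurableTypeR R) : measurableTypeR R := (c - x : R).

Lemma measurable_flip c : measurable_fun setT (flip c).
Proof. by apply: (@measurable_funB _ _ _ _ (cst c) (@id R)). Qed.

Lemma flip_itv c a b x : (c - b <= x <= c - a) = (a <= c - x <= b).
Proof. by apply/idP/idP => /andP[h1 h2]; apply/andP; split; lra. Qed.

(** Uniqueness of Lebesgue measure: a reflected half-open interval is open at the other end and has
    the same length. *)
Lemma lebesgue_measure_flip c (A : set R) : measurable A ->
  pushforward mu (flip c) A = mu A.
Proof.
move=> mA; apply/esym; pose m := pushforward mu (flip c).
have mf := measurable_flip c.
apply: (@lebesgue_measure_unique R (pushforward mu (flip c))) => //= _ [[a b]] _ <-.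
rewrite /pushforward.
have -> : flip c @^-1` `]a, b]%classic = `[c - b, c - a[%classic.
  by apply/seteqP; split=> x; rewrite /= !in_itv/= /flip => /andP[h1 h2]; apply/andP; split; lra.
rewrite !lebesgue_measure_itv/= !lte_fin.
have -> : (c - b < c - a) = (a < b) by apply/idP/idP; lra.
by case: ifP => // _; rewrite -!EFinD; congr (_%:E); ring.
Qed.

Lemma flip_image c a b : flip c @^-1` `[a, b]%classic = `[c - b, c - a]%classic.
Proof. by apply/seteqP; split=> x; rewrite /= !in_itv/= /flip flip_itv. Qed.

Lemma Rintegral_flip c a b f : mu.-integrable `[a, b] (EFin \o f) ->
  mu.-integrable `[c - b, c - a] (EFin \o (fun x => f (c - x))) /\
  \int[mu]_(x in `[c - b, c - a]) f (c - x) = \int[mu]_(x in `[a, b]) f x.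
Proof.
move=> fi.
pose G := f \_ `[a, b].
have mf : measurable_fun `[a, b] f by exact: Rintegrable_measurable fi.
have mG : measurable_fun setT (EFin \o G).
  by apply/measurable_EFinP; apply/(measurable_restrictT _ _).1.
have GE x : x \in `[a, b] -> G x = f x by move=> xab; rewrite /G patchE mem_set.
have fE x : x \in `[c - b, c - a] -> (EFin \o G) (flip c x) = (f (c - x))%:E.
  by rewrite in_itv/= flip_itv => xab /=; rewrite GE ?in_itv.
have E (g : R -> \bar R) (A : set R) : measurable A ->
    (\int[pushforward mu (flip c)]_(x in A) g x = \int[mu]_(x in A) g x)%E.
  move=> mA; apply: eq_measure_integral => [|? B mB _]; first exact: measurable_flip.
  exact: lebesgue_measure_flip.
have mfl := measurable_flip c.
have fi' : mu.-integrable `[c - b, c - a] (EFin \o (fun x => f (c - x))).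
  apply: (@eq_integrable _ _ _ _ _ _ ((EFin \o G) \o flip c)) => //.
    by move=> x; rewrite inE/= => /fE.
  apply/integrableP; split.
    apply: measurable_funTS; exact: measurableT_comp mG mfl.
  have := @ge0_integral_pushforward _ _ _ _ R (flip c) mfl mu `[a, b]%classic
    (abse \o (EFin \o G)); rewrite flip_image => <- //.
  - rewrite E//; case/integrableP: fi => _; congr (_ < _)%E.
    by apply: eq_integral => x; rewrite inE/= => xab; rewrite GE.
  - by apply: measurableT_comp => //; exact: measurable_funTS.
  - by move=> x _; exact: abse_ge0.
split=> //; congr fine.
transitivity (\int[mu]_(x in flip c @^-1` `[a, b]) ((EFin \o G) \o flip c) x)%E.
  by rewrite flip_image; apply: eq_integral => x; rewrite inE/= => /fE <-.
rewrite -integral_pushforward//; last first.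
  rewrite flip_image; apply: eq_integrable fi' => //.
  by move=> x; rewrite inE/= => /fE <-.
by rewrite E//; apply: eq_integral => x; rewrite inE/= => xab /=; rewrite GE.
Qed.

Lemma prim_flip c a b f g : prim a b f g ->
  prim (c - b) (c - a) (fun x => f (c - x)) (fun x => - g (c - x)).
Proof.
move=> pf; have [gi _] := pf; have [gi' _] := Rintegral_flip c gi.
apply: primP.
  by have := RintegrableZ (-1) gi'; congr (_.-integrable _ _); apply/funext => x /=; rewrite mulN1r.
move=> x y cx xy yc.
have gxy : mu.-integrable `[c - y, c - x] (EFin \o g).
  by apply: integrable_subitv gi; lra.
have [+ E] := Rintegral_flip c gxy.
rewrite !subKr in E * => gi2.
rewrite (_ : (fun t => - g (c - t)) = (fun t => -1 * g (c - t))); last first.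
  by apply/funext => t; rewrite mulN1r.
rewrite RintegralZl// E -(primB_int pf); lra.
Qed.

Lemma sqint_flip c a b f : sqint a b f -> sqint (c - b) (c - a) (fun x => f (c - x)).
Proof.
move=> f2; have fi := sqint_integrable f2; have [_ f2i] := f2.
have [fi' _] := Rintegral_flip c fi; have [f2i' _] := Rintegral_flip c f2i.
by split=> //; exact: Rintegrable_measurable fi'.
Qed.

End Flip.

(** * Solvability for right-hand sides of mean zero *)

Section TanHalf.
Context {R : realType}.
Implicit Types (x y w : R).
Notation pi := (@trigo.pi R).

Lemma is_derive_congr (f : R -> R) (x a b : R) :
  is_derive x 1 f a -> a = b -> is_derive x 1 f b.
Proof. by move=> ? <-. Qed.

Lemma is_derive_continuous (f : R -> R) (x a : R) :
  is_derive x 1 f a -> {for x, continuous f}.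
Proof. by move=> ?; apply: differentiable_continuous; exact/derivable1_diffP. Qed.

Lemma prim_le (a b : R) (f g P p : R -> R) : a <= b -> prim a b f g -> prim a b P p ->
  (forall x, a <= x <= b -> `|g x| <= p x) -> `|f b - f a| <= P b - P a.
Proof.
move=> ab pf pP gp; have [gi _] := pf; have [pi_ _] := pP.
rewrite (primB_int pf)// (primB_int pP)// (le_trans (le_normr_Rintegral _ gi))//.
by apply: le_Rintegral => //; exact: (integrable_norm gi).
Qed.

Lemma atan_le w : 0 <= w -> atan w <= w.
Proof.
move=> w0; have pa : prim 0 w (@atan R) (fun x => (1 + x ^+ 2)^-1).
  apply: prim_C1 => x _; apply: cvgV; first by rewrite gt_eqF// ltr_wpDr// sqr_ge0.
  by apply: cvgD; [exact: cvg_cst|exact: exprn_continuous].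
have := prim_lip pa (M := 1) (x := 0) (y := w); rewrite atan0 !subr0 mul1r => H.
apply: le_trans (ler_norm _) (H _ _ _ _) => //.
move=> x _; rewrite ger0_norm ?invr_ge0 ?addr_ge0 ?sqr_ge0//.
by rewrite invf_le1 ?ltr_wpDr ?sqr_ge0// lerDl sqr_ge0.
Qed.

Lemma atan_gt0 w : 0 < w -> 0 < atan w.
Proof. by move=> w0; rewrite -[ltLHS](@atan0 R); exact: lt_atan. Qed.

Lemma tan_compl y : tan (pi / 2 - y) = (tan y)^-1.
Proof.
by rewrite -opprB tanN /tan sinBpihalf cosBpihalf mulNr opprK invf_div.
Qed.

Lemma atan_compl_le w : 0 < w -> pi / 2 - atan w <= w^-1.
Proof.
move=> w0; have aw := atan_gt0 w0; have := atan_ltpi2 w => wpi.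
have -> : pi / 2 - atan w = atan w^-1.
  by rewrite -{2}(atanK w) -tan_compl tanK// in_itv/=; apply/andP; split; lra.
by apply: atan_le; rewrite invr_ge0 ltW.
Qed.

Lemma tan_half_gt0 x : 0 < x < pi -> 0 < tan (x / 2).
Proof.
move=> /andP[x0 xpi]; rewrite -(@tan0 R) ltr_tan ?divr_gt0//;
  rewrite in_itv/=; apply/andP; split; lra.
Qed.

Lemma atan_tan_half x : 0 < x < pi -> 2 * atan (tan (x / 2)) = x.
Proof.
move=> /andP[x0 xpi]; rewrite tanK; first by rewrite mulrC divfK.
by rewrite in_itv/=; apply/andP; split; lra.
Qed.

Lemma cos_half_neq0 x : 0 < x < pi -> cos (x / 2) != 0.
Proof.
by move=> /andP[x0 xpi]; rewrite gt_eqF// cos_gt0_pihalf//; apply/andP; split; lra.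
Qed.

Lemma sin_tan_half x : 0 < x < pi ->
  sin x = 2 * tan (x / 2) / (1 + tan (x / 2) ^+ 2).
Proof.
move=> xpi; have c0 := cos_half_neq0 xpi.
rewrite -cos2_tan2// invrK /tan {1}(_ : x = (x / 2) *+ 2); last first.
  by rewrite -mulr_natr divfK.
by rewrite sin_mulr2n -mulr_natr; field.
Qed.

(** Since tan(x/2) solves t' = t / sin, its power [eps^-1] is an integrating factor for
    [eps * sin x * z' + z]. *)
Lemma is_derive_tan_half x : 0 < x < pi ->
  is_derive x 1 (fun x => tan (x / 2)) (tan (x / 2) / sin x).
Proof.
move=> xpi; have c0 := cos_half_neq0 xpi; have t0 := tan_half_gt0 xpi.
have d1 : is_derive x 1 (fun x : R => x / 2) (1 / 2).
  by apply: is_derive_eq; rewrite /GRing.scale/=; ring.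
apply: is_derive_congr (@is_derive1_comp _ tan (fun x => x / 2) x _ _ (is_derive_tan c0) d1) _.
rewrite sin_tan_half// cos2_tan2//; field.
by rewrite !gt_eqF// ltr_wpDr ?sqr_ge0.
Qed.

End TanHalf.

(** * Variation of constants on the half period [0, pi] *)

Section HalfSolution.
Context {R : realType}.
Notation mu := (@lebesgue_measure R).
Notation pi := (@trigo.pi R).
Variables (eps : R) (G : R -> R) (A : R).
Hypotheses (eps0 : 0 < eps) (eps2 : eps < 2).
Hypothesis cG : continuous G.
Hypothesis G0 : forall x, 0 <= x <= pi -> `|G x - G 0| <= A * Num.sqrt x.
Hypothesis Gpi : forall x, 0 <= x <= pi -> `|G x - G pi| <= A * Num.sqrt (pi - x).

(** The right-hand side in the variable u = tan(x/2)^(1/eps), which maps ]0, pi[ onto the positive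
    half-line. Here the integrated equation loses its singular weight: it says that u z is the
    integral of [g] from 0. *)
Let g u := G (2 * atan (u `^ eps)).

Let A0 : 0 <= A.
Proof.
have pi0 := @pi_gt0 R.
have := G0 (x := pi); rewrite lexx ltW// => /(_ erefl) /(le_trans (normr_ge0 _)).
by rewrite pmulr_lge0// sqrtr_gt0.
Qed.

Let argI u : 0 <= u -> 0 <= 2 * atan (u `^ eps) <= pi.
Proof.
move=> u0; have := atan_ltpi2 (u `^ eps) => h1.
have : 0 <= atan (u `^ eps) by rewrite -(@atan0 R) le_atan// powR_ge0.
by move=> h2; apply/andP; split; lra.
Qed.

Let mg : measurable_fun setT g.
Proof.
apply: measurableT_comp; first exact: continuous_measurable_fun.
apply: measurable_funM => //; apply: measurableT_comp; last exact: measurable_powR.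
by apply: continuous_measurable_fun => x; exact: continuous_atan.
Qed.

Let gB u : 0 <= u -> `|g u| <= `|G 0| + A * Num.sqrt pi.
Proof.
move=> /argI uI; have := G0 uI; have := ler_normD (G 0) (g u - G 0).
rewrite addrC subrK => h1 h2; apply: le_trans h1 _; rewrite lerD2l (le_trans h2)//.
by rewrite ler_wpM2l// ler_sqrt ?pi_ge0//; case/andP: uI.
Qed.

Let H M := \int[mu]_(t in `[0, M]) g t.

Let pH M : prim 0 M H g.
Proof.
split.
  apply: Rintegrable_bounded; first exact: measurable_funTS mg.
  by move=> x /andP[x0 _]; exact: gB.
by move=> x _; rewrite /H set_itv1 Rintegral_set1 add0r.
Qed.

Let dH (M : R) : 0 < M -> is_derive M 1 H (g M).
Proof.
move=> M0; apply: (prim_derive_at (pH (M + 1))); first by rewrite M0 ltrDl ltr01.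
apply: continuous_comp; last exact: cG.
apply: cvgM; first exact: cvg_cst.
apply: continuous_comp; last exact: continuous_atan.
exact: is_derive_continuous (is_derive1_powR eps M0).
Qed.

Let H00 : H 0 = 0.
Proof. by rewrite /H set_itv1 Rintegral_set1. Qed.

Let HG0 (M : R) : 0 < M -> `|H M - G 0 * M| <= A * Num.sqrt 2 * Num.sqrt (M `^ eps) * M.
Proof.
move=> M0.
have pid : prim 0 M (fun x => - G 0 * x) (fun x => - G 0 * 1).
  apply: primZ; apply: prim_C1 => x _; exact: cvg_cst.
have pHG := primD (pH M) pid.
have -> : H M - G 0 * M = (H \+ (fun x => - G 0 * x)) M - (H \+ (fun x => - G 0 * x)) 0.
  by rewrite /= H00; ring.
rewrite -[X in _ <= _ * X]subr0; apply: (prim_lip pHG _ (lexx 0) (ltW M0) (lexx M)).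
move=> x /andP[x0 xM]; rewrite /= mulr1 -/(g x).
apply: le_trans (G0 (argI x0)) _; rewrite -mulrA ler_wpM2l// -sqrtrM// ler_wsqrtr//.
rewrite ler_pM2l//; apply: le_trans (atan_le (powR_ge0 _ _)) _.
by apply: ge0_ler_powR => //; rewrite ?nnegrE ?(ltW M0) ?(ltW eps0).
Qed.

Let C := A * Num.sqrt 2 / (1 - eps / 2).

Let s0 : 0 < 1 - eps / 2.
Proof. by rewrite subr_gt0 ltr_pdivrMr// mul1r. Qed.

(** By [Gpi] and [atan_compl_le] the deviation of [g u] from [G pi] is at most a multiple of
    u^(-eps/2). Integrating this power produces the exponent [1 - eps / 2] and the denominator of
    [C], positive because [eps < 2]. *)
Let HGpi (M : R) : 0 < M -> `|H M - G pi * M| <= C * M `^ (1 - eps / 2).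
Proof.
move=> M0; pose K := `|G 0| + A * Num.sqrt pi + `|G pi|.
have K0 : 0 <= K by rewrite !addr_ge0// mulr_ge0// sqrtr_ge0.
(* The comparison power is singular at 0, so it is used on [[d, M]] only; the piece [[0, d]] costs
   at most [K * d], which tends to 0. *)
suff HK (d : R) : 0 < d -> d < M -> `|H M - G pi * M| <= C * M `^ (1 - eps / 2) + K * d.
  apply/ler_addgt0Pr => e e0.
  pose d := Num.min (e / (K + 1)) (M / 2).
  have K1 : 0 < K + 1 by rewrite ltr_wpDl.
  have d0 : 0 < d by rewrite lt_min !divr_gt0.
  apply: le_trans (HK d d0 _) _.
    by rewrite (@le_lt_trans _ _ (M / 2))// ?ge_min ?lexx ?orbT// ltr_pdivrMr//; lra.
  rewrite lerD2l; apply: (@le_trans _ _ ((K + 1) * d)).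
    by rewrite ler_wpM2r ?(ltW d0)// lerDl.
  by rewrite mulrC -ler_pdivlMr// /d ge_min lexx.
move=> d0 dM.
have ppw : prim d M (fun u => C * u `^ (1 - eps / 2))
    (fun u => C * ((1 - eps / 2) * u `^ (1 - eps / 2 - 1))).
  apply: primZ; apply: prim_C1 => u /andP[du _]; have u0 := lt_le_trans d0 du.
    exact: is_derive1_powR.
  apply: cvgM; first exact: cvg_cst.
  exact: is_derive_continuous (is_derive1_powR (1 - eps / 2 - 1) u0).
have pid : prim d M (fun x => - G pi * x) (fun x => - G pi * 1).
  apply: primZ; apply: prim_C1 => x _; exact: cvg_cst.
have pHG := primD (primS (ltW d0) (lexx M) (pH M)) pid.
have := prim_le (ltW dM) pHG ppw.
have h1 : `|H d| <= (`|G 0| + A * Num.sqrt pi) * d.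
  have := prim_lip (M := `|G 0| + A * Num.sqrt pi) (pH d) _ (lexx 0) (ltW d0) (lexx d).
  rewrite H00 !subr0; apply.
  by move=> x /andP[x0 _]; exact: gB.
have h2 : `|G pi * d| = `|G pi| * d by rewrite normrM (gtr0_norm d0).
have h3 : 0 <= C * d `^ (1 - eps / 2).
  by rewrite mulr_ge0 ?powR_ge0// divr_ge0 ?(ltW s0)// mulr_ge0// sqrtr_ge0.
move=> Hle; have {Hle} : `|H M - G pi * M - (H d - G pi * d)| <= 
    C * M `^ (1 - eps / 2) - C * d `^ (1 - eps / 2).
  have -> : H M - G pi * M - (H d - G pi * d) =
    H M + - G pi * M - (H d + - G pi * d) by ring.
  apply: Hle => u /andP[du uM]; have u0 := lt_le_trans d0 du.
  rewrite /= mulr1 -/(g u); apply: le_trans (Gpi (argI (ltW u0))) _.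
  have w0 : 0 < u `^ eps by exact: powR_gt0.
  have -> : C * ((1 - eps / 2) * u `^ (1 - eps / 2 - 1)) =
      A * (Num.sqrt 2 * Num.sqrt (u `^ eps)^-1).
    rewrite /C mulrA divfK ?gt_eqF// -mulrA; congr (_ * (_ * _)).
    rewrite -powRN -powR12_sqrt ?powR_ge0// -powRrM; congr (_ `^ _); lra.
  rewrite ler_wpM2l// -sqrtrM// ler_wsqrtr//.
  by have := atan_compl_le w0; lra.
have := ler_normD (H M - G pi * M - (H d - G pi * d)) (H d - G pi * d).
have := ler_normB (H d) (G pi * d); rewrite subrK /K; lra.
Qed.

Let m x := tan (x / 2) `^ eps^-1.

Let dm (x : R) : 0 < x < pi -> is_derive x 1 m (m x / (eps * sin x)).
Proof.
move=> xpi; have t0 := tan_half_gt0 xpi.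
have d := @is_derive1_comp _ (fun y : R => y `^ eps^-1) (fun x => tan (x / 2)) x _ _
  (is_derive1_powR eps^-1 t0) (is_derive_tan_half xpi).
apply: (@is_derive_congr _ m _ _ _ d).
have s_gt0 : 0 < sin x by exact: sin_gt0_pi.
rewrite powRB ?(gt_eqF t0) ?implybT// powRr1 ?ltW// /m; field.
by rewrite !gt_eqF.
Qed.

(** The solution is the average of [g] over [[0, m x]], and an average inherits the deviation bounds
    at both poles. The constant [D] adds those of the two poles. *)
Lemma half_solution : exists z D, forall x, 0 < x < pi ->
  [/\ is_derive x 1 z ((G x - z x) / (eps * sin x)),
      `|z x - G 0| <= D * Num.sqrt (tan (x / 2)) &
      `|z x - G pi| <= D * Num.sqrt (tan (x / 2))^-1].
Proof.
exists (fun x => H (m x) / m x), (A * Num.sqrt 2 + C) => x xpi.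
have t0 := tan_half_gt0 xpi; have m0 : 0 < m x by exact: powR_gt0.
have s_gt0 : 0 < sin x by exact: sin_gt0_pi.
have mE : m x `^ eps = tan (x / 2).
  by rewrite /m -powRrM mulVf ?gt_eqF// powRr1// ltW.
have AS : 0 <= A * Num.sqrt 2 by rewrite mulr_ge0// sqrtr_ge0.
have C0 : 0 <= C by rewrite divr_ge0// ltW.
split.
- have dHm := @is_derive1_comp _ H m x _ _ (dH m0) (dm xpi).
  have dVm := @is_deriveV _ m x _ 1 (lt0r_neq0 m0) (dm xpi).
  have d : is_derive x 1 ((H \o m) * (fun y => (m y)^-1))
      (G x / (eps * sin x) - H (m x) / m x / (eps * sin x)).
    have gmE : g (m x) = G x by rewrite /g mE atan_tan_half.
    apply: (@is_derive_congr _ _ _ _ _ (is_deriveM dHm dVm)).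
    rewrite /GRing.scale/= gmE; field.
    by rewrite !gt_eqF.
  apply: (@is_derive_congr _ (fun x => H (m x) / m x) _ _ _ d).
  by rewrite mulrBl.
- have := HG0 m0; rewrite mE => h.
  have -> : H (m x) / m x - G 0 = (H (m x) - G 0 * m x) / m x by field; rewrite gt_eqF.
  rewrite normrM normfV (gtr0_norm m0) ler_pdivrMr// (le_trans h)// ler_wpM2r ?(ltW m0)//.
  by rewrite ler_wpM2r ?sqrtr_ge0// lerDl.
- have h := HGpi m0.
  have -> : H (m x) / m x - G pi = (H (m x) - G pi * m x) / m x by field; rewrite gt_eqF.
  rewrite normrM normfV (gtr0_norm m0) ler_pdivrMr// (le_trans h)//.
  have -> : m x `^ (1 - eps / 2) = Num.sqrt (tan (x / 2))^-1 * m x.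
    rewrite powRB ?(gt_eqF m0) ?implybT// powRr1 ?(ltW m0)// mulrC; congr (_ * _).
    by rewrite sqrtrV ?(ltW t0)// -powR12_sqrt ?(ltW t0)// -mE -powRrM.
  by rewrite mulrA ler_wpM2r ?(ltW m0)// ler_wpM2r ?sqrtr_ge0// lerDr.
Qed.

End HalfSolution.

(** * Regularity of the half-period solution up to the poles *)

Section HalfPrim.
Context {R : realType}.
Notation mu := (@lebesgue_measure R).
Notation pi := (@trigo.pi R).
Variables (eps : R) (G z : R -> R) (B : R).
Hypotheses (eps0 : 0 < eps) (cG : continuous G) (B0 : 0 <= B).
Hypothesis dz : forall x, 0 < x < pi -> is_derive x 1 z ((G x - z x) / (eps * sin x)).
Hypothesis zB : forall x, 0 < x < pi ->
  `|G x - z x| <= B * Num.sqrt (tan (x / 2)) /\ `|G x - z x| <= B * Num.sqrt (tan (x / 2))^-1.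

Let w (x : R) := Num.sqrt (tan (x / 2)).

Let w0 (x : R) : 0 < x < pi -> 0 < w x.
Proof. by move=> /tan_half_gt0; rewrite /w sqrtr_gt0. Qed.

Let w2 (x : R) : 0 < x < pi -> tan (x / 2) = w x ^+ 2.
Proof. by move=> /tan_half_gt0/ltW xpi; rewrite sqr_sqrtr. Qed.

(** The minimum of w and 1/w is at most 2 w / (1 + w^2), which joins the decay at both poles in one
    smooth formula. *)
Let zw (x : R) : 0 < x < pi -> `|G x - z x| <= 2 * B * (w x / (1 + w x ^+ 2)).
Proof.
move=> xpi; have [h1 h2] := zB xpi; have w_gt0 := w0 xpi.
have w2_gt0 : 0 < 1 + w x ^+ 2 by rewrite ltr_wpDr// sqr_ge0.
rewrite mulrA ler_pdivlMr//.
move: h2; rewrite sqrtrV ?(ltW (tan_half_gt0 xpi))// -/(w x) => h2.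
move: h1; rewrite -/(w x) => h1.
have [w1|/ltW w1] := leP (w x) 1.
  apply: (@le_trans _ _ (B * w x * (1 + w x ^+ 2))).
    by rewrite ler_wpM2r ?(ltW w2_gt0).
  have : w x ^+ 2 <= 1 by rewrite expr_le1// ltW.
  have : 0 <= B * w x by rewrite mulr_ge0// ltW.
  nra.
apply: (@le_trans _ _ (B * (w x)^-1 * (1 + w x ^+ 2))).
  by rewrite ler_wpM2r ?(ltW w2_gt0).
have : 1 <= w x ^+ 2 by rewrite exprn_ege1.
have -> : B * (w x)^-1 * (1 + w x ^+ 2) = B * (1 + w x ^+ 2) / w x by rewrite mulrAC.
rewrite ler_pdivrMr// => h.
have -> : 2 * B * w x * w x = B * (2 * w x ^+ 2) by ring.
by rewrite ler_wpM2l//; lra.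
Qed.

(** Square [zw], replace (1 + w^2)^2 by the smaller 1 + w^4, and use sin x = 2 w^2 / (1 + w^4) for
    w^2 = tan(x/2). *)
Lemma half_sin (x : R) : 0 < x < pi -> (G x - z x) ^+ 2 <= 2 * B ^+ 2 * sin x.
Proof.
move=> xpi; have h := zw xpi; have w_gt0 := w0 xpi.
have w2_gt0 : 0 < 1 + w x ^+ 2 by rewrite ltr_wpDr// sqr_ge0.
have w4_gt0 : 0 < 1 + w x ^+ 2 ^+ 2 by rewrite ltr_wpDr// sqr_ge0.
have hw0 : 0 <= 2 * B * (w x / (1 + w x ^+ 2)).
  by apply: mulr_ge0; [exact: mulr_ge0|apply: divr_ge0; exact: ltW].
rewrite -(real_normK (num_real (G x - z x))).
apply: (@le_trans _ _ ((2 * B * (w x / (1 + w x ^+ 2))) ^+ 2)).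
  by rewrite ler_pXn2r// nnegrE.
rewrite sin_tan_half// w2//.
have -> : 2 * B ^+ 2 * (2 * w x ^+ 2 / (1 + w x ^+ 2 ^+ 2)) =
  (2 * B * w x) ^+ 2 / (1 + w x ^+ 2 ^+ 2) by field; rewrite gt_eqF.
rewrite mulrA expr_div_n ler_wpM2l ?sqr_ge0// lef_pV2 ?posrE ?exprn_gt0//.
by have := sqr_ge0 (w x); nra.
Qed.

Definition halfz (x : R) : R := if x <= 0 then G 0 else if pi <= x then G pi else z x.

Lemma halfzE (x : R) : 0 < x < pi -> halfz x = z x.
Proof. by move=> /andP[x0 xpi]; rewrite /halfz leNgt x0 leNgt xpi. Qed.

Lemma halfz0 : halfz 0 = G 0. Proof. by rewrite /halfz lexx. Qed.
Lemma halfzpi : halfz pi = G pi.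
Proof. by rewrite /halfz leNgt pi_gt0 lexx. Qed.

(** By [half_sin] the solution is squeezed between [G] plus and minus a multiple of the square root
    of sin, which vanishes at the pole. *)
Let halfz_cvg (c : R) (F : set_system R) : Filter F -> sin c = 0 -> F --> c ->
  halfz c = G c -> (\forall x \near F, 0 < x < pi) -> halfz x @[x --> F] --> halfz c.
Proof.
move=> FF sc Fc hc Fx; rewrite hc.
have c1 : G x @[x --> F] --> G c by apply: cvg_comp Fc _; exact: cG.
have c2 : Num.sqrt (2 * B ^+ 2 * sin x) @[x --> F] --> (0 : R).
  rewrite -(sqrtr0 R) -[X in Num.sqrt X](mulr0 (2 * B ^+ 2)) -sc.
  apply: continuous_cvg; first exact: sqrt_continuous.
  apply: cvgM; first exact: cvg_cst.
  by apply: cvg_comp Fc _; exact: continuous_sin.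
have c3 : G x - Num.sqrt (2 * B ^+ 2 * sin x) @[x --> F] --> G c.
  by rewrite -[X in _ --> X](subr0 (G c)); exact: cvgB.
have c4 : G x + Num.sqrt (2 * B ^+ 2 * sin x) @[x --> F] --> G c.
  by rewrite -[X in _ --> X](addr0 (G c)); exact: cvgD.
apply: squeeze_cvgr c3 c4; near=> x; have xpi : 0 < x < pi by near: x.
have h := half_sin xpi.
have : `|G x - halfz x| <= Num.sqrt (2 * B ^+ 2 * sin x).
  by rewrite halfzE// -(sqrtr_sqr (G x - z x)) ler_wsqrtr.
by rewrite ler_norml => /andP[h1 h2]; apply/andP; split; lra.
Unshelve. all: by end_near. Qed.

Let k (x : R) := (G x - z x) / (eps * sin x).

Let cz (x : R) : 0 < x < pi -> {for x, continuous z}.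
Proof. by move=> /dz /is_derive_continuous. Qed.

Let ck (x : R) : 0 < x < pi -> {for x, continuous k}.
Proof.
move=> xpi; have s_gt0 : 0 < sin x by exact: sin_gt0_pi.
apply: cvgM; first by apply: cvgB; [exact: cG|exact: cz].
apply: cvgV; first by rewrite mulf_neq0// gt_eqF.
by apply: cvgM; [exact: cvg_cst|exact: continuous_sin].
Qed.

Lemma prim_half : prim 0 pi halfz k.
Proof.
have pi0 := @pi_gt0 R.
(* By the chain rule and w^2 = tan(x/2), the derivative of [P] is exactly the bound of [zw] divided
   by [eps * sin x]; so [P] is a bounded antiderivative of a majorant of [|k|]. *)
pose P (x : R) := 4 * B / eps * atan (w x).
pose p (x : R) := 4 * B / eps * ((1 + w x ^+ 2)^-1 * ((2 * w x)^-1 * (tan (x / 2) / sin x))).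
have dw (x : R) : 0 < x < pi -> is_derive x 1 w ((2 * w x)^-1 * (tan (x / 2) / sin x)).
  move=> xpi; have t0 := tan_half_gt0 xpi.
  exact: (@is_derive1_comp _ (@Num.sqrt R) (fun x => tan (x / 2)) x _ _
    (is_derive1_sqrt t0) (is_derive_tan_half xpi)).
apply: (@prim_dominated _ _ _ _ _ P p (4 * B / eps * (pi / 2)) pi0).
- move=> x xpi; apply: near_eq_is_derive (dz xpi).
  case/andP: xpi => x0 xpi; near=> y; rewrite halfzE//; apply/andP; split; near: y.
    exact: lt_nbhsr.
  exact: lt_nbhsl.
- exact: ck.
- apply: halfz_cvg; rewrite ?sin0 ?halfz0//; first exact: cvg_within.
  near=> x; apply/andP; split; near: x; [exact: nbhs_right_gt|exact: nbhs_right_lt].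
- apply: halfz_cvg; rewrite ?sinpi ?halfzpi//; first exact: cvg_within.
  near=> x; apply/andP; split; near: x; [exact: nbhs_left_gt|exact: nbhs_left_lt].
- move=> x xpi.
  have d := @is_derive1_comp _ (@atan R) w x _ _ (is_derive1_atan (w x)) (dw x xpi).
  exact: (is_deriveZ (4 * B / eps) d).
- move=> x xpi; have w_gt0 := w0 xpi.
  have cw : {for x, continuous w} by exact: is_derive_continuous (dw x xpi).
  have s_gt0 : 0 < sin x by exact: sin_gt0_pi.
  apply: cvgM; first exact: cvg_cst.
  apply: cvgM.
    apply: cvgV; first by rewrite gt_eqF// ltr_wpDr// sqr_ge0.
    by apply: cvgD; [exact: cvg_cst|exact: cvgM].
  apply: cvgM; first apply: cvgV.
  - by rewrite mulf_neq0// gt_eqF.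
  - by apply: cvgM; [exact: cvg_cst|].
  - apply: cvgM; first exact: is_derive_continuous (is_derive_tan_half xpi).
    by apply: cvgV; [rewrite gt_eqF|exact: continuous_sin].
- move=> x xpi; have h := zw xpi; have w_gt0 := w0 xpi.
  have s_gt0 : 0 < sin x by exact: sin_gt0_pi.
  have w2_gt0 : 0 < 1 + w x ^+ 2 by rewrite ltr_wpDr// sqr_ge0.
  rewrite /k normrM normfV (gtr0_norm (mulr_gt0 eps0 s_gt0)) ler_pdivrMr ?mulr_gt0//.
  apply: le_trans h _; rewrite /p w2//.
  by rewrite [leRHS](_ : _ = 2 * B * (w x / (1 + w x ^+ 2))) //; field; rewrite !gt_eqF.
- move=> x xpi; rewrite /P normrM ger0_norm; last by rewrite divr_ge0 ?mulr_ge0// ltW.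
  rewrite ler_wpM2l//; first by rewrite divr_ge0 ?mulr_ge0// ltW.
  by rewrite ler_norml !ltW ?atan_ltpi2 ?atan_gtNpi2.
Unshelve. all: by end_near. Qed.

End HalfPrim.

(** * Gluing the two half periods *)

Section Existence.
Context {R : realType}.
Implicit Types (a b c x : R) (f g h u v : R -> R).
Notation mu := (@lebesgue_measure R).
Notation pi := (@trigo.pi R).

Lemma eq_prim_deriv a b f g h : {in `[a, b], g =1 h} -> prim a b f g -> prim a b f h.
Proof.
move=> gh [gi fE]; split.
  by apply: eq_integrable gi => // x; rewrite inE/= => /gh gx; rewrite gx.
move=> x /[dup] axb /andP[ax xb]; rewrite fE//; congr (_ + _).
apply: eq_Rintegral => t; rewrite inE/= in_itv/= => /andP[at_ tx].
by apply: gh; rewrite in_itv/= at_ (le_trans tx xb).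
Qed.

Lemma prim_glue a b c f g h : a <= c -> c <= b -> prim a c f g -> prim c b f h ->
  prim a b f (fun x => if x <= c then g x else h x).
Proof.
move=> ac cb pg ph; set k := fun x => _.
have [hi _] := ph; have mh := Rintegrable_measurable hi.
apply: (prim_cat ac cb).
  by apply: eq_prim_deriv pg => x; rewrite in_itv/= /k => /andP[_ ->].
apply: prim_ae ph; last first.
  by apply: aeW => x /andP[cx _]; rewrite /k leNgt cx.
rewrite -(@setU1itv _ _ (BRight b) c false); last by rewrite bnd_simp.
apply/measurable_funU => //; split; first exact: measurable_fun_set1.
apply: (eq_measurable_fun h).
  by move=> x; rewrite inE/= in_itv/= /k => /andP[cx _]; rewrite leNgt cx.
apply: measurable_funS mh => // x; rewrite /= !in_itv/= => /andP[cx ->].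
by rewrite ltW.
Qed.

Variables (eps : R) (eps0 : 0 < eps) (eps2 : eps < 2).

Lemma sqrt_tan_bounds x : 0 < x < pi ->
  Num.sqrt x <= Num.sqrt 2 * Num.sqrt (tan (x / 2)) /\
  Num.sqrt (pi - x) <= Num.sqrt 2 * Num.sqrt (tan (x / 2))^-1.
Proof.
move=> xpi; have t0 := tan_half_gt0 xpi; rewrite -!sqrtrM//.
have := atan_tan_half xpi => xE.
split; apply: ler_wsqrtr.
  by rewrite -{1}xE ler_wpM2l// atan_le// ltW.
by have := atan_compl_le t0; move: xE; set t := atan _; set w := (tan _)^-1; lra.
Qed.

Lemma half_exists (G : R -> R) (A : R) : continuous G ->
  (forall x, 0 <= x <= pi -> `|G x - G 0| <= A * Num.sqrt x) ->
  (forall x, 0 <= x <= pi -> `|G x - G pi| <= A * Num.sqrt (pi - x)) ->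
  exists z k B, [/\ prim 0 pi z k, z 0 = G 0, z pi = G pi,
    (forall x, 0 < x < pi -> eps * (sin x * k x) + z x = G x) &
    (forall x, 0 < x < pi -> (G x - z x) ^+ 2 <= B * sin x)].
Proof.
move=> cG GA0 GApi; have [z [D zD]] := half_solution eps0 eps2 cG GA0 GApi.
have A0 : 0 <= A.
  have := GA0 (pi : R); rewrite lexx pi_ge0 => /(_ erefl) /(le_trans (normr_ge0 _)).
  by rewrite pmulr_lge0// sqrtr_gt0 pi_gt0.
have D0 : 0 <= D.
  have h : 0 < (pi : R) / 2 < pi by have := @pi_gt0 R => ?; apply/andP; split; lra.
  have [_ + _] := zD _ h => /(le_trans (normr_ge0 _)).
  by rewrite pmulr_lge0// sqrtr_gt0 tan_half_gt0.
pose B := A * Num.sqrt 2 + D.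
have B0 : 0 <= B by rewrite addr_ge0// mulr_ge0// sqrtr_ge0.
have dz x : 0 < x < pi -> is_derive x 1 z ((G x - z x) / (eps * sin x)) by case/zD.
have zB x : 0 < x < pi -> `|G x - z x| <= B * Num.sqrt (tan (x / 2)) /\
    `|G x - z x| <= B * Num.sqrt (tan (x / 2))^-1.
  move=> xpi; have [_ h1 h2] := zD x xpi; have [s1 s2] := sqrt_tan_bounds xpi.
  have xI : 0 <= x <= pi by case/andP: xpi => *; rewrite !ltW.
  have g1 := GA0 x xI; have g2 := GApi x xI.
  rewrite /B !mulrDl -!mulrA; split.
    have -> : G x - z x = (G x - G 0) - (z x - G 0) by ring.
    apply: le_trans (ler_normB _ _) _; apply: lerD => //.
    by apply: le_trans g1 _; rewrite ler_wpM2l.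
  have -> : G x - z x = (G x - G pi) - (z x - G pi) by ring.
  apply: le_trans (ler_normB _ _) _; apply: lerD => //.
  by apply: le_trans g2 _; rewrite ler_wpM2l.
exists (halfz G z), (fun x => (G x - z x) / (eps * sin x)), (2 * B ^+ 2); split.
- exact: prim_half cG B0 dz zB.
- exact: halfz0.
- exact: halfzpi.
- move=> x xpi; rewrite halfzE//; have s_gt0 : 0 < sin x by exact: sin_gt0_pi.
  by field; rewrite !gt_eqF.
- by move=> x xpi; rewrite halfzE//; exact: half_sin B0 zB _ xpi.
Qed.

(** The half-period solutions take the values of [F] at [- pi], 0 and [pi], so they match at 0 and
    glue to a primitive across the interior pole. The bound on the flux is kept for the cutoff. *)
Lemma solves_exists f : sqint (- pi) pi f -> \int[mu]_(t in `[- pi, pi]) f t = 0 ->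
  exists u v E, [/\ solves eps u v f, 0 <= E &
    forall x, - pi <= x <= pi -> flux eps u f x ^+ 2 <= E * `|sin x|].
Proof.
move=> f2 f0; have pF := prim_Fint f2.
have pi_gt0 := @pi_gt0 R.
pose F := Fint f \o clamp (- pi) pi.
have FE x : - pi <= x <= pi -> F x = Fint f x by move=> xpi; rewrite /F/= clamp_id.
have cF : continuous F.
  by apply: abs_cont_clamp_continuous; [exact: ltW pi0|exact: prim_abs_cont (ltW pi0) pF].
pose A := Num.sqrt (nsq (- pi) pi f).
(* Cauchy-Schwarz: the Hoelder constant is the L^2 norm of [f]. *)
have FA x y : - pi <= x -> x <= y -> y <= pi -> `|F y - F x| <= A * Num.sqrt (y - x).
  move=> pix xy ypi.
  rewrite !FE ?pix ?ypi ?(le_trans pix xy) ?(le_trans xy ypi)//.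
  rewrite /A -sqrtrM ?nsq_ge0// -sqrtr_sqr ler_wsqrtr// (primB_int pF)//.
  apply: le_trans (cauchy_schwarz_itv xy (sqintS pix ypi f2)) _.
  by rewrite mulrC ler_wpM2r ?subr_ge0//; exact: nsqS_le.
have [||z1 [k1 [B1 [p1 z10 z1pi z1E z1B]]]] := @half_exists F A cF.
- by move=> x /andP[x0 xpi]; rewrite -{2}(subr0 x); apply: FA => //; lra.
- by move=> x /andP[x0 xpi]; rewrite distrC; apply: FA => //; lra.
(* The expression sin(x) d/dx is invariant under x -> -x, so [-pi, 0] is reduced to [0, pi] by
   reflecting the right-hand side. *)
have [|||z2 [k2 [B2 [p2 z20 z2pi z2E z2B]]]] := @half_exists (fun x => F (- x)) A.
- by move=> x; apply: continuous_comp; [exact: opp_continuous|exact: cF].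
- move=> x /andP[x0 xpi]; rewrite oppr0 distrC.
  by have := FA (- x) 0; rewrite sub0r opprK; apply; lra.
- move=> x /andP[x0 xpi].
  by rewrite (_ : pi - x = - x - - pi); [apply: FA; lra|ring].
pose u x := if x <= 0 then z2 (- x) else z1 x.
pose v x := if x <= 0 then - k2 (- x) else k1 x.
have pu : prim (- pi) pi u v.
  apply: prim_glue; rewrite ?oppr_le0 ?pi_ge0//.
    apply: (eq_prim (f := fun x => z2 (0 - x))).
      by move=> x; rewrite in_itv/= /u sub0r => /andP[_ ->].
    have := prim_flip 0 p2; rewrite sub0r subr0; apply: eq_prim_deriv => x _.
    by rewrite sub0r.
  apply: (eq_prim (f := z1)) p1 => x; rewrite in_itv/= /u => /andP[x0 _].
  case: ifPn => // x0'; have -> : x = 0 by apply/le_anti; rewrite x0 x0'.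
  by rewrite oppr0 z10 z20 oppr0.
have FNpi : F (- pi) = 0 by rewrite FE ?FintNpi// lexx ltW// pi0.
(* Mean zero of [f] makes [F] agree at the two ends, and with it [u]. *)
have Fpi : F pi = 0 by rewrite FE ?lexx ?ltW ?pi0// /Fint f0.
have uNpi : u (- pi) = 0 by rewrite /u oppr_le0 ltW// opprK z2pi FNpi.
have upi : u pi = 0 by rewrite /u leNgt pi_gt0/= z1pi Fpi.
have uE x : - pi < x < pi -> eps * (sin x * v x) + u x = F x.
  move=> /andP[pix xpi]; rewrite /u /v; case: ifPn => x0; last first.
    by apply: z1E; rewrite xpi ltNge x0.
  have [->|xn0] := eqVneq x 0.
    by rewrite sin0 mul0r mulr0 add0r oppr0 z20 oppr0.
  have := z2E (- x); rewrite opprK sinN => <-; first by ring.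
  by rewrite oppr_gt0 lt_neqAle xn0 x0/=; lra.
have uB x : - pi <= x <= pi -> (F x - u x) ^+ 2 <= Num.max B1 B2 * `|sin x|.
  move=> /andP[pix xpi]; rewrite /u; case: ifPn => x0; last first.
    have {}x0 : 0 < x by rewrite ltNge.
    have [->|xnpi] := eqVneq x pi.
      by rewrite z1pi subrr expr0n/= sinpi normr0 mulr0.
    have xI : 0 < x < pi by rewrite x0 lt_neqAle xnpi.
    apply: le_trans (z1B x xI) _.
    by rewrite ger0_norm ?ler_wpM2r ?le_max ?lexx// ltW// sin_gt0_pi.
  have [->|xn0] := eqVneq x 0.
    by rewrite oppr0 z20 oppr0 subrr expr0n/= sin0 normr0 mulr0.
  have [->|xnpi] := eqVneq x (- pi).
    by rewrite opprK z2pi subrr expr0n/= sinN sinpi oppr0 normr0 mulr0.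
  have xI : 0 < - x < pi.
    by rewrite oppr_gt0 lt_neqAle xn0 x0/= ltrNl lt_neqAle eq_sym xnpi.
  have := z2B (- x) xI; rewrite opprK sinN => /le_trans; apply.
  have : 0 < sin (- x) by exact: sin_gt0_pi.
  rewrite sinN => s_gt0; rewrite -(normrN (sin x)) gtr0_norm//.
  by rewrite ler_wpM2r ?le_max ?lexx ?orbT// ltW.
have B0 : 0 <= Num.max B1 B2.
  have h : - pi <= (pi : R) / 2 <= pi by apply/andP; split; lra.
  have := uB _ h; rewrite sin_pihalf normr1 mulr1; apply: le_trans.
  exact: sqr_ge0.
exists u, v, (eps^-1 ^+ 2 * Num.max B1 B2); split.
- split => //; first by rewrite uNpi upi.
  apply: aeW => x xpi; rewrite uE// uNpi add0r FE//.
  by case/andP: xpi => *; rewrite !ltW.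
- by rewrite mulr_ge0// sqr_ge0.
- move=> x xpi; have -> : flux eps u f x = eps^-1 * (F x - u x).
    by rewrite /flux uNpi add0r FE.
  by rewrite [leLHS]exprMn -[leRHS]mulrA; apply: ler_wpM2l; [exact: sqr_ge0|exact: uB].
Qed.

End Existence.

(** * Symmetry under the reflection J *)

Section Symmetry.
Context {R : realType}.
Implicit Types (a b c x : R) (f g h u v : R -> R).
Notation mu := (@lebesgue_measure R).
Notation pi := (@trigo.pi R).
Variables (eps : R) (eps0 : 0 < eps).

Lemma solves_graphLr u v f : solves eps u v f -> graphLr eps u f.
Proof.
move=> uvf; have [f2 pu upi f0 uE] := uvf; have pp := prim_flux uvf.
have leNpi : - pi <= pi by exact: ltW pi0.
split => //; [exact: sqint_prim pu|exact: prim_abs_cont leNpi pu|].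
have du := prim_is_derive pu; have dp := prim_is_derive pp.
exists (flux eps u f); split.
- move=> a b pia bpi; exact: abs_contS (ltW pia) (ltW bpi) (prim_abs_cont leNpi pp).
- move: (fluxE eps0 uvf) du; apply: filterS2 => x pE du xpi.
  by rewrite pE// derive1E (@derive_val _ _ _ _ _ _ _ (du xpi)).
- move: du dp; apply: filterS2 => x du dp xpi.
  rewrite !derive1E (@derive_val _ _ _ _ _ _ _ (du xpi)) (@derive_val _ _ _ _ _ _ _ (dp xpi)).
  by field; rewrite gt_eqF.
Qed.

Lemma ae_flip c (P : R -> Prop) : {ae mu, forall x, P x} -> {ae mu, forall x, P (c - x)}.
Proof.
move=> [N [mN N0 PN]]; exists (flip c @^-1` N); split.
- by rewrite -[X in measurable X]setTI; exact: measurable_flip.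
- by have := lebesgue_measure_flip c mN; rewrite N0.
- by move=> x /= Px; apply: PN.
Qed.

(** Lagrange identity. With w the reflection of [u2], q = [u1 (- pi) + Fint f1] and r the reflection
    of [u2 (- pi) + Fint f2], the function q w + u1 r - u1 w has the integrand as derivative: the
    two terms [eps * sin * v1 * v2] cancel because sin is symmetric about the midpoint. Where the
    fluxes vanish, q = u1 and r = w, which leaves the boundary value u1 w. *)
Lemma flux_sym u1 v1 f1 u2 v2 f2 a b : solves eps u1 v1 f1 -> solves eps u2 v2 f2 ->
  - pi <= a -> a < b -> b <= pi -> (forall x, sin (a + b - x) = sin x) ->
  flux eps u1 f1 a = 0 -> flux eps u1 f1 b = 0 ->
  flux eps u2 f2 a = 0 -> flux eps u2 f2 b = 0 ->
  \int[mu]_(x in `[a, b]) (f1 x * u2 (a + b - x)) -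
  \int[mu]_(x in `[a, b]) (u1 x * f2 (a + b - x)) = u1 b * u2 a - u1 a * u2 b.
Proof.
move=> s1 s2 pia ab bpi sinc p1a p1b p2a p2b; set c := a + b.
have leab := ltW ab.
have [f12 pu1 _ _ u1E] := s1; have [f22 pu2 _ _ u2E] := s2.
have ca : c - b = a by rewrite /c; ring.
have cb : c - a = b by rewrite /c; ring.
have q0 u f x : flux eps u f x = 0 -> u (- pi) + Fint f x = u x.
  by move=> /eqP; rewrite /flux mulf_eq0 invr_eq0 gt_eqF//= => /eqP; lra.
have pu1ab := primS pia bpi pu1.
have pw := prim_flip c (primS pia bpi pu2); rewrite ca cb in pw.
have pq := primD (prim0 a b (u1 (- pi))) (primS pia bpi (prim_Fint f12)).
have pfl := prim_flip c (primS pia bpi (prim_Fint f22)); rewrite ca cb in pfl.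
have pr := primD (prim0 a b (u2 (- pi))) pfl.
have f12ab := sqintS pia bpi f12.
have f22ab := sqint_flip c (sqintS pia bpi f22); rewrite ca cb in f22ab.
have i1 := sqintM_integrable f12ab (sqint_prim pw).
have i2 := sqintM_integrable (sqint_prim pu1ab) f22ab.
have pP := primB (primD (primM ab pq pw) (primM ab pu1ab pr)) (primM ab pu1ab pw).
have {pP} : prim a b (((fun x => u1 (- pi) + Fint f1 x) \* (fun x => u2 (c - x)) \+
      u1 \* (fun x => u2 (- pi) + Fint f2 (c - x))) \- u1 \* (fun x => u2 (c - x)))
    (fun x => f1 x * u2 (c - x) - u1 x * f2 (c - x)).
  apply: prim_ae pP.
    apply: measurable_funB; [exact: Rintegrable_measurable i1|exact: Rintegrable_measurable i2].
  move: u1E (ae_flip c u2E); apply: filterS2 => x E1 E2 /andP[ax xb].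
  have x1 : - pi < x < pi by rewrite (le_lt_trans pia ax) (lt_le_trans xb bpi).
  have x2 : - pi < c - x < pi by rewrite /c; apply/andP; split; lra.
  have := E1 x1; have := E2 x2; rewrite sinc /= => h2 h1.
  rewrite -h1 -h2; ring.
move=> pP; have := primB_int pP (lexx a) leab (lexx b).
rewrite RintegralB//; rewrite /= => <-.
rewrite !ca !cb (q0 _ _ _ p1a) (q0 _ _ _ p1b) (q0 _ _ _ p2a) (q0 _ _ _ p2b); ring.
Qed.

(* [J] on real functions, [y(pi - x)] for the periodic extension of [y]. *)
Definition Jr f x := if 0 < x then f (pi - x) else f (- pi - x).

Lemma sqint_glue a b c f g : a <= c -> c <= b -> sqint a c f -> sqint c b g ->
  sqint a b (fun x => if x <= c then f x else g x).
Proof.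
move=> ac cb [mf fi] [mg gi]; set k := fun x => _.
have E : `[a, b]%classic = `[a, c]%classic `|` `]c, b]%classic :> set R.
  by rewrite -itv_bndbnd_setU// ?bnd_simp.
have kf : {in `[a, c]%classic, f =1 k}.
  by move=> x; rewrite inE/= in_itv/= /k => /andP[_ ->].
have kg : {in `]c, b]%classic, g =1 k}.
  by move=> x; rewrite inE/= in_itv/= /k => /andP[cx _]; rewrite leNgt cx.
have sub : `]c, b] `<=` `[c, b] by exact: subset_itv_oc_cc.
split; rewrite E.
  apply/measurable_funU => //; split; first exact: eq_measurable_fun mf.
  by apply: eq_measurable_fun kg _; exact: measurable_funS mg.
apply: integrable_itvU => //.
  by apply: eq_integrable fi => // x xac; rewrite /= kf.
have gi' : mu.-integrable `]c, b] (EFin \o (fun x => g x ^+ 2)) by exact: integrableS gi.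
by apply: eq_integrable gi' => // x xac; rewrite /= kg.
Qed.

Lemma sqint_J f : sqint (- pi) pi f -> sqint (- pi) pi (Jr f).
Proof.
move=> f2; have pi_ge0 := @pi_ge0 R; have Npi_le0 : - pi <= 0 by rewrite oppr_le0.
have s1 := sqint_flip (- pi) (sqintS (lexx _) pi_ge0 f2).
have s2 := sqint_flip pi (sqintS Npi_le0 (lexx _) f2).
rewrite subrr subr0 in s2; rewrite subr0 subrr in s1.
have := sqint_glue Npi_le0 pi_ge0 s1 s2; congr sqint.
by apply/funext => x; rewrite /Jr leNgt if_neg.
Qed.

Lemma Rintegral_J h f : mu.-integrable `[- pi, pi] (EFin \o (h \* Jr f)) ->
  \int[mu]_(x in `[- pi, pi]) (h x * Jr f x) =
  \int[mu]_(x in `[- pi, 0]) (h x * f (- pi - x)) +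
  \int[mu]_(x in `[0, pi]) (h x * f (pi - x)).
Proof.
move=> hi; have pi_ge0 := @pi_ge0 R; have Npi_le0 : - pi <= 0 by rewrite oppr_le0.
have hi2 : mu.-integrable `[0, pi] (EFin \o (h \* Jr f)) by exact: integrable_subitv hi.
rewrite (Rintegral_itv_cat Npi_le0 pi_ge0 hi); congr (_ + _).
  by apply: eq_Rintegral => x; rewrite inE/= in_itv/= /Jr => /andP[_]; rewrite leNgt => /negbTE ->.
rewrite -Rintegral_itv_obnd_cbnd; last by apply: integrableS hi2 => //; exact: subset_itv_oc_cc.
have E : {in `]0, pi]%classic, h \* Jr f =1 (fun x => h x * f (pi - x))}.
  by move=> x; rewrite inE/= in_itv/= /Jr => /andP[-> _].
transitivity (\int[mu]_(x in `]0, pi]) (h x * f (pi - x))).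
  by apply: eq_Rintegral => x xI; rewrite -E.
rewrite Rintegral_itv_obnd_cbnd//.
have hi3 : mu.-integrable `]0, pi] (EFin \o (h \* Jr f)).
  by apply: integrableS hi2 => //; exact: subset_itv_oc_cc.
by apply: eq_integrable hi3 => // x xI /=; rewrite -E.
Qed.

Lemma Rintegral_Jr f : sqint (- pi) pi f ->
  \int[mu]_(x in `[- pi, pi]) Jr f x = \int[mu]_(x in `[- pi, pi]) f x.
Proof.
move=> f2; have pi_ge0 := @pi_ge0 R; have Npi_le0 : - pi <= 0 by rewrite oppr_le0.
have fi := sqint_integrable f2; have Ji := sqint_integrable (sqint_J f2).
have := @Rintegral_J (cst 1) f.
rewrite (_ : cst 1 \* Jr f = Jr f); last by apply/funext => x /=; rewrite mul1r.
move=> /(_ Ji).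
under eq_Rintegral do rewrite mul1r.
move=> ->; rewrite (Rintegral_itv_cat Npi_le0 pi_ge0 fi).
have [_] := Rintegral_flip (- pi) (integrable_subitv (lexx _) pi_ge0 fi).
have [_] := Rintegral_flip pi (integrable_subitv Npi_le0 (lexx _) fi).
rewrite !subrr !subr0 => <- <-.
by congr (_ + _); apply: eq_Rintegral => x _; rewrite mul1r.
Qed.

Lemma JrK f x : - pi < x < pi -> x != 0 -> Jr (Jr f) x = f x.
Proof.
move=> /andP[pix xpi] x0; rewrite /Jr; case: ifPn => [xpos|].
  by rewrite subr_gt0 xpi subKr.
rewrite -leNgt le_eqVlt (negbTE x0)/= => xneg.
by rewrite subr_gt0 ltNge (ltW pix)/= subKr.
Qed.

(** The boundary terms of the two half periods cancel each other by periodicity of [u1] and [u2]. *)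
Lemma solves_sym u1 v1 f1 u2 v2 f2 : solves eps u1 v1 f1 -> solves eps u2 v2 f2 ->
  \int[mu]_(x in `[- pi, pi]) (f1 x * Jr u2 x) =
  \int[mu]_(x in `[- pi, pi]) (u1 x * Jr f2 x).
Proof.
move=> s1 s2; have [f12 pu1 u1pi _ _] := s1; have [f22 pu2 u2pi _ _] := s2.
have pi_gt0 := @pi_gt0 R.
have Npi_lt0 : - pi < 0 by rewrite oppr_lt0.
rewrite Rintegral_J; last exact: sqintM_integrable f12 (sqint_J (sqint_prim pu2)).
rewrite Rintegral_J; last exact: sqintM_integrable (sqint_prim pu1) (sqint_J f22).
have F1 := fluxNpi eps u1 f1; have F2 := fluxNpi eps u2 f2.
have G1 := fluxpi s1; have G2 := fluxpi s2.
have H1 := flux0 eps0 s1; have H2 := flux0 eps0 s2.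
have := flux_sym s1 s2 (lexx (- pi)) Npi_lt0 (ltW pi_gt0) _ F1 H1 F2 H2.
have := flux_sym s1 s2 (ltW Npi_lt0) pi_gt0 (lexx pi) _ H1 G1 H2 G2.
rewrite add0r addr0 => h1 h2.
have {}h1 := h1 _; have {}h2 := h2 _.
have e1 : forall x : R, sin (pi - x) = sin x.
  by move=> x; rewrite sinB sinpi cospi mul0r mulN1r sub0r opprK.
have e2 : forall x : R, sin (- pi - x) = sin x.
  by move=> x; rewrite sinB sinN sinpi cosN cospi oppr0 mul0r mulN1r sub0r opprK.
by have := h1 e1; have := h2 e2; rewrite u1pi u2pi; lra.
Qed.

End Symmetry.

(** * Density of smooth periodic functions in L^2 *)

Section Smooth.
Context {R : realType}.
Implicit Types (a b c x : R) (f g h w : R -> R).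
Notation mu := (@lebesgue_measure R).
Notation pi := (@trigo.pi R).

Lemma Rintegral_cvg a b (h_ : (R -> R)^nat) h (F : R -> R) :
  (forall n, measurable_fun `[a, b] (h_ n)) -> measurable_fun `[a, b] h ->
  {ae mu, forall x, a < x < b -> h_ n x @[n --> \oo] --> h x} ->
  mu.-integrable `[a, b] (EFin \o F) ->
  (forall n x, a <= x <= b -> `|h_ n x| <= F x) ->
  \int[mu]_(x in `[a, b]) h_ n x @[n --> \oo] --> \int[mu]_(x in `[a, b]) h x.
Proof.
move=> mh_ mh hh Fi hF.
have mE n : measurable_fun `[a, b] (EFin \o h_ n) by apply/measurable_EFinP.
have mE' : measurable_fun `[a, b] (EFin \o h) by apply/measurable_EFinP.
have cE : {ae mu, forall x, `[a, b]%classic x ->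
    (EFin \o h_ n) x @[n --> \oo] --> (EFin \o h) x}.
  move: (ae_itv hh); apply: filterS => x hx /= xab.
  by apply: cvg_EFin; [exact: nearW|apply: hx].
have bE : {ae mu, forall x n, `[a, b]%classic x -> (`|(EFin \o h_ n) x| <= (EFin \o F) x)%E}.
  by apply: aeW => x n; rewrite /= in_itv/= => xab; rewrite lee_fin hF.
have [hi _] := @dominated_convergence _ _ R mu _ (measurable_itv `[a, b])
  (fun n => EFin \o h_ n) _ _ mE mE' cE Fi bE.
move=> c; apply: fine_cvg; rewrite fineK//.
exact: integrable_fin_num.
Qed.

Lemma nsq_cvg0 a b (h_ : (R -> R)^nat) (F : R -> R) :
  (forall n, measurable_fun `[a, b] (h_ n)) ->
  {ae mu, forall x, a < x < b -> h_ n x @[n --> \oo] --> 0} ->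
  mu.-integrable `[a, b] (EFin \o F) ->
  (forall n x, a <= x <= b -> h_ n x ^+ 2 <= F x) ->
  nsq a b (h_ n) @[n --> \oo] --> 0.
Proof.
move=> mh_ hh Fi hF.
have -> : 0 = \int[mu]_(x in `[a, b]) (cst 0 x : R).
  by rewrite Rintegral_cst// mul0r.
apply: (Rintegral_cvg _ _ _ Fi) => //.
- by move=> n; exact: measurable_funX.
- move: hh; apply: filterS => x hx xab.
  have -> : cst 0 x = 0 * 0 :> R by rewrite mulr0.
  by under eq_fun do rewrite expr2; exact: cvgM (hx xab) (hx xab).
- by move=> n x xab; rewrite ger0_norm ?sqr_ge0// hF.
Qed.

(** A class closed under differentiation (a derivative of cos is a shift of it by pi/2) and under
    reciprocals, hence containing the bumps. Smoothness of all orders then follows by induction,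
    without formulas for higher derivatives. *)
Inductive elementary : (R -> R) -> Prop :=
| elementary_cst c : elementary (cst c)
| elementary_cos c : elementary (fun x => cos (x + c))
| elementaryD f g : elementary f -> elementary g -> elementary (f \+ g)
| elementaryM f g : elementary f -> elementary g -> elementary (f \* g)
| elementaryV f : elementary f -> (forall x, f x != 0) ->
    elementary (fun x => (f x)^-1).

Lemma elementary_derive f : elementary f ->
  exists2 g, elementary g & forall x, is_derive x 1 f (g x).
Proof.
elim=> [c|c|{}f g _ [f' ef df] _ [g' eg dg]|{}f g ef0 [f' ef df] eg0 [g' eg dg]
       |{}f ef0 [f' ef df] f0].
- by exists (cst 0) => [|x]; [exact: elementary_cst|exact: is_derive_cst].
- exists (fun x => cos (x + (c + pi / 2))) => [|x]; first exact: elementary_cos.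
  rewrite addrA cosDpihalf.
  have d : is_derive x 1 (fun x => x + c) 1.
    by rewrite -[X in is_derive _ _ _ X]addr0; apply: is_deriveD.
  have := @is_derive1_comp _ (@cos R) (fun x => x + c) x _ _ (is_derive_cos (x + c)) d.
  by rewrite mulr1.
- by exists (f' \+ g') => [|x]; [exact: elementaryD|exact: is_deriveD].
- exists ((f \* g') \+ (g \* f')) => [|x].
    by apply: elementaryD; apply: elementaryM.
  exact: is_deriveM.
- exists ((cst (-1)) \* ((fun x => (f x)^-1) \* ((fun x => (f x)^-1) \* f'))).
    do ![apply: elementaryM => //]; first exact: elementary_cst.
      exact: elementaryV.
    exact: elementaryV.
  move=> x; have := is_deriveV (f0 x) (df x); congr (is_derive _ _ _ _).
  by rewrite /GRing.scale/= -exprVn; ring.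
Qed.

Definition smooth f := forall n x, derivable (derive1n n f) x 1.

Lemma elementary_smooth f : elementary f -> smooth f.
Proof.
move=> ef n; elim: n f ef => [|n IH] f ef x; have [g eg df] := elementary_derive ef.
  by have [] := df x.
rewrite derive1Sn (_ : derive1 f = g); first exact: IH.
by apply/funext => y; rewrite derive1E derive_val.
Qed.

Lemma smooth_primitive f g : (forall x, is_derive x 1 f (g x)) -> smooth g -> smooth f.
Proof.
move=> df sg [|n] x; first by have [] := df x.
rewrite derive1Sn (_ : derive1 f = g)//.
by apply/funext => y; rewrite derive1E derive_val.
Qed.

Lemma elementary_continuous f : elementary f -> continuous f.
Proof. by move=> /elementary_derive[g _ df] x; exact: is_derive_continuous. Qed.

Definition per f := forall x, f (x + 2 * pi) = f x.

Definition trig_elem f := elementary f /\ per f.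

Lemma trig_elemD f g : trig_elem f -> trig_elem g -> trig_elem (f \+ g).
Proof.
move=> [ef pf] [eg pg]; split; first exact: elementaryD.
by move=> x; rewrite /= pf pg.
Qed.

Lemma trig_elemM f g : trig_elem f -> trig_elem g -> trig_elem (f \* g).
Proof.
move=> [ef pf] [eg pg]; split; first exact: elementaryM.
by move=> x; rewrite /= pf pg.
Qed.

Lemma trig_elem_cst c : trig_elem (cst c).
Proof. by split; first exact: elementary_cst. Qed.

Lemma trig_elemX f n : trig_elem f -> trig_elem (fun x => f x ^+ n).
Proof.
move=> tf; elim: n => [|n IH]; first exact: trig_elem_cst.
rewrite (_ : (fun x => _) = (f \* (fun x => f x ^+ n))); first exact: trig_elemM.
by apply/funext => x; rewrite /= exprS.
Qed.

(* [((2 + cos (x - c)) / (2 + cos d)) ^+ n] blows up inside [|x - c| < d] and vanishes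
   outside. *)
Definition bump c d (n : nat) (x : R) : R :=
  1 - (1 + ((2 + cos (x - c)) / (2 + cos d)) ^+ n)^-1.

Let cos2 x : 0 < 2 + cos x.
Proof. by have := @cos_geN1 R x; lra. Qed.

Let ratio_gt0 c d x : 0 < (2 + cos (x - c)) / (2 + cos d).
Proof. by rewrite divr_gt0. Qed.

Lemma bump_trig c d n : trig_elem (bump c d n).
Proof.
have tc : trig_elem (fun x => (2 + cos (x - c)) / (2 + cos d)).
  apply: (@trig_elemM (fun x => 2 + cos (x - c)) (cst (2 + cos d)^-1));
    last exact: trig_elem_cst.
  apply: (@trig_elemD (cst 2) (fun x => cos (x - c))); first exact: trig_elem_cst.
  split; first exact: elementary_cos.
  by move=> x; rewrite addrAC mulr_natl cosD2pi.
have t1 : trig_elem (fun x => 1 + ((2 + cos (x - c)) / (2 + cos d)) ^+ n).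
  by apply: (@trig_elemD (cst 1)); [exact: trig_elem_cst|exact: trig_elemX].
apply: (@trig_elemD (cst 1)); first exact: trig_elem_cst.
have -> : (fun x => - (1 + ((2 + cos (x - c)) / (2 + cos d)) ^+ n)^-1) =
    (cst (-1)) \* (fun x => (1 + ((2 + cos (x - c)) / (2 + cos d)) ^+ n)^-1).
  by apply/funext => x /=; rewrite mulN1r.
apply: trig_elemM; first exact: trig_elem_cst.
split; last by move=> x; rewrite t1.2.
apply: elementaryV; first exact: t1.1.
by move=> x; rewrite gt_eqF// ltr_wpDr// exprn_ge0// ltW.
Qed.

Lemma bump_bounds c d n x : 0 <= bump c d n x <= 1.
Proof.
have r0 := exprn_ge0 n (ltW (ratio_gt0 c d x)).
rewrite /bump subr_ge0 gerBl invr_ge0 invf_le1 ?ltr_wpDr//.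
by rewrite lerDl r0 addr_ge0.
Qed.

Lemma cos_lt_window d t : 0 < d <= pi -> 0 <= t -> t < d -> cos d < cos t.
Proof.
move=> /andP[d0 dpi] t0 td; rewrite ltr_cos// in_itv/= ?(ltW d0)// t0/=.
exact: ltW (lt_le_trans td dpi).
Qed.

Lemma cos_gt_window d t : 0 < d <= pi -> d < t < 2 * pi - d -> cos t < cos d.
Proof.
move=> /andP[d0 dpi] /andP[dt td]; have [tpi|pit] := leP t pi.
  by rewrite ltr_cos// in_itv/= ?(ltW d0)// tpi (ltW (lt_trans d0 dt)).
have -> : cos t = cos (2 * pi - t).
  rewrite -[in RHS](cosN (2 * pi - t)) opprB -[in LHS](subrK (2 * pi) t).
  by rewrite [X in cos (_ + X)]mulr_natl cosD2pi.
rewrite ltr_cos ?in_itv/=; lra.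
Qed.

(** With r the ratio of the two cosine terms, the bump 1 - 1 / (1 + r^n) tends to 1 for r > 1 and to
    0 for r < 1; at distance exactly [d] it is constantly 1/2. The bound [2 * pi - d] keeps [x]
    outside the window of the neighbouring period. *)
Lemma bump_cvg c (d : R) x : 0 < d <= pi -> `|x - c| < 2 * pi - d -> `|x - c| != d ->
  bump c d n x @[n --> \oo] --> ((`|x - c| < d)%R%:R : R).
Proof.
move=> dI xc xd; set r := (2 + cos (x - c)) / (2 + cos d).
have r0 : 0 < r := ratio_gt0 c d x.
have cosE : cos (x - c) = cos `|x - c| by case: (ger0P (x - c)) => // _; rewrite cosN.
have [xlt|xge] := ltP `|x - c| d.
  have r1 : `|r^-1| < 1.
    rewrite ger0_norm ?invr_ge0 ?(ltW r0)// invf_lt1// /r ltr_pdivlMr// mul1r ltrD2l cosE.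
    exact: cos_lt_window.
  have -> : (fun n => bump c d n x) = (fun n => 1 - r^-1 ^+ n * (1 + r^-1 ^+ n)^-1).
    apply/funext => n; rewrite /bump -/r; congr (1 - _); have rn := exprn_gt0 n r0.
    by rewrite exprVn; field; rewrite !gt_eqF//; have := addr_gt0 ltr01 rn; rewrite addrC.
  have c0 := cvg_expr r1.
  have c1 : 1 + r^-1 ^+ n @[n --> \oo] --> (1 + 0 : R) by apply: cvgD => //; exact: cvg_cst.
  have c2 : (1 + r^-1 ^+ n)^-1 @[n --> \oo] --> ((1 + 0)^-1 : R).
    by apply: cvgV => //; rewrite addr0.
  have -> : (true%:R : R) = 1 - 0 * (1 + 0)^-1 by rewrite mul0r subr0.
  by apply: cvgB; [exact: cvg_cst|exact: cvgM].
have r1 : `|r| < 1.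
  rewrite ger0_norm ?(ltW r0)// /r ltr_pdivrMr// mul1r ltrD2l cosE.
  by apply: cos_gt_window => //; rewrite xc andbT lt_neqAle eq_sym xd.
have c0 := cvg_expr r1.
have c1 : 1 + r ^+ n @[n --> \oo] --> (1 + 0 : R) by apply: cvgD => //; exact: cvg_cst.
have c2 : (1 + r ^+ n)^-1 @[n --> \oo] --> ((1 + 0)^-1 : R).
  by apply: cvgV => //; rewrite addr0.
have -> : (false%:R : R) = 1 - (1 + 0)^-1 by rewrite addr0 invr1 subrr.
by apply: cvgB => //; exact: cvg_cst.
Qed.

Lemma elementary_sqint a b f : elementary f -> sqint a b f.
Proof.
move=> /elementary_derive[g eg df]; apply: (@sqint_prim _ _ _ _ g).
by apply: prim_C1 => x _; exact: elementary_continuous.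
Qed.

Definition trig_approx w := sqint (- pi) pi w /\ forall e : R, 0 < e ->
  exists2 W, trig_elem W & nsq (- pi) pi (W \- w) < e.

Lemma approx_lim w : sqint (- pi) pi w ->
  (forall e : R, 0 < e -> exists2 w', trig_approx w' & nsq (- pi) pi (w' \- w) < e) ->
  trig_approx w.
Proof.
move=> w2 H; split => // e e0; have e4 : 0 < e / 4 by rewrite divr_gt0.
have [w' [w'2 H'] we] := H _ e4; have [W tW We] := H' _ e4.
exists W => //.
have -> : W \- w = (W \- w') \+ (w' \- w) by apply/funext => x /=; ring.
have W2 := elementary_sqint (- pi) pi tW.1.
have := nsqD_le (sqintB W2 w'2) (sqintB w'2 w2); lra.
Qed.

Lemma approxD f g : trig_approx f -> trig_approx g -> trig_approx (f \+ g).
Proof.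
move=> [f2 fa] [g2 ga]; split; first exact: sqintD.
move=> e e0; have e4 : 0 < e / 4 by rewrite divr_gt0.
have [F tF Fe] := fa _ e4; have [G tG Ge] := ga _ e4.
exists (F \+ G); first exact: trig_elemD.
have -> : (F \+ G) \- (f \+ g) = (F \- f) \+ (G \- g) by apply/funext => x /=; ring.
have := nsqD_le (sqintB (elementary_sqint _ _ tF.1) f2)
  (sqintB (elementary_sqint _ _ tG.1) g2); lra.
Qed.

Lemma approxZ c f : trig_approx f -> trig_approx (fun x => c * f x).
Proof.
move=> [f2 fa]; split; first exact: sqintZ.
move=> e e0; have c1 : 0 < c ^+ 2 + 1 by rewrite ltr_wpDl ?sqr_ge0.
have [F tF Fe] := fa (e / (c ^+ 2 + 1)) (divr_gt0 e0 c1).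
exists (fun x => c * F x).
  exact: (trig_elemM (trig_elem_cst c) tF).
have -> : (fun x => c * F x) \- (fun x => c * f x) = (fun x => c * (F \- f) x).
  by apply/funext => x /=; ring.
rewrite nsqZ; last exact: sqintB (elementary_sqint _ _ tF.1) f2.
move: Fe; rewrite ltr_pdivlMr// => Fe.
have := nsq_ge0 (- pi) pi (F \- f); lra.
Qed.

Lemma approx0 : trig_approx (cst 0).
Proof.
split; first exact: sqint_cst.
move=> e e0; exists (cst 0); first exact: trig_elem_cst.
rewrite (_ : nsq _ _ _ = 0)//.
have -> : cst (0 : R) \- cst 0 = (fun x => 0 * cst 0 x) :> (R -> R).
  by apply/funext => x /=; rewrite subr0 mul0r.
by rewrite nsqZ ?expr0n ?mul0r//; exact: sqint_cst.
Qed.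

Lemma approx_sum n (F : nat -> R -> R) : (forall k, (k < n)%N -> trig_approx (F k)) ->
  trig_approx (fun x => \sum_(k < n) F k x).
Proof.
elim: n => [|n IH] H.
  rewrite (_ : (fun x => _) = cst 0); first exact: approx0.
  by apply/funext => x; rewrite big_ord0.
rewrite (_ : (fun x => _) = (fun x => \sum_(k < n) F k x) \+ F n).
  by apply: approxD; [apply: IH => k kn; apply: H; exact: ltnW|exact: H].
by apply/funext => x; rewrite big_ord_recr.
Qed.

Lemma approx_cvg (w_ : (R -> R)^nat) w (F : R -> R) : sqint (- pi) pi w ->
  (forall n, trig_approx (w_ n)) ->
  {ae mu, forall x, - pi < x < pi -> w_ n x @[n --> \oo] --> w x} ->
  mu.-integrable `[- pi, pi] (EFin \o F) ->
  (forall n x, - pi <= x <= pi -> (w_ n x - w x) ^+ 2 <= F x) ->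
  trig_approx w.
Proof.
move=> w2 aw ww Fi wF; apply: approx_lim => // e e0.
have c0 : nsq (- pi) pi (w_ n \- w) @[n --> \oo] --> 0.
  apply: (nsq_cvg0 (F := F)) => //.
  - by move=> n; apply: measurable_funB; [case: (aw n) => -[]|case: w2].
  - move: ww; apply: filterS => x wx xpi; rewrite -(subrr (w x)).
    by apply: cvgB; [exact: wx|exact: cvg_cst].
have : \forall n \near \oo, nsq (- pi) pi (w_ n \- w) < e.
  by move/cvgr_lt : c0; apply.
by move=> [n _ /(_ n (leqnn n))] ?; exists (w_ n).
Qed.

(** Bumps centred at the midpoint, with the half-length as radius, converge to the step except at
    its two endpoints, and are dominated by constants. *)
Lemma approx_step a b : - pi <= a -> a < b -> b <= pi ->
  trig_approx (fun x => (a <= x < b)%R%:R).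
Proof.
move=> pia ab bpi; set w := fun x => _.
have mw : measurable_fun setT w.
  rewrite (_ : w = \1_(`[a, b[%classic)); first exact: measurable_indic.
  by apply/funext => x; rewrite indicE /w; congr (_ %:R); rewrite mem_setE in_itv.
have w01 x : 0 <= w x <= 1 by rewrite /w ler0n lern1 leq_b1.
pose c := (a + b) / 2; pose d := (b - a) / 2.
apply: (@approx_cvg (bump c d) w (cst 1)).
- apply: (@sqint_bounded _ _ _ _ 1) => [|x _]; first exact: measurable_funS mw.
  by have /andP[w0 w1] := w01 x; rewrite ger0_norm.
- move=> n; have bt := bump_trig c d n; split; first exact: elementary_sqint bt.1.
  move=> e e0; exists (bump c d n) => //.
  have -> : bump c d n \- bump c d n = (fun x => 0 * cst 0 x) :> (R -> R).
    by apply/funext => x /=; rewrite subrr mul0r.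
  by rewrite nsqZ ?expr0n ?mul0r//; exact: sqint_cst.
- move: (ae_neq a) (ae_neq b); apply: filterS2 => x xa xb /andP[xl xr].
  have -> : w x = (`|x - c| < d)%R%:R.
    rewrite /w (_ : (a <= x < b) = (`|x - c| < d)%R)// ltr_norml.
    have -> : (a <= x) = (a < x) by rewrite le_eqVlt eq_sym (negbTE xa).
    apply/andP/andP => -[h1 h2]; move: h1 h2; rewrite /c /d => h1 h2; split; lra.
  apply: bump_cvg.
  + by rewrite /d; apply/andP; split; lra.
  + by rewrite ltr_norml /c /d; apply/andP; split; lra.
  + apply/eqP => xcd; move: xa xb => /eqP xa /eqP xb.
    by move: xcd; case: (ger0P (x - c)) => _; rewrite /c /d => xcd;
      [apply: xb|apply: xa]; lra.
- exact: Rintegrable_cst.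
- move=> n x _ /=; have /andP[w0 w1] := w01 x; have /andP[b0 b1] := bump_bounds c d n x.
  nra.
Qed.

End Smooth.

(** * From steps to continuous, bounded and arbitrary square-integrable functions *)

Section SmoothDense.
Context {R : realType}.
Implicit Types (a b c x : R) (f g h w : R -> R).
Notation mu := (@lebesgue_measure R).
Notation pi := (@trigo.pi R).

Let Npi_pi : - pi <= pi :> R. Proof. exact: ltW pi0. Qed.

Lemma approx_continuous h : continuous h -> trig_approx h.
Proof.
move=> ch; have pi_gt0 := @pi_gt0 R.
have wch : {within `[- pi, pi], continuous h} by exact: continuous_subspaceT.
have [xM _ hM] := EVT_max Npi_pi (f := Num.norm \o h)
  (continuous_subspaceT (fun x => continuous_comp (ch x) (@norm_continuous _ _ _))).
set M := (_ xM) in hM.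
have M0 : 0 <= M by exact: normr_ge0.
have hb x : - pi <= x <= pi -> `|h x| <= M.
  by move=> xpi; apply: hM; rewrite in_itv.
have h2 : sqint (- pi) pi h.
  apply: (@sqint_bounded _ _ _ _ M) => // .
  by apply: subspace_continuous_measurable_fun => //; exact: measurable_itv.
pose t (n : nat) (k : nat) := - pi + k%:R * (2 * pi / n.+1%:R).
pose y (n : nat) x := (x + pi) / (2 * pi / n.+1%:R).
have p0 n : 0 < 2 * pi / n.+1%:R :> R by rewrite divr_gt0// mulr_gt0.
pose w_ (n : nat) x := \sum_(k < n.+1) h (t n k) * ((t n k <= x < t n k.+1)%R%:R : R).
have yE n k x : (t n k <= x < t n k.+1) = (k%:R <= y n x < k.+1%:R).
  rewrite /t /y ler_pdivlMr// ltr_pdivrMr//; set q := 2 * pi / _.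
  by congr (_ && _); apply/idP/idP; lra.
have y0 n x : - pi <= x -> 0 <= y n x.
  by move=> xpi; rewrite /y divr_ge0 ?(ltW (p0 n))//; lra.
(* The cells are disjoint, so at most the one indexed by [truncn (y n x)] contributes. At [x = pi]
   this index is already [n.+1], which no cell carries, whence the default 0. *)
have wE n x : - pi <= x -> w_ n x =
    if (Num.truncn (y n x) < n.+1)%N then h (t n (Num.truncn (y n x))) else 0.
  move=> xpi; rewrite /w_.
  under eq_bigr do rewrite yE -truncn_eq ?y0//.
  case: ifP => [kn|/negbT kn].
    rewrite (bigD1 (Ordinal kn))//= eqxx mulr1 big1 ?addr0// => i ik.
    suff -> : (Num.truncn (y n x) == i) = false by rewrite mulr0.
    by apply: contra_neqF ik => /eqP ik; apply: val_inj.
  rewrite big1// => i _; rewrite gtn_eqF ?mulr0//.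
  by rewrite (leq_trans (ltn_ord i))// leqNgt.
have tpi n k : (k <= n.+1)%N -> - pi <= t n k <= pi.
  move=> kn; rewrite /t lerDl mulr_ge0 ?(ltW (p0 n))//=.
  have : k%:R * (2 * pi / n.+1%:R) <= n.+1%:R * (2 * pi / n.+1%:R) :> R.
    by rewrite ler_wpM2r ?(ltW (p0 n))// ler_nat.
  by rewrite [leRHS]mulrC divfK ?pnatr_eq0//; set z := k%:R * _; lra.
apply: (@approx_cvg _ w_ h (cst ((2 * M) ^+ 2))) => //.
- move=> n; apply: (@approx_sum _ _ (fun k x => h (t n k) * ((t n k <= x < t n k.+1)%R%:R : R))).
  move=> k kn; apply: approxZ.
  have /andP[? _] := tpi n k (ltnW kn); have /andP[_ ?] := tpi n k.+1 kn.
  by apply: approx_step => //; rewrite /t ltrD2l ltr_pM2r// ltr_nat.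
- apply: aeW => x /andP[xl xr].
  have c0 : 2 * pi / n.+1%:R @[n --> \oo] --> (2 * pi * 0 : R).
    by apply: cvgM; [exact: cvg_cst|exact: cvg_harmonic].
  have c1 : t n (Num.truncn (y n x)) @[n --> \oo] --> x.
    apply/cvgrPdist_le => e e0; rewrite mulr0 in c0.
    near=> n; have /andP[h1 h3] := truncn_itv (y0 n _ (ltW xl)).
    have : t n (Num.truncn (y n x)) <= x < t n (Num.truncn (y n x)).+1.
      by rewrite yE h1.
    have : 2 * pi / n.+1%:R <= e by near: n; exact: cvgr_le c0 _ e0.
    rewrite /t; set q := 2 * pi / _; rewrite -[(Num.truncn _).+1]addn1 natrD mulrDl mul1r.
    set z := _ * q; move=> h4 /andP[h5 h6].
    by rewrite ger0_norm; lra.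
  have : h (t n (Num.truncn (y n x))) @[n --> \oo] --> h x.
    exact: (continuous_cvg _ (ch x) c1).
  apply: cvg_trans; apply: near_eq_cvg; apply: nearW => n.
  rewrite wE ?(ltW xl)// ifT// truncn_lt_nat ?y0 ?(ltW xl)//.
  by rewrite /y ltr_pdivrMr// mulrC divfK ?pnatr_eq0//; lra.
- exact: Rintegrable_cst.
- move=> n x xpi; have /andP[xl xr] := xpi.
  have : `|w_ n x| <= M.
    rewrite wE//; case: ifP => [kn|_]; last by rewrite normr0.
    exact/hb/tpi/ltnW.
  have := hb x xpi; rewrite !ler_norml /cst => /andP[? ?] /andP[? ?]; nra.
Unshelve. all: by end_near. Qed.

Lemma clamp_continuous a b : continuous (clamp a b).
Proof.
move=> x; apply/cvgrPdist_le => e e0; near=> y.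
apply: (le_trans (clamp_lip _ _ _ _)); near: y.
by apply: cvgr_dist_le => //; exact: cvg_id.
Unshelve. all: by end_near. Qed.

Lemma clamp_measurable a b w (D : set R) : measurable D -> measurable_fun D w ->
  measurable_fun D (clamp a b \o w).
Proof.
move=> mD mw; apply: measurableT_comp => //.
by apply: continuous_measurable_fun; exact: clamp_continuous.
Qed.

(** Continuous functions approximate [w] in L^1. Clamped to [[- M, M]] they come no farther from
    [w], and the difference is bounded, so its squared L^2 norm is at most a multiple of its L^1
    norm. *)
Lemma approx_bounded M w : measurable_fun `[- pi, pi] w ->
  (forall x, - pi <= x <= pi -> `|w x| <= M) -> trig_approx w.
Proof.
move=> mw wM; have M0 : 0 <= M.
  by apply: le_trans (wM (- pi) _); rewrite ?normr_ge0// lexx.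
have NM : - M <= M by lra.
have w2 : sqint (- pi) pi w by exact: sqint_bounded wM.
have wi := sqint_integrable w2.
have mI : (mu `[(- pi)%R, pi]%classic < +oo)%E.
  by rewrite lebesgue_measure_itv/=; case: ifP => _; rewrite -?EFinB ltry.
have [g_ [cg ig gw]] := approximation_continuous_integrable (measurable_itv `[- pi, pi]) mI wi.
apply: approx_lim => // e e0.
have wpos : 0 < 2 * (M + 1) :> R by lra.
have gw' : \int[mu]_(z in `[- pi, pi]) `|w z - g_ n z| @[n --> \oo] --> (0 : R).
  exact: fine_cvg gw.
have : \forall n \near \oo, \int[mu]_(z in `[- pi, pi]) `|w z - g_ n z| < e / (2 * (M + 1)).
  by move/cvgr_lt : gw'; apply; rewrite divr_gt0.
move=> [n _ /(_ n (leqnn n))] /= ge.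
have cgn : continuous (clamp (- M) M \o g_ n).
  by move=> x; apply: continuous_comp; [exact: cg|exact: clamp_continuous].
exists (clamp (- M) M \o g_ n); first exact: approx_continuous.
have i1 : mu.-integrable `[- pi, pi] (EFin \o (fun z => w z - g_ n z)).
  exact: sqint_integrable (sqintB w2 (approx_continuous (cg n)).1).
have i2 := integrable_norm i1.
have i3 : mu.-integrable `[- pi, pi] (EFin \o (fun z => `|w z - g_ n z|)) by [].
have dM x : - pi <= x <= pi -> `|((clamp (- M) M \o g_ n) \- w) x| <= 2 * (M + 1) /\
    `|((clamp (- M) M \o g_ n) \- w) x| <= `|w x - g_ n x|.
  move=> xpi; have wx := wM x xpi; have /andP[c1 c2] := clamp_itv (g_ n x) NM.
  have := wx; rewrite ler_norml => wx'; have /andP[wx1 wx2] := wx'; split.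
    by rewrite ler_norml /=; apply/andP; split; lra.
  by rewrite /= -[X in _ - X](clamp_id wx') distrC clamp_lip.
have : nsq (- pi) pi ((clamp (- M) M \o g_ n) \- w) <=
    \int[mu]_(x in `[- pi, pi]) (2 * (M + 1) * `|w x - g_ n x|).
  apply: le_Rintegral => //.
  - by apply: (sqintB _ w2).2; exact: (approx_continuous cgn).1.
  - exact: RintegrableZ.
  - move=> x; rewrite /= in_itv/= => /dM[h1 h2].
    by rewrite -[leLHS]ger0_norm ?sqr_ge0// normrX expr2 ler_pM.
rewrite RintegralZl// => h; apply: (le_lt_trans h).
by rewrite mulrC -ltr_pdivlMr.
Qed.

(** Truncation of the values at height [n]; the squared error is dominated by [w ^+ 2]. *)
Lemma approx_sqint w : sqint (- pi) pi w -> trig_approx w.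
Proof.
move=> w2; have [mw wi] := w2.
have Nn n : - n%:R <= n%:R :> R by rewrite ge0_cp.
apply: (@approx_cvg _ (fun n => clamp (- n%:R) n%:R \o w) w (fun x => w x ^+ 2)) => //.
- move=> n; apply: (@approx_bounded n%:R); first exact: clamp_measurable.
  by move=> x _; rewrite ler_norml clamp_itv.
- apply: aeW => x _; apply: cvg_near_cst; near=> n.
  apply: clamp_id; rewrite -ler_norml ltW//; near: n; exact: nbhs_infty_gtr.
- move=> n x _ /=; have n0 : 0 <= n%:R :> R by [].
  move: n0; move: (w x) n%:R => s N N0; rewrite /clamp.
  have [Ns|/ltW sN] := leP N s; first by rewrite max_r; nra.
  by have [Ns|/ltW Ns] := leP (- N) s; nra.
Unshelve. all: by end_near. Qed.

End SmoothDense.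

(** * Periodic primitives and simultaneous approximation of a function and its derivative *)

Section SmoothPrimitive.
Context {R : realType}.
Implicit Types (a b c x y e : R) (f g h w V W : R -> R).
Notation mu := (@lebesgue_measure R).
Notation pi := (@trigo.pi R).

(** The lower limit of integration moves with [x] so that the whole line is covered. Subtracting the
    value at 0 removes the dependence on it. *)
Lemma continuous_antiderivative W : continuous W ->
  exists A : R -> R, forall x, is_derive x 1 A (W x).
Proof.
move=> cW; pose F N (x : R) := \int[mu]_(t in `[- N, x]) W t.
have iW a b : mu.-integrable `[a, b] (EFin \o W).
  apply: continuous_compact_integrable; first exact: segment_compact.
  exact: continuous_subspaceT.
have pF N : prim (- N) N (F N) W.
  by split=> // x _; rewrite /F set_itv1 Rintegral_set1 add0r.
have FE N M x y : N <= M -> - N <= x <= N -> - N <= y <= N ->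
    F M x - F M y = F N x - F N y.
  move=> NM /andP[Nx _] /andP[Ny _]; have MN : - M <= - N by rewrite lerN2.
  by rewrite /F (Rintegral_itv_cat MN Nx)// (Rintegral_itv_cat MN Ny)//; ring.
exists (fun x => F (`|x| + 1) x - F (`|x| + 1) 0) => x0.
pose M := `|x0| + 2.
have nF : \near x0, F M x0 - F M 0 = F (`|x0| + 1) x0 - F (`|x0| + 1) 0.
  near=> x; apply: FE.
  - have : `|x0 - x| < 1 by near: x; apply: cvgr_dist_lt.
    by have := ler_dist_dist x x0; rewrite distrC /M ler_norml => /andP[? ?] ?; lra.
  - by have := ler_norm x; have := ler_norm (- x); rewrite normrN => ? ?; lra.
  - by have := normr_ge0 x; lra.
apply: (near_eq_is_derive nF).
rewrite -[X in is_derive _ _ _ X]subr0; apply: is_deriveB.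
apply: (prim_derive_at (pF M)); last exact: cW.
by have := ler_norm x0; have := ler_norm (- x0); rewrite normrN /M => ? ?; lra.
Unshelve. all: by end_near. Qed.

(** The increment over one period has derivative 0, and it vanishes at [- pi] by mean zero. *)
Lemma periodic_antiderivative W : continuous W -> per W ->
  \int[mu]_(x in `[- pi, pi]) W x = 0 ->
  exists2 A : R -> R, forall x, is_derive x 1 A (W x) & per A.
Proof.
move=> cW pW W0; have [A dA] := continuous_antiderivative cW; exists A => // x.
have pA : prim (- pi) pi A W by apply: prim_C1 => y _; exact: cW.
have Npi_pi : - pi <= pi :> R := ltW pi0.
have := primB_int pA (lexx _) Npi_pi (lexx _); rewrite W0 => Api.
suff : A (x + 2 * pi) - A x = 0 by move/subr0_eq.
rewrite -Api.
have -> : A pi - A (- pi) = (fun y => A (y + 2 * pi) - A y) (- pi).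
  by rewrite /=; congr (A _ - _); ring.
apply: (@is_derive_0_is_cst R (fun y => A (y + 2 * pi) - A y)) => y.
have d : is_derive y 1 (fun y : R => y + 2 * pi) 1.
  by rewrite -[X in is_derive _ _ _ X]addr0; apply: is_deriveD.
have := @is_derive1_comp _ A (fun y => y + 2 * pi) y _ _ (dA _) d.
rewrite mulr1 pW => d1; rewrite -(subrr (W y)); exact: is_deriveB.
Qed.

(** Functions of mean zero are orthogonal to constants. This removes the constants of integration
    from the estimates. *)
Lemma nsq_mean0 a b f c : a <= b -> sqint a b f -> \int[mu]_(x in `[a, b]) f x = 0 ->
  nsq a b f <= nsq a b (f \- cst c).
Proof.
move=> ab f2 f0; rewrite nsqB_cst// f0 mulr0 subr0 lerDl mulr_ge0 ?sqr_ge0//.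
by rewrite subr_ge0.
Qed.

(** Approximate the derivative [w] by an elementary function and integrate twice, subtracting the
    mean each time so that the primitives remain periodic. *)
Lemma smooth_approx V w e : 0 < e -> prim (- pi) pi V w -> sqint (- pi) pi w ->
  V (- pi) = V pi -> \int[mu]_(x in `[- pi, pi]) V x = 0 ->
  exists Y Y' W, [/\ smooth Y, per Y, forall x, is_derive x 1 Y (Y' x),
    forall x, is_derive x 1 Y' (W x) & [/\ continuous W,
      nsq (- pi) pi (Y' \- V) < e & nsq (- pi) pi (W \- w) < e]].
Proof.
move=> e0 pV w2 Vpi V0; have Npi_pi : - pi <= pi :> R := ltW pi0.
have pi_gt0 := @pi_gt0 R.
(* The factor [(2 * pi) ^+ 2] is a Poincare constant bounding [Y' - V] by [W - w]; with 1 added, the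
   same tolerance also covers [W - w] itself. *)
have c0 : 0 < 1 + (2 * pi) ^+ 2 :> R by rewrite ltr_wpDr ?sqr_ge0.
have w0 : \int[mu]_(x in `[- pi, pi]) w x = 0.
  by have := primB_int pV (lexx _) Npi_pi (lexx _); rewrite Vpi subrr => <-.
have [_ /(_ (e / (1 + (2 * pi) ^+ 2)))] := approx_sqint w2.
case=> [|W0 [eW0 pW0] We]; first exact: divr_gt0.
have W02 := elementary_sqint (- pi) pi eW0.
pose m := (\int[mu]_(x in `[- pi, pi]) W0 x) / (pi - - pi).
pose W := W0 \- cst m.
have cW : continuous W.
  by move=> x; apply: continuousB; [exact: elementary_continuous|exact: cvg_cst].
have W2 : sqint (- pi) pi W by apply: sqintB => //; exact: sqint_cst.
have Wm : \int[mu]_(x in `[- pi, pi]) W x = 0 by exact: Rintegral_subr_mean pi0 W02.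
have pW : per W by move=> x; rewrite /W /= pW0.
have We' : nsq (- pi) pi (W \- w) * (1 + (2 * pi) ^+ 2) < e.
  move: We; rewrite ltr_pdivlMr//; apply: le_lt_trans.
  rewrite ler_pM2r// (_ : W0 \- w = (W \- w) \- cst (- m)); last first.
    by apply/funext => x; rewrite /W /=; ring.
  apply: nsq_mean0 => //; first exact: sqintB.
  by rewrite RintegralB// ?Wm ?w0 ?subrr//; exact: sqint_integrable.
have [A dA pA] := periodic_antiderivative cW pW Wm.
have cA : continuous A by move=> x; exact: is_derive_continuous (dA x).
pose Y' := A \- cst ((\int[mu]_(x in `[- pi, pi]) A x) / (pi - - pi)).
have dY' x : is_derive x 1 Y' (W x).
  by rewrite -[X in is_derive _ _ _ X]subr0; apply: is_deriveB.
have cY' : continuous Y' by move=> x; exact: is_derive_continuous (dY' x).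
have pY' : prim (- pi) pi Y' W by apply: prim_C1 => y _; exact: cW.
have A2 : sqint (- pi) pi A.
  by apply: (sqint_prim (g := W)); apply: prim_C1 => y _; exact: cW.
have Y'm : \int[mu]_(x in `[- pi, pi]) Y' x = 0 by exact: Rintegral_subr_mean pi0 A2.
have perY' : per Y' by move=> x; rewrite /Y' /= pA.
have [Y dY pY] := periodic_antiderivative cY' perY' Y'm.
exists Y, Y', W; split => //.
  apply: (smooth_primitive dY); apply: (smooth_primitive dY').
  by apply: elementary_smooth; apply: (elementaryD eW0); exact: (elementary_cst (- m)).
have Ww2 := sqintB W2 w2; have Y'2 := sqint_prim pY'; have V2 := sqint_prim pV.
have pD := primB pY' pV.
split => //; last first.
  by apply: le_lt_trans We'; rewrite ler_peMr ?nsq_ge0// lerDl sqr_ge0.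
apply: le_lt_trans We'.
apply: (@le_trans _ _ (nsq (- pi) pi ((Y' \- V) \- cst ((Y' \- V) (- pi))))).
  apply: nsq_mean0 => //; first exact: sqintB.
  by rewrite RintegralB// ?Y'm ?V0 ?subrr//; exact: sqint_integrable.
apply: (@le_trans _ _ (\int[mu]_(x in `[- pi, pi]) (2 * pi * nsq (- pi) pi (W \- w)))).
  apply: le_Rintegral => //.
  - by apply: (sqintB (sqintB Y'2 V2) (sqint_cst _ _ _)).2.
  - exact: Rintegrable_cst.
  move=> x; rewrite /= in_itv/= => xpi.
  rewrite [X in X ^+ 2](_ : _ = Fint (W \- w) x); first exact: Fint_bound.
  have [_ /(_ _ xpi) DE] := pD.
  by rewrite /Fint -[LHS]/((Y' \- V) x - (Y' \- V) (- pi)) DE; ring.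
rewrite Rintegral_itv_cst// opprK.
have := nsq_ge0 (- pi) pi (W \- w); nra.
Qed.

End SmoothPrimitive.

(** * Logarithmic cutoff and smooth core *)

Section LogCutoff.
Context {R : realType}.
Implicit Types (a b c x y e : R) (f g h u v w V W : R -> R).
Notation mu := (@lebesgue_measure R).
Notation pi := (@trigo.pi R).

Variables (L : R) (L2 : 2 <= L).
Let q := expR L.
(* With [c = (q + 1) / (q - 1)] one has [sin ^ 2 + logd = c ^ 2 - cos ^ 2]. *)
Definition logd := 4 * q / (q - 1) ^+ 2.
Let d := logd.

Let q3 : (3 : R) <= q.
Proof. by have h := expR_ge1Dx L; apply: le_trans h; have := L2; lra. Qed.
Let L0 : 0 < L. Proof. by have := L2; lra. Qed.
Let q1 : 0 < q - 1. Proof. by have := q3; lra. Qed.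
Let d0 : 0 < d. Proof. by rewrite /d /logd divr_gt0 ?exprn_gt0// mulr_gt0//; have := q3; lra. Qed.

Definition logr x := (sin x ^+ 2 + d)^-1.
(** The logarithmic ramp: 0 at the poles and at most [L] everywhere, because [(1 + d) / d <= q], the
    exponential of [L]. *)
Definition logl x := ln (sin x ^+ 2 + d) - ln d.

Let s0 x : 0 < sin x ^+ 2 + d. Proof. by rewrite ltr_wpDl ?sqr_ge0. Qed.

Let dq : 1 + d <= d * q.
Proof.
rewrite /d /logd -[X in X + _](@divff _ ((q - 1) ^+ 2)) ?gt_eqF ?exprn_gt0//.
rewrite -mulrDl mulrAC ler_wpM2r ?invr_ge0 ?sqr_ge0//; have := q3; nra.
Qed.

Lemma logd_le : logd <= 16 / q.
Proof.
rewrite /logd ler_pdivlMr ?expR_gt0// mulrAC ler_pdivrMr ?exprn_gt0//.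
by have := q3; nra.
Qed.

Lemma logr_gt0 x : 0 < logr x. Proof. by rewrite invr_gt0. Qed.

Lemma logl_ge0 x : 0 <= logl x.
Proof. by rewrite subr_ge0 ler_ln ?posrE// lerDr sqr_ge0. Qed.

Lemma logl_leS x : d * logl x <= sin x ^+ 2.
Proof.
rewrite /logl -ln_div ?posrE// mulrDl divff ?gt_eqF// addrC -ler_pdivlMl// mulrC.
apply: le_ln1Dx; apply: (@lt_le_trans _ _ 0); first by rewrite oppr_lt0.
by rewrite mulr_ge0 ?sqr_ge0// invr_ge0 ltW.
Qed.

Lemma logl_leL x : logl x <= L.
Proof.
rewrite -[leRHS]expRK -/q lerBlDr -lnM ?posrE ?expR_gt0// ler_ln ?posrE//; last first.
  by rewrite mulr_gt0// expR_gt0.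
rewrite mulrC; apply: le_trans dq.
by rewrite lerD2r; have := cos2Dsin2 x; have := sqr_ge0 (cos x); lra.
Qed.

Let dsin2 x : is_derive x 1 (fun x => sin x ^+ 2 + d) (2 * (sin x * cos x)).
Proof.
rewrite (_ : (fun x => _) = (@sin R * @sin R) + cst d); last first.
  by apply/funext => y; rewrite expr2.
have := is_deriveD (is_deriveM (is_derive_sin x) (is_derive_sin x)) (is_derive_cst d x 1).
by congr (is_derive _ _ _ _); rewrite /GRing.scale/=; ring.
Qed.

Let dlogr x : is_derive x 1 logr (- (2 * (sin x * cos x)) * logr x ^+ 2).
Proof.
have := @is_deriveV _ (fun x => sin x ^+ 2 + d) x _ _ (lt0r_neq0 (s0 x)) (dsin2 x).
congr (is_derive _ _ _ _).
by rewrite /GRing.scale/= /logr exprVn; ring.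
Qed.

Let dlogl x : is_derive x 1 logl (2 * (sin x * cos x) * logr x).
Proof.
rewrite -[X in is_derive _ _ _ X]subr0; apply: is_deriveB.
have := @is_derive1_comp _ (@ln R) (fun x => sin x ^+ 2 + d) x _ _ (is_derive1_ln (s0 x)) (dsin2 x).
by congr (is_derive _ _ _ _); rewrite /logr; ring.
Qed.

Let csin := @continuous_sin R.
Let ccos := @continuous_cos R.
Let clogr : continuous logr. Proof. by move=> x; exact: is_derive_continuous (dlogr x). Qed.

Let csc : continuous (fun x : R => 2 * (sin x * cos x)).
Proof.
move=> x; apply: (@continuousM _ _ (fun=> 2) (fun x => sin x * cos x)); first exact: cvg_cst.
by apply: continuousM; [exact: csin|exact: ccos].
Qed.

Lemma prim_logr a b : prim a b logr (fun x => - (2 * (sin x * cos x)) * logr x ^+ 2).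
Proof.
apply: prim_C1 => x _; first exact: dlogr.
apply: (@continuousM _ _ (fun x => - (2 * (sin x * cos x))) (fun x => logr x ^+ 2)).
  by apply: (@continuousN _ _ _ (fun x => 2 * (sin x * cos x))); exact: csc.
rewrite (_ : (fun x => _) = logr \* logr); first by apply: continuousM; exact: clogr.
by apply/funext => y; rewrite expr2.
Qed.

Lemma prim_logl a b : prim a b logl (fun x => 2 * (sin x * cos x) * logr x).
Proof.
apply: prim_C1 => x _; first exact: dlogl.
by apply: (@continuousM _ _ (fun x => 2 * (sin x * cos x)) logr); [exact: csc|exact: clogr].
Qed.

(* [1 / sin], cut off logarithmically near the poles. *)
Definition logk x := L^-1 * (sin x * (logl x * logr x)).

Definition logk' x := L^-1 * (cos x * (logl x * logr x) + sin x *
  (2 * (sin x * cos x) * logr x * logr x + logl x * (- (2 * (sin x * cos x)) * logr x ^+ 2))).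

Lemma prim_logk a b : a < b -> prim a b logk logk'.
Proof.
by move=> ab; exact: primZ (primM ab (prim_sin a b) (primM ab (prim_logl a b) (prim_logr a b))).
Qed.

Lemma prim_logk' a b : a < b -> exists g, prim a b logk' g.
Proof.
move=> ab; have pM f g : (exists f', prim a b f f') -> (exists g', prim a b g g') ->
    exists g', prim a b (fun x => f x * g x) g'.
  by move=> [f' pf] [g' pg]; eexists; exact: primM pf pg.
have pD f g : (exists f', prim a b f f') -> (exists g', prim a b g g') ->
    exists g', prim a b (fun x => f x + g x) g'.
  by move=> [f' pf] [g' pg]; eexists; exact: primD pf pg.
have ps : exists g', prim a b (@sin R) g' by eexists; exact: prim_sin.
have pc : exists g', prim a b (@cos R) g' by eexists; exact: prim_cos.
have pl : exists g', prim a b logl g' by eexists; exact: prim_logl.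
have pr : exists g', prim a b logr g' by eexists; exact: prim_logr.
have p0 c : exists g', prim a b (fun=> c) g' by eexists; exact: prim0.
have p2 : exists g', prim a b (fun x => 2 * (sin x * cos x)) g' by do !apply: (pM) => //.
have pN : exists g', prim a b (fun x => - (2 * (sin x * cos x))) g'.
  rewrite (_ : (fun x => _) = (fun x => -1 * (2 * (sin x * cos x)))); first exact: (pM).
  by apply/funext => x; rewrite mulN1r.
have pr2 : exists g', prim a b (fun x => logr x ^+ 2) g'.
  rewrite (_ : (fun x => _) = (fun x => logr x * logr x)); first exact: (pM).
  by apply/funext => x; rewrite expr2.
by do ![apply: (pM) => //|apply: (pD) => //].
Qed.

Definition logg x := sin x * logk x.

Lemma loggE x : logg x = sin x ^+ 2 * logr x * (logl x / L).
Proof. by rewrite /logg /logk; ring. Qed.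

Let Sr1 x : 0 <= sin x ^+ 2 * logr x <= 1.
Proof.
rewrite mulr_ge0 ?sqr_ge0 ?(ltW (logr_gt0 x))//= /logr ler_pdivrMr// mul1r lerDl.
exact: ltW.
Qed.

Let lL1 x : 0 <= logl x / L <= 1.
Proof. by rewrite divr_ge0 ?logl_ge0 ?(ltW L0)//= ler_pdivrMr// mul1r logl_leL. Qed.

Lemma logg_bound x : 0 <= logg x <= 1.
Proof.
rewrite loggE; have /andP[a0 a1] := Sr1 x; have /andP[b0 b1] := lL1 x.
by rewrite mulr_ge0//= mulr_ile1.
Qed.

(** For factors in [0, 1], 1 - a b <= (1 - a) + (1 - b). The first defect is [d * logr x], the
    second uses [d <= 16 / q]. At a fixed point off the poles both are O(1 / L). *)
Lemma logg_le x : sin x != 0 ->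
  1 - logg x <= 16 / L / sin x ^+ 2 + (ln 16 - ln (sin x ^+ 2)) / L.
Proof.
move=> sx; have S0 : 0 < sin x ^+ 2 by rewrite exprn_even_gt0.
have /andP[a0 a1] := Sr1 x; have /andP[b0 b1] := lL1 x.
have h1 : 1 - sin x ^+ 2 * logr x <= 16 / L / sin x ^+ 2.
  have -> : 1 - sin x ^+ 2 * logr x = d * logr x.
    by rewrite /logr; field; rewrite gt_eqF.
  apply: ler_pM; rewrite ?(ltW d0) ?(ltW (logr_gt0 x))//.
    apply: le_trans logd_le _; rewrite ler_pM2l// lef_pV2 ?posrE ?expR_gt0//.
    by apply: le_trans (expR_ge1Dx L); lra.
  by rewrite lef_pV2 ?posrE// lerDl ltW.
have h2 : 1 - logl x / L <= (ln 16 - ln (sin x ^+ 2)) / L.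
  rewrite -[X in X - _](@divff _ L) ?gt_eqF// -mulrBl ler_pM2r ?invr_gt0//.
  have : L + ln d <= ln 16.
    rewrite -[X in X + _]expRK -/q -lnM ?posrE ?expR_gt0// ler_ln ?posrE//.
      by have := logd_le; rewrite ler_pdivlMr ?expR_gt0// mulrC.
    by rewrite mulr_gt0// expR_gt0.
  have : ln (sin x ^+ 2) <= ln (sin x ^+ 2 + d).
    by rewrite ler_ln ?posrE// lerDl ltW.
  rewrite /logl; lra.
rewrite loggE; nra.
Qed.

(** The derivative of the cutoff [logg], by the product rule. *)
Definition logh x := cos x * logk x + sin x * logk' x.

(** In the closed form [hE] the term [d * logl x] is at most [sin x ^+ 2], because ln(1 + t) <= t.
    So [logh ^+ 2] is at most [16 / L ^+ 2] times [logr], whose integral against [|sin|] is only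
    O(L). *)
Lemma logh_bound x : logh x ^+ 2 * `|sin x| <= 16 / L ^+ 2 * (`|sin x| * logr x).
Proof.
set S := sin x ^+ 2; set r := logr x.
have r0 : 0 < r := logr_gt0 x; have S0 : 0 <= S := sqr_ge0 _.
have hE : logh x = 2 * L^-1 * (sin x * cos x) * r ^+ 2 * (d * logl x + S).
  have rE : r * (S + d) = 1 by rewrite mulVf// gt_eqF.
  rewrite /logh /logk /logk' -/r.
  have -> : d = r^-1 - S by rewrite /r /logr invrK -/S -/d [S + d]addrC addrK.
  by rewrite /S; field; rewrite !gt_eqF.
have b0 : 0 <= d * logl x + S <= 2 * S.
  by have := logl_leS x; have := mulr_ge0 (ltW d0) (logl_ge0 x); rewrite -/S; lra.
have /andP[a0 a1] := Sr1 x; rewrite -/S -/r in a0 a1.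
have cS : cos x ^+ 2 <= 1 by have := cos2Dsin2 x; have := sqr_ge0 (sin x); lra.
rewrite mulrCA [leLHS]mulrC ler_wpM2l// hE.
have -> : (2 * L^-1 * (sin x * cos x) * r ^+ 2 * (d * logl x + S)) ^+ 2 =
    4 / L ^+ 2 * r * (S * r * (cos x ^+ 2 * (r * (d * logl x + S)) ^+ 2)).
  by rewrite /S; field; rewrite gt_eqF.
have -> : 16 / L ^+ 2 * r = 4 / L ^+ 2 * r * 4 by field; rewrite gt_eqF.
rewrite ler_wpM2l//; first by rewrite mulr_ge0 ?(ltW r0)// divr_ge0// sqr_ge0.
have /andP[b1 b2] := b0.
have t0 : 0 <= r * (d * logl x + S) by rewrite mulr_ge0// ltW.
have t2 : r * (d * logl x + S) <= 2 by have := ler_wpM2l (ltW r0) b2; lra.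
move: t0 t2 a0 a1 cS; set t := r * (d * _ + _).
move: t (S * r) (cos x) => t z y t0 t2 z0 z1 y1.
have t4 : t ^+ 2 <= 4 by nra.
have h0 : 0 <= y ^+ 2 * t ^+ 2 <= 4.
  rewrite mulr_ge0 ?sqr_ge0//=; apply: le_trans t4.
  by rewrite ler_piMl ?sqr_ge0.
have /andP[h1 h2] := h0.
by apply: le_trans (_ : 1 * (y ^+ 2 * t ^+ 2) <= 4); [rewrite ler_wpM2r|rewrite mul1r].
Qed.

Lemma prim_logh a b : a < b -> exists g, prim a b logh g.
Proof.
move=> ab; have [g pg] := prim_logk' ab; eexists.
exact: primD (primM ab (prim_cos a b) (prim_logk ab)) (primM ab (prim_sin a b) pg).
Qed.

Let c := (q + 1) / (q - 1).
(** Antiderivative of [sin x * logr x] by partial fractions in cos x. The form of [logd] makes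
    [(c + 1) / (c - 1)] equal to [q], so that the increment over [0, pi] is exactly [L / c]. *)
Let A x := (ln (c - cos x) - ln (c + cos x)) / (2 * c).

Let c1 : 1 < c. Proof. by rewrite /c ltr_pdivlMr//; have := q1; lra. Qed.
Let cB x : 0 < c - cos x. Proof. by have := @cos_le1 R x; have := c1; lra. Qed.
Let cD x : 0 < c + cos x. Proof. by have := @cos_geN1 R x; have := c1; lra. Qed.

Let dA x : is_derive x 1 A (sin x * logr x).
Proof.
have d1 : is_derive x 1 (fun x => c - cos x) (sin x).
  by rewrite -[X in is_derive _ _ _ X]opprK -[X in is_derive _ _ _ X]add0r; apply: is_deriveB.
have d2 : is_derive x 1 (fun x => c + cos x) (- sin x).
  by rewrite -[X in is_derive _ _ _ X]add0r; apply: is_deriveD.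
have e1 := @is_derive1_comp _ (@ln R) (fun x => c - cos x) x _ _ (is_derive1_ln (cB x)) d1.
have e2 := @is_derive1_comp _ (@ln R) (fun x => c + cos x) x _ _ (is_derive1_ln (cD x)) d2.
have := is_deriveZ (2 * c)^-1 (is_deriveB e1 e2).
congr (is_derive _ _ _ _).
  by apply/funext => y; rewrite /A [RHS]mulrC.
rewrite /GRing.scale/= /logr.
have -> : sin x ^+ 2 + d = (c - cos x) * (c + cos x).
  have -> : sin x ^+ 2 = 1 - cos x ^+ 2 by have := cos2Dsin2 x; lra.
  have -> : d = c ^+ 2 - 1 by rewrite /d /logd /c; field; rewrite gt_eqF.
  ring.
by field; rewrite !gt_eqF//; have := q1; have := c1; lra.
Qed.

Let Adiff : A pi - A 0 <= L.
Proof.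
rewrite /A cospi cos0 opprK.
have -> : (ln (c + 1) - ln (c - 1)) / (2 * c) - (ln (c - 1) - ln (c + 1)) / (2 * c) =
  (ln (c + 1) - ln (c - 1)) / c by field; rewrite gt_eqF//; have := c1; lra.
rewrite -ln_div ?posrE; try by have := c1; lra.
have -> : (c + 1) / (c - 1) = q.
  by rewrite /c; field; rewrite !gt_eqF//; have := q1; have := c1; lra.
rewrite /q expRK ler_pdivrMr; last by have := c1; lra.
by rewrite ler_peMr ?(ltW L0)// ltW.
Qed.

Lemma logr_integral : mu.-integrable `[- pi, pi] (EFin \o (fun x => `|sin x| * logr x)) /\
  \int[mu]_(x in `[- pi, pi]) (`|sin x| * logr x) <= 2 * L.
Proof.
have pi_ge0 := @pi_ge0 R; have Npi_le0 : - pi <= 0 :> R by rewrite oppr_le0.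
have cn : continuous (fun x => `|sin x| * logr x).
  move=> x; apply: (@continuousM _ _ (fun x => `|sin x|) logr); last exact: clogr.
  by apply: continuous_comp; [exact: csin|exact: norm_continuous].
have ii : mu.-integrable `[- pi, pi] (EFin \o (fun x => `|sin x| * logr x)).
  apply: continuous_compact_integrable; first exact: segment_compact.
  exact: continuous_subspaceT.
split=> //; rewrite (Rintegral_itv_cat Npi_le0 pi_ge0 ii).
have csr : continuous (fun x => sin x * logr x).
  by move=> x; apply: (@continuousM _ _ (@sin R) logr); [exact: csin|exact: clogr].
have pA a b : prim a b A (fun x => sin x * logr x) by apply: prim_C1 => x _; [exact: dA|exact: csr].
have h1 := primB_int (pA 0 pi) (lexx _) pi_ge0 (lexx _).
have h2 := primB_int (pA (- pi) 0) (lexx _) Npi_le0 (lexx _).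
have -> : \int[mu]_(x in `[0, pi]) (`|sin x| * logr x) = A pi - A 0.
  rewrite h1; apply: eq_Rintegral => x; rewrite inE/= in_itv/= => xI.
  by rewrite ger0_norm// sin_ge0_pi.
have -> : \int[mu]_(x in `[- pi, 0]) (`|sin x| * logr x) = A (- pi) - A 0.
  rewrite -opprB h2 -[RHS]mulN1r -RintegralZl//; last by case: (pA (- pi) 0).
  apply: eq_Rintegral => x; rewrite inE/= in_itv/= => /andP[x1 x2].
  rewrite ler0_norm; first by rewrite mulNr mulN1r.
  by rewrite -oppr_ge0 -sinN sin_ge0_pi//; apply/andP; split; lra.
have -> : A (- pi) = A pi by rewrite /A cosN.
by have := Adiff; lra.
Qed.

End LogCutoff.

(** * Smooth approximation in the graph norm *)

Section Density.
Context {R : realType}.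
Implicit Types (a b c x y e : R) (f g h u v w V W : R -> R).
Notation mu := (@lebesgue_measure R).
Notation pi := (@trigo.pi R).
Variables (eps : R) (eps0 : 0 < eps).

Let Npi_pi : - pi <= pi :> R. Proof. exact: ltW pi0. Qed.

Lemma nsqM_le a b f g c : sqint a b g -> sqint a b (f \* g) ->
  (forall x, a <= x <= b -> f x ^+ 2 <= c) -> nsq a b (f \* g) <= c * nsq a b g.
Proof.
move=> [mg gi] [_ fgi] fc; rewrite /nsq -RintegralZl//; apply: le_Rintegral => //.
  exact: RintegrableZ.
move=> x; rewrite /= in_itv/= => xab; rewrite exprMn ler_wpM2r ?sqr_ge0//.
exact: fc.
Qed.

Lemma Rintegral_ae a b f g : mu.-integrable `[a, b] (EFin \o f) -> a <= b ->
  measurable_fun `[a, b] g -> {ae mu, forall x, a < x < b -> f x = g x} ->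
  \int[mu]_(x in `[a, b]) f x = \int[mu]_(x in `[a, b]) g x.
Proof.
move=> fi ab mg fg; pose F x := \int[mu]_(t in `[a, x]) f t.
have pF : prim a b F f.
  by split=> // x _; rewrite /F set_itv1 Rintegral_set1 add0r.
have pG := prim_ae mg fg pF.
by rewrite -(primB_int pF)// -(primB_int pG).
Qed.

Lemma sin_neq0 x : - pi < x < pi -> x != 0 -> sin x != 0.
Proof.
move=> /andP[x1 x2]; rewrite neq_lt => /orP[xn|xp].
  by rewrite -oppr_eq0 -sinN gt_eqF// sin_gt0_pi//; apply/andP; split; lra.
by rewrite gt_eqF// sin_gt0_pi// xp.
Qed.

Section Regularize.
Variables (u v f : R -> R) (E : R).
Hypotheses (uvf : solves eps u v f) (E0 : 0 <= E)
  (fluxE2 : forall x, - pi <= x <= pi -> flux eps u f x ^+ 2 <= E * `|sin x|).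

Let p := flux eps u f.
Let L (n : nat) : R := 2 * n.+1%:R.
Let L2 n : 2 <= L n. Proof. by rewrite /L ler_peMr// ler1n. Qed.
Let L0 n : 0 < L n. Proof. exact: lt_le_trans (L2 n). Qed.
Let kp n := logk (L n) \* p.
Let a n := (\int[mu]_(x in `[- pi, pi]) kp n x) / (pi - - pi).

Let pp : prim (- pi) pi p (fun x => eps^-1 * (f x - v x)) := prim_flux uvf.
Let pk n := prim_logk (L2 n) (@pi0 R).
Let pkp n := primM (@pi0 R) (pk n) pp.
Let f2 : sqint (- pi) pi f. Proof. by case: uvf. Qed.
Let mv : measurable_fun `[- pi, pi] v.
Proof. by have [_ [vi _] _ _ _] := uvf; exact: Rintegrable_measurable vi. Qed.

Let V n := kp n \- cst (a n).
(** The derivative of [V n], with [sin x * v x] replaced by [p x]: [v] is only known to be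
    integrable, whereas every term written this way is square-integrable. *)
Let w n x := logk' (L n) x * p x + eps^-1 * (logk (L n) x * f x) -
  eps^-1 * ((L n)^-1 * (logl (L n) x * logr (L n) x * p x)).

Let w2 n : sqint (- pi) pi (w n).
Proof.
have [k' pk'] := prim_logk' (L2 n) (@pi0 R).
have [M _ kM] := prim_bounded (pk n).
apply: sqintB; first apply: sqintD.
- exact: sqint_prim (primM (@pi0 R) pk' pp).
- apply: sqintZ; exact: sqintM_bounded (prim_measurable (pk n)) kM f2.
do 2!apply: sqintZ; apply: sqint_prim.
exact: primM (@pi0 R) (primM (@pi0 R) (prim_logl (L2 n) _ _) (prim_logr (L2 n) _ _)) pp.
Qed.

Let pV n : prim (- pi) pi (V n) (w n).
Proof.
have := primB (pkp n) (prim0 (- pi) pi (a n)); apply: prim_ae; first by case: (w2 n).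
move: (fluxE eps0 uvf); apply: filterS => x pE /pE; rewrite -/p => {}pE.
by rewrite /w /= pE /logk; ring.
Qed.

Let Vpi n : V n (- pi) = V n pi.
Proof. by rewrite /V /kp /= /p fluxNpi (fluxpi uvf) !mulr0. Qed.

Let V0 n : \int[mu]_(x in `[- pi, pi]) V n x = 0.
Proof. exact: Rintegral_subr_mean pi0 (sqint_prim (pkp n)). Qed.

Let cL : (L n)^-1 @[n --> \oo] --> (0 : R).
Proof.
rewrite -[X in _ --> X](mulr0 2^-1).
under eq_fun do rewrite /L invfM.
by apply: cvgM; [exact: cvg_cst|exact: cvg_harmonic].
Qed.

Let cg x : - pi < x < pi -> x != 0 -> 1 - logg (L n) x @[n --> \oo] --> (0 : R).
Proof.
move=> xpi x0; have sx := sin_neq0 xpi x0.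
pose K := 16 / sin x ^+ 2 + (ln 16 - ln (sin x ^+ 2)).
apply: (@squeeze_cvgr _ _ _ _ (fun=> 0) (fun n => K * (L n)^-1)).
- apply: nearW => n; have /andP[g0 g1] := logg_bound (L2 n) x.
  rewrite subr_ge0 g1/=; apply: le_trans (logg_le (L2 n) sx) _.
  by rewrite /K le_eqVlt; apply/orP; left; apply/eqP; ring.
- exact: cvg_cst.
- by rewrite -[X in _ --> X](mulr0 K); apply: cvgM; [exact: cvg_cst|exact: cL].
Qed.

Let g2 n : sqint (- pi) pi ((fun x => logg (L n) x - 1) \* f).
Proof.
have pg := primB (primM (@pi0 R) (prim_sin _ _) (pk n)) (prim0 (- pi) pi 1).
apply: (sqintM_bounded (prim_measurable pg) _ f2 (c := 1)) => x _ /=.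
have /andP[g0 g1] := logg_bound (L2 n) x; rewrite -/(logg (L n) x) ler_norml.
by apply/andP; split; lra.
Qed.

Let cgf : nsq (- pi) pi ((fun x => logg (L n) x - 1) \* f) @[n --> \oo] --> (0 : R).
Proof.
apply: (nsq_cvg0 (F := fun x => f x ^+ 2)).
- by move=> n; case: (g2 n).
- move: (@ae_neq R 0); apply: filterS => x x0 xpi.
  rewrite -[X in _ --> X](mul0r (f x)) -oppr0; apply: cvgM; last exact: cvg_cst.
  under eq_fun do rewrite -opprB.
  by apply: cvgN; exact: cg.
- by case: f2.
- move=> n x _ /=; have /andP[g0 g1] := logg_bound (L2 n) x.
  rewrite exprMn ler_piMl ?sqr_ge0//; nra.
Qed.

(** Almost everywhere [kp n] equals [logg] times [v], which converges to [v] under the majorant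
    [|v|]; and [v] has mean zero because [u] is periodic. *)
Let ca : a n @[n --> \oo] --> (0 : R).
Proof.
have [_ pu upi _ _] := uvf; have [vi _] := pu.
have v0 : \int[mu]_(x in `[- pi, pi]) v x = 0.
  by rewrite -(primB_int pu)// upi subrr.
rewrite -[X in _ --> X](mul0r (pi - - pi)^-1) -v0; apply: cvgM; last exact: cvg_cst.
have mg n : measurable_fun `[- pi, pi] (logg (L n)).
  exact: prim_measurable (primM (@pi0 R) (prim_sin _ _) (pk n)).
have kpE n : \int[mu]_(x in `[- pi, pi]) kp n x =
    \int[mu]_(x in `[- pi, pi]) (logg (L n) x * v x).
  apply: Rintegral_ae => //; first exact: sqint_integrable (sqint_prim (pkp n)).
    exact: measurable_funM.
  move: (fluxE eps0 uvf); apply: filterS => x pE /pE; rewrite -/p => {}pE.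
  by rewrite /kp /= pE /logg; ring.
under eq_fun do rewrite kpE.
apply: (Rintegral_cvg (F := fun x => `|v x|)) => //.
- by move=> n; exact: measurable_funM.
- move: (@ae_neq R 0); apply: filterS => x x0 xpi.
  rewrite -[X in _ --> X]mul1r; apply: cvgM; last exact: cvg_cst.
  rewrite -[X in _ --> X]subr0.
  under eq_fun do rewrite -[logg _ _](subKr 1).
  by apply: cvgB; [exact: cvg_cst|exact: cg].
- exact: (integrable_norm vi).
- move=> n x _; rewrite normrM ler_piMl//.
  by have /andP[g0 g1] := logg_bound (L2 n) x; rewrite ger0_norm.
Qed.

Let h2 n : sqint (- pi) pi (logh (L n) \* p).
Proof. by have [h' ph] := prim_logh (L2 n) (@pi0 R); exact: sqint_prim (primM (@pi0 R) ph pp). Qed.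

Let hp n : nsq (- pi) pi (logh (L n) \* p) <= 32 * E * (L n)^-1.
Proof.
have [ri rL] := logr_integral (L2 n).
apply: (@le_trans _ _ (\int[mu]_(x in `[- pi, pi])
    (E * (16 / L n ^+ 2) * (`|sin x| * logr (L n) x)))).
  apply: le_Rintegral => //; [by case: (h2 n)|exact: RintegrableZ|].
  move=> x; rewrite /= in_itv/= => /fluxE2; rewrite -/p => px.
  rewrite exprMn -mulrA; apply: le_trans (ler_wpM2l E0 (logh_bound (L2 n) x)).
  by rewrite [leRHS]mulrCA; exact: ler_wpM2l (sqr_ge0 _) _ _ px.
rewrite RintegralZl//.
have -> : 32 * E * (L n)^-1 = E * (16 / L n ^+ 2) * (2 * L n).
  by field; rewrite gt_eqF.
by rewrite ler_wpM2l// mulr_ge0// divr_ge0// sqr_ge0.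
Qed.

(** With chi = [logg], the defect of the equation is eps chi' p + (chi - 1) f - a n (eps cos + 1).
    The three terms vanish in L^2 by [hp], dominated convergence and [ca]. *)
Lemma regularize e : 0 < e -> exists V w, [/\ prim (- pi) pi V w, sqint (- pi) pi w,
  V (- pi) = V pi, \int[mu]_(x in `[- pi, pi]) V x = 0 &
  nsq (- pi) pi ((fun x => eps * (cos x * V x + sin x * w x) + V x) \- f) < e].
Proof.
move=> e0; pose b := (fun x : R => eps * cos x + 1).
have b2 : sqint (- pi) pi b.
  apply: sqint_prim; exact: primD (primZ eps (prim_cos _ _)) (prim0 _ _ 1).
pose T n := 2 * (eps ^+ 2 * (32 * E * (L n)^-1)) +
  2 * (2 * nsq (- pi) pi ((fun x => logg (L n) x - 1) \* f) +
       2 * ((- a n) ^+ 2 * nsq (- pi) pi b)).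
have cT : T n @[n --> \oo] --> (0 : R).
  have -> : (0 : R) = 2 * (eps ^+ 2 * (32 * E * 0)) +
      2 * (2 * 0 + 2 * ((- 0) * (- 0) * nsq (- pi) pi b)).
    by ring.
  rewrite /T; apply: cvgD; apply: cvgM; try exact: cvg_cst.
    by do 2!(apply: cvgM; first exact: cvg_cst); exact: cL.
  apply: cvgD; (apply: cvgM; first exact: cvg_cst); first exact: cgf.
  apply: cvgM; last exact: cvg_cst.
  by under eq_fun do rewrite expr2; apply: cvgM; exact: cvgN ca.
have : \forall n \near \oo, T n < e by move/cvgr_lt : cT; apply.
move=> [n _ /(_ n (leqnn n))] /= Te.
exists (V n), (w n); split; [exact: pV|exact: w2|exact: Vpi|exact: V0|].
apply: le_lt_trans Te.
have -> : (fun x => eps * (cos x * V n x + sin x * w n x) + V n x) \- f =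
    (fun x => eps * (logh (L n) \* p) x) \+
    (((fun x => logg (L n) x - 1) \* f) \+ (fun x => - a n * b x)).
  apply/funext => x; rewrite /V /w /kp /b /logh /logg /logk /=.
  by field; rewrite !gt_eqF.
have ab2 := sqintZ (- a n) b2.
apply: le_trans (nsqD_le (sqintZ eps (h2 n)) (sqintD (g2 n) ab2)) _.
rewrite /T lerD// ler_pM2l//.
  by rewrite nsqZ// ler_wpM2l ?sqr_ge0//; exact: hp.
by apply: le_trans (nsqD_le (g2 n) ab2) _; rewrite nsqZ.
Qed.

End Regularize.

Lemma solves_C2 Y Y' W : (forall x, is_derive x 1 Y (Y' x)) ->
  (forall x, is_derive x 1 Y' (W x)) -> continuous W -> Y (- pi) = Y pi ->
  solves eps Y Y' (fun x => eps * (cos x * Y' x + sin x * W x) + Y' x).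
Proof.
move=> dY dY' cW Ypi; set g := fun x => _.
have cY' : continuous Y' by move=> x; exact: is_derive_continuous (dY' x).
have pY : prim (- pi) pi Y Y' by apply: prim_C1 => x _; exact: cY'.
have pY' : prim (- pi) pi Y' W by apply: prim_C1 => x _; exact: cW.
have pF := primD (primZ eps (primM (@pi0 R) (prim_sin _ _) pY')) pY.
have g2 : sqint (- pi) pi g.
  apply: sqintD; last exact: sqint_prim pY'.
  apply: sqintZ; apply: sqintD.
    exact: sqint_prim (primM (@pi0 R) (prim_cos _ _) pY').
  apply: (sqintM_bounded (c := 1)).
  - exact: prim_measurable (prim_sin _ _).
  - by move=> x _; rewrite ler_norml sin_geN1 sin_le1.
  - exact: (approx_continuous cW).1.
split=> //.
- rewrite -(primB_int pF)// /= sinN sinpi Ypi; ring.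
- apply: aeW => x /andP[x1 x2].
  have xI : - pi <= x <= pi by rewrite !ltW.
  have [_ /(_ _ xI) /=] := pF; rewrite sinN sinpi oppr0 mul0r mulr0 add0r.
  exact.
Qed.

(** After expanding (sin y')', the equation involves only y' and its derivative with bounded
    coefficients, so it suffices to approximate the regularized pair [V], [w] in L^2. *)
Lemma solves_dense f e : eps < 2 -> sqint (- pi) pi f ->
  \int[mu]_(x in `[- pi, pi]) f x = 0 -> 0 < e ->
  exists Y Y' g, [/\ smooth Y, per Y, solves eps Y Y' g & nsq (- pi) pi (g \- f) < e].
Proof.
move=> eps2 f2 f0 e0; have [u [v [E [uvf E0 fE]]]] := solves_exists eps0 eps2 f2 f0.
have e4 : 0 < e / 4 by rewrite divr_gt0.
have [V [w [pV w2 Vpi V0 Ve]]] := regularize uvf E0 fE e4.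
(* Dominates the squares of the coefficients [eps * cos x + 1] and [eps * sin x]. Two uses of
   [nsqD_le] give a total of at most [4 * (e / 16) + 2 * (e / 4)], below [e]. *)
pose C := 1 + (eps + 1) ^+ 2 + eps ^+ 2.
have C0 : 0 < C by rewrite /C; have := sqr_ge0 eps; have := sqr_ge0 (eps + 1); lra.
have e1 : 0 < e / 16 / C by rewrite !divr_gt0.
have [Y [Y' [W [sY pY dY dY' [cW Y'e We]]]]] := smooth_approx e1 pV w2 Vpi V0.
have Ypi : Y (- pi) = Y pi by rewrite -(pY (- pi)); congr Y; ring.
have sol := solves_C2 dY dY' cW Ypi.
eexists Y, Y', _; split=> //; first exact: sol.
have [g2 _ _ _ _] := sol.
have pY' : prim (- pi) pi Y' W by apply: prim_C1 => x _; exact: cW.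
have D2 := sqintB (sqint_prim pY') (sqint_prim pV).
have W2 : sqint (- pi) pi W by exact: (approx_continuous cW).1.
have Ww2 := sqintB W2 w2.
have pc := primD (primZ eps (prim_cos (- pi) pi)) (prim0 _ _ 1).
have cB x : (eps * cos x + 1) ^+ 2 <= (eps + 1) ^+ 2.
  have h1 := ler_wpM2l (ltW eps0) (cos_le1 x).
  have h3 := ler_wpM2l (ltW eps0) (cos_geN1 x).
  have h4 := eps0; nra.
have sB x : (eps * sin x) ^+ 2 <= eps ^+ 2.
  rewrite exprMn ler_piMr ?sqr_ge0//; have := cos2Dsin2 x; have := sqr_ge0 (cos x); lra.
have d1 : sqint (- pi) pi ((fun x => eps * cos x + 1) \* (Y' \- V)).
  apply: (sqint_prim (g := _)); exact: primM (@pi0 R) pc (primB pY' pV).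
have d2 : sqint (- pi) pi ((fun x => eps * sin x) \* (W \- w)).
  apply: (sqintM_bounded (c := eps)) => //.
    exact: prim_measurable (primZ eps (prim_sin _ _)).
  move=> x _; rewrite normrM ger0_norm ?(ltW eps0)// ler_piMr ?(ltW eps0)//.
  by rewrite ler_norml sin_geN1 sin_le1.
set g := fun x => _.
have -> : g \- f = (((fun x => eps * cos x + 1) \* (Y' \- V)) \+
    ((fun x => eps * sin x) \* (W \- w))) \+
    ((fun x => eps * (cos x * V x + sin x * w x) + V x) \- f).
  by apply/funext => x; rewrite /g /=; ring.
have f_2 : sqint (- pi) pi ((fun x => eps * (cos x * V x + sin x * w x) + V x) \- f).
  have V2 := sqint_prim pV; have sw : sqint (- pi) pi (@sin R \* w).
    apply: (sqintM_bounded (c := 1)) => //; first exact: prim_measurable (prim_sin _ _).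
    by move=> x _; rewrite ler_norml sin_geN1 sin_le1.
  apply: sqintB => //; apply: sqintD => //; apply: sqintZ; apply: sqintD => //.
  exact: sqint_prim (primM (@pi0 R) (prim_cos _ _) pV).
have := nsqD_le (sqintD d1 d2) f_2; have := nsqD_le d1 d2.
have := nsqM_le D2 d1 (fun x _ => cB x); have := nsqM_le Ww2 d2 (fun x _ => sB x).
have k1 : (eps + 1) ^+ 2 * nsq (- pi) pi (Y' \- V) + eps ^+ 2 * nsq (- pi) pi (W \- w) <= e / 16.
  have := ler_wpM2l (sqr_ge0 (eps + 1)) (ltW Y'e); have := ler_wpM2l (sqr_ge0 eps) (ltW We).
  have : C * (e / 16 / C) = e / 16 by rewrite mulrC divfK ?gt_eqF.
  rewrite {1}/C; move: (e / 16 / C) e1 => t t0; lra.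
lra.
Qed.

End Density.

(** * Closure and adjoint on real functions *)

Section RealClosure.
Context {R : realType}.
Implicit Types (a b c x e : R) (f g h u v w y : R -> R).
Notation mu := (@lebesgue_measure R).
Notation pi := (@trigo.pi R).
Variables (eps : R) (eps0 : 0 < eps) (eps2 : eps < 2).

Let Npi_pi : - pi <= pi :> R. Proof. exact: ltW pi0. Qed.

Lemma cvg0_le (s : nat -> R) x : s n @[n --> \oo] --> 0 -> (forall n, x <= s n) -> x <= 0.
Proof.
move=> s0 xs; rewrite leNgt; apply/negP => x0.
have : \forall n \near \oo, s n < x by move/cvgr_lt : s0; apply.
by move=> [n _ /(_ n (leqnn n))] /=; rewrite ltNge xs.
Qed.

Lemma solvesB u v f u' v' f' : solves eps u v f -> solves eps u' v' f' ->
  solves eps (u \- u') (v \- v') (f \- f').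
Proof.
move=> s1 s2; have := solvesD s1 (solvesZ (-1) s2).
by congr solves; apply/funext => x /=; rewrite mulN1r.
Qed.

Lemma solves_addc c u v f : solves eps u v f -> solves eps (u \+ cst c) v f.
Proof.
move=> s; have := solvesD s (solves_cst eps c).
by congr solves; apply/funext => x /=; rewrite addr0.
Qed.

(** The mean is the best constant approximation, so a function approximated by constants in L^2 has
    distance 0 from its mean. *)
Lemma nsq_mean_eq0 (psi : R -> R) (s c : nat -> R) : sqint (- pi) pi psi ->
  (forall n, nsq (- pi) pi (psi \- cst (c n)) <= s n) -> s n @[n --> \oo] --> 0 ->
  exists m, {ae mu, forall x, - pi < x < pi -> psi x = m}.
Proof.
move=> p2 pc s0; pose m := (\int[mu]_(x in `[- pi, pi]) psi x) / (pi - - pi).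
have pm2 := sqintB p2 (sqint_cst (- pi) pi m).
have pm0 : \int[mu]_(x in `[- pi, pi]) (psi \- cst m) x = 0.
  exact: Rintegral_subr_mean pi0 p2.
exists m; have : nsq (- pi) pi (psi \- cst m) = 0.
  apply/eqP; rewrite eq_le nsq_ge0 andbT; apply: (cvg0_le s0) => n.
  apply: le_trans (pc n).
  have := nsq_mean0 (c n - m) Npi_pi pm2 pm0; congr (_ <= nsq _ _ _).
  by apply/funext => x /=; ring.
move/(nsq_eq0 pm2); apply: filterS => x px /px /=; lra.
Qed.

(** Mean zero passes to the limit [f], so some [z] solves the equation for [f]. Coercivity applied
    to [y_ n - z] shows that [phi - z] is a limit of constants. *)
Lemma solves_closed (y_ v_ g_ : nat -> R -> R) f (phi : R -> R) :
  (forall n, solves eps (y_ n) (v_ n) (g_ n)) ->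
  sqint (- pi) pi phi -> sqint (- pi) pi f ->
  nsq (- pi) pi (y_ n \- phi) @[n --> \oo] --> 0 ->
  nsq (- pi) pi (g_ n \- f) @[n --> \oo] --> 0 ->
  exists z v, solves eps z v f /\ {ae mu, forall x, - pi < x < pi -> z x = phi x}.
Proof.
move=> sn phi2 f2 yphi gf.
have g2 n : sqint (- pi) pi (g_ n) by case: (sn n).
have y2 n : sqint (- pi) pi (y_ n) by have [_ p _ _ _] := sn n; exact: sqint_prim p.
have f0 : \int[mu]_(x in `[- pi, pi]) f x = 0.
  apply/eqP; rewrite -sqrf_eq0 eq_le sqr_ge0 andbT.
  have c0 : (pi - - pi) * nsq (- pi) pi (g_ n \- f) @[n --> \oo] --> 0.
    by rewrite -[X in _ --> X](mulr0 (pi - - pi)); apply: cvgM => //; exact: cvg_cst.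
  apply: (cvg0_le c0) => n; apply: le_trans (cauchy_schwarz_itv Npi_pi (sqintB (g2 n) f2)).
  have [_ _ _ g0 _] := sn n.
  by rewrite RintegralB ?g0 ?sub0r ?sqrrN//; exact: sqint_integrable.
have [z [v [_ [sz _ _]]]] := solves_exists eps0 eps2 f2 f0.
have z2 : sqint (- pi) pi z by have [_ p _ _ _] := sz; exact: sqint_prim p.
pose c n := (y_ n \- z) (- pi).
have [m psim] : exists m, {ae mu, forall x, - pi < x < pi -> (phi \- z) x = m}.
  apply: (@nsq_mean_eq0 _ (fun n => 2 * nsq (- pi) pi (y_ n \- phi) +
      2 * ((2 * pi) ^+ 2 * nsq (- pi) pi (g_ n \- f))) c) => [|n|].
  - exact: sqintB.
  - have := solves_nsq eps0 (solvesB (sn n) sz) => h.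
    have d1 := sqintZ (-1) (sqintB (y2 n) phi2).
    have d2 := sqintB (sqintB (y2 n) z2) (sqint_cst (- pi) pi (c n)).
    have := nsqD_le d1 d2; rewrite nsqZ; last exact: sqintB.
    have -> : (fun x => -1 * (y_ n \- phi) x) \+ ((y_ n \- z) \- cst (c n)) =
        (phi \- z) \- cst (c n) by apply/funext => x /=; ring.
    by move=> h'; apply: (le_trans h'); rewrite sqrrN expr1n mul1r lerD2l ler_pM2l.
  - have -> : (0 : R) = 2 * 0 + 2 * ((2 * pi) ^+ 2 * 0) by rewrite !mulr0 addr0.
    apply: cvgD; (apply: cvgM; first exact: cvg_cst) => //.
    by apply: cvgM; first exact: cvg_cst.
exists (z \+ cst m), v; split; first exact: solves_addc.
by move: psim; apply: filterS => x h /h /=; lra.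
Qed.

Lemma smooth_subc c f : smooth f -> smooth (f \- cst c).
Proof.
move=> sf; have df x : is_derive x 1 f (derive1 f x).
  by have := sf 0%N x; rewrite derive1E => h; exact: DeriveDef.
apply: (@smooth_primitive _ _ (derive1 f)).
  by move=> x; rewrite -[X in is_derive _ _ _ X]subr0; apply: is_deriveB.
by move=> n x; rewrite -derive1Sn; exact: sf.
Qed.

(** It is enough to approximate [f]: once [Y] is shifted to agree with [u] at [- pi], coercivity
    bounds [Y - u] by [g - f]. *)
Lemma solves_core u v f e : solves eps u v f -> 0 < e ->
  exists Y g, [/\ smooth Y, per Y, graphLr eps Y g,
    nsq (- pi) pi (Y \- u) < e & nsq (- pi) pi (g \- f) < e].
Proof.
move=> s e0; have [f2 pu _ f0 _] := s; have pi_gt0 := @pi_gt0 R.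
have c0 : 0 < 1 + (2 * pi) ^+ 2 :> R by rewrite ltr_wpDr ?sqr_ge0.
have e1 : 0 < e / (1 + (2 * pi) ^+ 2) by rewrite divr_gt0.
have [Y [Y' [g [sY pY sol]]]] := solves_dense eps0 eps2 f2 f0 e1.
rewrite ltr_pdivlMr// => ge; have gf0 := nsq_ge0 (- pi) pi (g \- f).
pose c := (Y \- u) (- pi).
exists (Y \- cst c), g; split.
- exact: smooth_subc.
- by move=> x; rewrite /= pY.
- have := solves_addc (- c) sol => /(solves_graphLr eps0); congr graphLr.
- have := solves_nsq eps0 (solvesB sol s).
  rewrite (_ : (fun x => _) = (Y \- cst c) \- u); first by nra.
  by apply/funext => x; rewrite /c /=; ring.
- nra.
Qed.

Lemma Jr_ae f g : {ae mu, forall x, - pi < x < pi -> f x = g x} ->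
  {ae mu, forall x, - pi < x < pi -> Jr f x = Jr g x}.
Proof.
move=> fg; move: (ae_flip pi fg) (ae_flip (- pi) fg) (@ae_neq R 0).
apply: filterS3 => x h1 h2 x0 /andP[xl xr]; rewrite /Jr; case: ltP => xs.
  by apply: h1; apply/andP; split; lra.
by apply: h2; move: xs; rewrite le_eqVlt (negbTE x0)/= => xs; apply/andP; split; lra.
Qed.

Lemma solves_adjoint u h : sqint (- pi) pi u -> sqint (- pi) pi h ->
  (forall y v f, solves eps y v f ->
    \int[mu]_(x in `[- pi, pi]) (f x * u x) = \int[mu]_(x in `[- pi, pi]) (y x * h x)) ->
  exists z v, solves eps z v (Jr h) /\ {ae mu, forall x, - pi < x < pi -> z x = Jr u x}.
Proof.
move=> u2 h2 H.
have h0 : \int[mu]_(x in `[- pi, pi]) Jr h x = 0.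
  rewrite Rintegral_Jr//; have := H _ _ _ (solves_cst eps 1).
  under eq_Rintegral do rewrite mul0r.
  rewrite Rintegral_itv_cst// mul0r => ->.
  by apply: eq_Rintegral => x _; rewrite mul1r.
have [z [v [_ [sz _ _]]]] := solves_exists eps0 eps2 (sqint_J h2) h0.
have z2 : sqint (- pi) pi z by have [_ p _ _ _] := sz; exact: sqint_prim p.
have Jz2 := sqint_J z2; have psi2 := sqintB u2 Jz2.
have orth y w f : solves eps y w f ->
    \int[mu]_(x in `[- pi, pi]) (f x * (u \- Jr z) x) = 0.
  move=> s; have [f2 py _ _ _] := s.
  have i1 := sqintM_integrable f2 u2; have i2 := sqintM_integrable f2 Jz2.
  under eq_Rintegral do rewrite /= mulrBr.
  rewrite RintegralB// (H _ _ _ s) (solves_sym eps0 s sz); apply/eqP; rewrite subr_eq0; apply/eqP.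
  apply: Rintegral_ae => //; first exact: sqintM_integrable (sqint_prim py) h2.
    apply: measurable_funM; first exact: prim_measurable py.
    by case: (sqint_J (sqint_J h2)).
  by move: (@ae_neq R 0); apply: filterS => x x0 xpi; rewrite JrK.
pose m := (\int[mu]_(x in `[- pi, pi]) (u \- Jr z) x) / (pi - - pi).
have pm2 := sqintB psi2 (sqint_cst (- pi) pi m).
have pm0 : \int[mu]_(x in `[- pi, pi]) ((u \- Jr z) \- cst m) x = 0.
  exact: Rintegral_subr_mean pi0 psi2.
(* The difference [u - Jr z] minus its mean lies itself in the range of the operator. Orthogonality
   to the range, together with mean zero, makes its norm 0. *)
have [y [w [_ [sy _ _]]]] := solves_exists eps0 eps2 pm2 pm0.
have n0 : nsq (- pi) pi ((u \- Jr z) \- cst m) = 0.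
  have i1 := sqintM_integrable pm2 psi2.
  have i2 := RintegrableZ m (sqint_integrable pm2).
  rewrite [LHS](_ : _ = \int[mu]_(x in `[- pi, pi]) (((u \- Jr z) \- cst m) x * (u \- Jr z) x) -
    \int[mu]_(x in `[- pi, pi]) (m * ((u \- Jr z) \- cst m) x)).
    by rewrite (orth _ _ _ sy) RintegralZl ?pm0 ?mulr0 ?subrr//; exact: sqint_integrable.
  by rewrite -RintegralB//; apply: eq_Rintegral => x _ /=; ring.
exists (z \+ cst m), v; split; first exact: solves_addc.
have ae1 : {ae mu, forall x, - pi < x < pi -> u x = (Jr z \+ cst m) x}.
  move: (nsq_eq0 pm2 n0); apply: filterS => x px /px /=; lra.
move: (Jr_ae ae1) (@ae_neq R 0); apply: filterS2 => x px x0 /[dup] xpi /px ->.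
by rewrite -[LHS]/(z x + m) -(JrK z xpi x0) /= [in RHS]/Jr [Jr (Jr z) x]/Jr; case: ifP.
Qed.

End RealClosure.

(** * The operator on complex functions *)

Section ComplexOperator.
Context {R : realType}.
Implicit Types (x : R) (u v h : R -> R) (f g y : Cfun R).
Notation mu := (@lebesgue_measure R).
Notation pi := (@trigo.pi R).
Variables (eps : R) (eps0 : 0 < eps) (eps2 : eps < 2).

Let Npi_pi : - pi <= pi :> R. Proof. exact: ltW pi0. Qed.

Definition mkC u v : Cfun R := fun x => Complex (u x) (v x).

Lemma L2P f : L2 f <-> sqint (- pi) pi (ReF f) /\ sqint (- pi) pi (ImF f).
Proof.
split=> [[mr mi fi]|[[mr ri] [mi ii]]]; last first.
  split=> //; have /integrableP[_] := RintegrableD ri ii.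
  apply: le_lt_trans; rewrite le_eqVlt; apply/orP; left; apply/eqP.
  by apply: eq_integral => x _ /=; rewrite ger0_norm// addr_ge0 ?sqr_ge0.
have ms : measurable_fun `[- pi, pi] (fun x => ReF f x ^+ 2 + ImF f x ^+ 2).
  by apply: measurable_funD; exact: measurable_funX.
have si : mu.-integrable `[- pi, pi] (EFin \o (fun x => ReF f x ^+ 2 + ImF f x ^+ 2)).
  apply/integrableP; split; first exact/measurable_EFinP.
  apply: le_lt_trans fi; rewrite le_eqVlt; apply/orP; left; apply/eqP.
  by apply: eq_integral => x _ /=; rewrite ger0_norm// addr_ge0 ?sqr_ge0.
by split; split=> //; apply: (Rintegrable_le _ si) => [|x _]; try exact: measurable_funX;
  rewrite /= ger0_norm ?sqr_ge0// ?lerDl ?lerDr sqr_ge0.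
Qed.

Lemma aeIP f g : aeI f g <->
  {ae mu, forall x, - pi < x < pi -> ReF f x = ReF g x} /\
  {ae mu, forall x, - pi < x < pi -> ImF f x = ImF g x}.
Proof.
split=> [fg|[/ae_itv r /ae_itv i]].
  split; move: fg; apply: filterS => x fgx xpi; rewrite /ReF /ImF fgx//;
  by rewrite /Iint/= in_itv/=; case/andP: xpi => ? ?; rewrite !ltW.
move: r i; apply: filterS2 => x r i xI.
move: (r xI) (i xI); rewrite /ReF /ImF; case: (f x) (g x) => [a b] [c d] /=.
by move=> -> ->.
Qed.

(** Both coefficients, [eps] and sin, are real, so the equation splits into real and imaginary
    parts. *)
Lemma graphLP f g : graphL eps (f, g) <->
  graphLr eps (ReF f) (ReF g) /\ graphLr eps (ImF f) (ImF g).
Proof.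
split=> [[/= /L2P[fr fi] /L2P[gr gi] [cr ci] fpi [p [pl /aeIP[p1 p2] /aeIP[g1 g2]]]]|].
  split; split=> //; rewrite /ReF /ImF ?fpi//.
    exists (ReF p); split=> //; [by move=> a b ? ?; case: (pl a b)| |].
      by move: p1; apply: filterS => x h /h E; rewrite [LHS]E /ReF /= mul0r subr0.
    by move: g1; apply: filterS => x h /h E; rewrite [LHS]E /ReF /= mul0r subr0.
  exists (ImF p); split=> //; [by move=> a b ? ?; case: (pl a b)| |].
    by move: p2; apply: filterS => x h /h E; rewrite [LHS]E /ImF /= mul0r addr0.
  by move: g2; apply: filterS => x h /h E; rewrite [LHS]E /ImF /= mul0r addr0.
move=> [[fr gr cr rpi [p [pl p1 p2]]] [fi gi ci ipi [q [ql q1 q2]]]].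
split; [exact/L2P|exact/L2P|by split| |].
  by move: rpi ipi; rewrite /ReF /ImF /=; case: (f _) (f _) => [a b] [c d] /= -> ->.
exists (mkC p q); split.
- by move=> a b ? ?; split; [exact: pl|exact: ql].
- apply/aeIP; split.
    by move: p1; apply: filterS => x h /h E; rewrite /ReF /= mul0r subr0 -E.
  by move: q1; apply: filterS => x h /h E; rewrite /ImF /= mul0r addr0 -E.
- apply/aeIP; split.
    by move: p2; apply: filterS => x h /h E; rewrite /= [LHS]E /ReF /= mul0r subr0.
  by move: q2; apply: filterS => x h /h E; rewrite /= [LHS]E /ImF /= mul0r addr0.
Qed.

Lemma dist2E f g : L2 f -> L2 g -> dist2 f g =
  (nsq (- pi) pi (ReF f \- ReF g) + nsq (- pi) pi (ImF f \- ImF g))%:E.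
Proof.
move=> /L2P[fr fi] /L2P[gr gi]; have [_ ri] := sqintB fr gr; have [_ ii] := sqintB fi gi.
rewrite /nsq -RintegralD// /Rintegral fineK//.
exact: integrable_fin_num (RintegrableD ri ii).
Qed.

Lemma dist2_cvg0 (f_ : nat -> Cfun R) g : (forall n, L2 (f_ n)) -> L2 g ->
  dist2 (f_ n) g @[n --> \oo] --> 0%E <->
  nsq (- pi) pi (ReF (f_ n) \- ReF g) @[n --> \oo] --> (0 : R) /\
  nsq (- pi) pi (ImF (f_ n) \- ImF g) @[n --> \oo] --> (0 : R).
Proof.
move=> f2 g2; under eq_fun do rewrite dist2E//.
split=> [/fine_cvg h|[h1 h2]]; last first.
  apply: cvg_EFin; first exact: nearW.
  by rewrite -[X in _ --> X](addr0 0); exact: cvgD.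
split; apply: (squeeze_cvgr _ (cvg_cst 0) h); apply: nearW => n; rewrite nsq_ge0/=.
  by rewrite lerDl nsq_ge0.
by rewrite lerDr nsq_ge0.
Qed.

Lemma innerE f g : L2 f -> L2 g -> inner f g = Complex
  (\int[mu]_(x in `[- pi, pi]) (ReF f x * ReF g x) +
   \int[mu]_(x in `[- pi, pi]) (ImF f x * ImF g x))
  (\int[mu]_(x in `[- pi, pi]) (ImF f x * ReF g x) -
   \int[mu]_(x in `[- pi, pi]) (ReF f x * ImF g x)).
Proof.
move=> /L2P[fr fi] /L2P[gr gi]; rewrite -RintegralD//; try exact: sqintM_integrable.
rewrite -RintegralB//; try exact: sqintM_integrable.
congr Complex; apply: eq_Rintegral => x _; rewrite /ReF /ImF;
  by case: (f x) (g x) => [a b] [c d] /=; ring.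
Qed.

Lemma ReJ f : ReF (Jop f) = Jr (ReF f).
Proof. by apply/funext => x; rewrite /ReF /Jop /Jr; case: ifP. Qed.

Lemma ImJ f : ImF (Jop f) = Jr (ImF f).
Proof. by apply/funext => x; rewrite /ImF /Jop /Jr; case: ifP. Qed.

Lemma JopK f : aeI f (Jop (Jop f)).
Proof.
apply/aeIP; rewrite !ReJ !ImJ.
by split; move: (@ae_neq R 0); apply: filterS => x x0 xpi; rewrite JrK.
Qed.

Lemma L2_Jop f : L2 f -> L2 (Jop f).
Proof. by move=> /L2P[fr fi]; apply/L2P; rewrite ReJ ImJ; split; exact: sqint_J. Qed.

Lemma graphLr_sym u1 h1 u2 h2 : graphLr eps u1 h1 -> graphLr eps u2 h2 ->
  \int[mu]_(x in `[- pi, pi]) (h1 x * Jr u2 x) =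
  \int[mu]_(x in `[- pi, pi]) (u1 x * Jr h2 x).
Proof.
move=> /(graphLr_solves eps0)[v1 s1] /(graphLr_solves eps0)[v2 s2].
exact (solves_sym eps0 s1 s2).
Qed.

(** The complex inner product expands into four real pairings, and [graphLr_sym] applies to each of
    them. *)
Lemma graphL_J_adjoint f g : graphL eps (f, g) -> adjoint (graphL eps) (Jop f, Jop g).
Proof.
move=> fg; have [f2 g2 _ _ _] := fg; have /graphLP[r i] := fg.
split; [exact: L2_Jop|exact: L2_Jop|move=> [y k] yk /=].
have [y2 k2 _ _ _] := yk; have /graphLP[yr yi] := yk.
rewrite !innerE//=; try exact: L2_Jop.
rewrite !ReJ !ImJ !(graphLr_sym yr r) !(graphLr_sym yi i).
by rewrite !(graphLr_sym yr i) !(graphLr_sym yi r).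
Qed.

Lemma graphLr0 : graphLr eps (cst 0) (cst 0).
Proof. exact: solves_graphLr eps0 _ _ _ (solves_cst eps 0). Qed.

(** Tested against real-valued functions, the real and imaginary parts of the adjoint identity
    concern [ReF f] and [ImF f] separately. *)
Lemma adjoint_real f g : adjoint (graphL eps) (f, g) -> forall u v h, solves eps u v h ->
  \int[mu]_(x in `[- pi, pi]) (h x * ReF f x) = \int[mu]_(x in `[- pi, pi]) (u x * ReF g x) /\
  \int[mu]_(x in `[- pi, pi]) (h x * ImF f x) = \int[mu]_(x in `[- pi, pi]) (u x * ImF g x).
Proof.
move=> [/= f2 g2 H] u v h /(solves_graphLr eps0) uh.
have uh' : graphL eps (mkC u (cst 0), mkC h (cst 0)).
  by apply/graphLP; split; [exact: uh|exact: graphLr0].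
have [u2 h2 _ _ _] := uh'; have := H _ uh'; rewrite /= !innerE//.
have z k : \int[mu]_(x in `[- pi, pi]) (cst 0 x * k x) = 0 :> R.
  under eq_Rintegral do rewrite mul0r.
  by rewrite Rintegral_itv_cst// mul0r.
rewrite /ReF /ImF /= in z *.
rewrite !z !addr0 !sub0r => -[-> /oppr_inj ->].
by [].
Qed.

Lemma adjoint_graphL f g : adjoint (graphL eps) (f, g) ->
  exists y, graphL eps (y, Jop g) /\ aeI y (Jop f).
Proof.
move=> fg; have H := adjoint_real fg; have [/= /L2P[fr fi] /L2P[gr gi] _] := fg.
have [y1 [v1 [s1 e1]]] := solves_adjoint eps0 eps2 fr gr (fun u v h s => (H u v h s).1).
have [y2 [v2 [s2 e2]]] := solves_adjoint eps0 eps2 fi gi (fun u v h s => (H u v h s).2).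
exists (mkC y1 y2); split.
  by apply/graphLP; rewrite ReJ ImJ; split; [exact: solves_graphLr s1|exact: solves_graphLr s2].
by apply/aeIP; rewrite ReJ ImJ.
Qed.

Lemma aeI_refl f : aeI f f.
Proof. by apply/aeIP; split; apply: aeW. Qed.

Lemma graphL_closure f g : graphL eps (f, g) -> closure_op (graphL0 eps) (f, g).
Proof.
move=> fg; have [f2 g2 _ _ _] := fg.
have /graphLP[/(graphLr_solves eps0)[v1 s1] /(graphLr_solves eps0)[v2 s2]] := fg.
have e0 n : 0 < harmonic n :> R by rewrite /= invr_gt0.
have [Y1 HY1] := choice (fun n => solves_core eps0 eps2 s1 (e0 n)).
have [G1 HG1] := choice HY1.
have [Y2 HY2] := choice (fun n => solves_core eps0 eps2 s2 (e0 n)).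
have [G2 HG2] := choice HY2.
have gr n : graphL eps (mkC (Y1 n) (Y2 n), mkC (G1 n) (G2 n)).
  by apply/graphLP; split; [case: (HG1 n)|case: (HG2 n)].
have c0 (s : nat -> R) : (forall n, 0 <= s n < harmonic n) -> s n @[n --> \oo] --> (0 : R).
  move=> sh; apply: (squeeze_cvgr _ (cvg_cst 0) cvg_harmonic).
  by apply: nearW => n; have /andP[-> /ltW ->] := sh n.
split=> //; exists (fun n => (mkC (Y1 n) (Y2 n), mkC (G1 n) (G2 n))); split.
- move=> n; split=> //=; have [sY1 pY1 _ _ _] := HG1 n; have [sY2 pY2 _ _ _] := HG2 n.
  by split=> [m x|x]; [split; [exact: sY1|exact: sY2]|rewrite /mkC pY1 pY2].
- apply/dist2_cvg0 => //; first by move=> n; case: (gr n).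
  by split; apply: c0 => n; rewrite nsq_ge0/=; [case: (HG1 n)|case: (HG2 n)].
- apply/dist2_cvg0 => //; first by move=> n; case: (gr n).
  by split; apply: c0 => n; rewrite nsq_ge0/=; [case: (HG1 n)|case: (HG2 n)].
Qed.

Lemma closure_graphL f g : closure_op (graphL0 eps) (f, g) ->
  exists y, graphL eps (y, g) /\ aeI y f.
Proof.
move=> [/= f2 g2 [u [uG uf ug]]].
have uL n : graphL eps ((u n).1, (u n).2) by have [] := uG n; rewrite -surjective_pairing.
have l1 n : L2 (u n).1 by case: (uL n).
have l2 n : L2 (u n).2 by case: (uL n).
have [fr fi] := (dist2_cvg0 l1 f2).1 uf; have [gr gi] := (dist2_cvg0 l2 g2).1 ug.
have /L2P[fr2 fi2] := f2; have /L2P[gr2 gi2] := g2.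
have [v1 s1] := choice (fun n => graphLr_solves eps0 ((graphLP _ _).1 (uL n)).1).
have [v2 s2] := choice (fun n => graphLr_solves eps0 ((graphLP _ _).1 (uL n)).2).
have [y1 [w1 [t1 e1]]] := solves_closed eps0 eps2 s1 fr2 gr2 fr gr.
have [y2 [w2 [t2 e2]]] := solves_closed eps0 eps2 s2 fi2 gi2 fi gi.
exists (mkC y1 y2); split; last exact/aeIP.
by apply/graphLP; split; [exact: solves_graphLr t1|exact: solves_graphLr t2].
Qed.

End ComplexOperator.

Theorem theorem2 (R : realType) (eps : R) :
  0 < eps -> eps < 2 ->
  op_eq (graphL eps) (closure_op (graphL0 eps)) /\
  op_eq (graphL eps) (Jconj (adjoint (graphL eps))).
Proof.
move=> eps0 eps2; split; split.
- move=> [f g] fg; exists (f, g); first exact: graphL_closure.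
  by split; exact: aeI_refl.
- move=> [f g] /(closure_graphL eps0 eps2)[y [yg yf]]; exists (y, g) => //.
  by split=> //; exact: aeI_refl.
(* Members of [Jconj] are literal images under [Jop], so the witness is the double reflection, which
   agrees with [f] and [g] almost everywhere. *)
- move=> [f g] fg; exists (Jop (Jop f), Jop (Jop g)); last by split; exact: JopK.
  by exists (Jop f, Jop g) => //; exact: graphL_J_adjoint.
- move=> _ [[f g] /(adjoint_graphL eps0 eps2)[y [yg yf]] ->] /=.
  by exists (y, Jop g) => //; split=> //; exact: aeI_refl.
Qed.
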